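(* Let $1\le p,q<+\infty$. Then there are constants (independent of $f$) such that for every $f\in\mathcal H(\mathbb D)$: (1) $\rho_{p,q}(f)\asymp\|f\|_{T_p^q(1)}$; (2) $\rho_{p,q}\big(f'(\cdot)(1-|\cdot|)\big)\asymp\big\|f'(\cdot)(1-|\cdot|)\big\|_{T_p^q(1)}$. In particular, $RM(p,q)=AT_p^q(1)$.
   Context: $\mathbb D$ is the open unit disc of $\mathbb C$, $\mathbb T$ its boundary circle, $\mathcal H(\mathbb D)$ the analytic functions on $\mathbb D$, $dA$ area Lebesgue measure, $|d\xi|$ arc-length measure on $\mathbb T$. The notation $a\asymp b$ means $C^{-1}b\le a\le Cb$ for a constant $C>0$ independent of $f$. The expression $f'(\cdot)(1-|\cdot|)$ denotes the function $z\mapsto f'(z)(1-|z|)$. For a measurable function $h$ on $\mathbb D$ and $0<p,q<\infty$, $$\rho_{p,q}(h)=\left(\frac1{2\pi}\int_0^{2\pi}\left(\int_0^1|h(re^{i\theta})|^p\,dr\right)^{q/p}d\theta\right)^{1/q},$$ and $RM(p,q)=\{f\in\mathcal H(\mathbb D):\rho_{p,q}(f)<+\infty\}$. Fix $M>1/2$; for $\xi\in\mathbb T$, $\Gamma(\xi)=\{z\in\mathbb D: |1-\bar\xi z|<M(1-|z|^2)\}$. For $0<p,q,\alpha<\infty$, $T_p^q(\alpha)$ is the set of measurable $h$ on $\mathbb D$ with $$\|h\|_{T_p^q(\alpha)}=\left(\int_{\mathbb T}\left(\int_{\Gamma(\xi)}|h(z)|^p\frac{dA(z)}{(1-|z|^2)^{2-\alpha}}\right)^{q/p}|d\xi|\right)^{1/q}<+\infty,$$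 and $AT_p^q(\alpha)=T_p^q(\alpha)\cap\mathcal H(\mathbb D)$. *)

(* Defs.v *)
From HB Require Import structures.
From mathcomp Require Import all_boot all_order all_algebra.
From mathcomp Require Import complex.
From mathcomp Require Import all_classical all_reals all_analysis.

Set Implicit Arguments.
Unset Strict Implicit.
Unset Printing Implicit Defensive.

Import Order.TTheory GRing.Theory Num.Theory.
Import numFieldNormedType.Exports.
Import ComplexField.Normc.

Local Open Scope classical_set_scope.
Local Open Scope ring_scope.
Local Open Scope complex_scope.

Section RadialTent.
Context {R : realType}.
Implicit Types (p q al M r t : R) (z xi : R[i]) (f h : R[i] -> R[i]).

(* The absolute value used throughout is [normc : R[i] -> R], which is
   R-valued, unlike the R[i]-valued [`|_|]. *)

Definition disc : set R[i] := [set z | normc z < 1].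

(* Functions on the disc are represented by total functions on R[i]; all the
   notions below depend only on the values taken in [disc], because [disc] is
   open (for the derivative) and all integrals range over subsets of it. *)

(* [R[i]^o] selects the structure of normed space of R[i] over itself, so that
   this is complex differentiability. *)
Definition analytic_disc : set (R[i] -> R[i]) :=
  fun f => forall z, disc z -> derivable (f : R[i]^o -> R[i]^o) z 1.

Definition cderiv f : R[i] -> R[i] := derive1 (f : R[i]^o -> R[i]^o).

Definition cderiv_weighted f : R[i] -> R[i] :=
  fun z => cderiv f z * (1 - normc z)%:C.

Definition polar r t : R[i] := (r * cos t) +i* (r * sin t).

Definition of_plane (w : R * R) : R[i] := w.1 +i* w.2.

(* Integral against area measure: two-dimensional Lebesgue measure,
   transported along the identification of R * R with R[i]. *)
Definition area_integral (A : set R[i]) (g : R[i] -> \bar R) : \bar R :=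
  (\int[(@lebesgue_measure R \x @lebesgue_measure R)%E]_(w in of_plane @^-1` A)
     g (of_plane w))%E.

(* Integral against the arc-length measure of the unit circle. *)
Definition arc_integral (g : R[i] -> \bar R) : \bar R :=
  (\int[@lebesgue_measure R]_(t in `[0%R, (2 * pi)%R]) g (polar 1 t))%E.

(* A complex function is (Borel) measurable when its real and imaginary
   parts are. *)
Definition measurable_disc h : Prop :=
  measurable_fun (of_plane @^-1` disc) (fun w : R * R => complex.Re (h (of_plane w)))
  /\ measurable_fun (of_plane @^-1` disc) (fun w : R * R => complex.Im (h (of_plane w))).

(* All norms are valued in the extended reals: they are +oo exactly when the
   function does not belong to the space. *)
Definition rho p q h : \bar R :=
  ((((2 * pi)^-1)%R%:E *
   \int[@lebesgue_measure R]_(t in `[0%R, (2 * pi)%R])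
     ((\int[@lebesgue_measure R]_(r in `[0%R, 1%R[)
        (normc (h (polar r t)) `^ p)%R%:E) `^ (q / p)%R)) `^ (q^-1)%R)%E.

Definition RM p q : set (R[i] -> R[i]) :=
  [set f | analytic_disc f /\ (rho p q f < +oo)%E].

Definition stolz M xi : set R[i] :=
  [set z | disc z /\ normc (1 - conjc xi * z) < M * (1 - normc z ^+ 2)].

Definition tent_norm M p q al h : \bar R :=
  (arc_integral (fun xi =>
     (area_integral (stolz M xi) (fun z =>
        (normc (h z) `^ p / (1 - normc z ^+ 2) `^ (2 - al))%R%:E)) `^ (q / p)%R)
  `^ (q^-1)%R)%E.

Definition tent M p q al : set (R[i] -> R[i]) :=
  [set h | measurable_disc h /\ (tent_norm M p q al h < +oo)%E].

Definition AT M p q al : set (R[i] -> R[i]) :=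
  tent M p q al `&` analytic_disc.

(* a and b are comparable on S; the constant does not depend on the element
   of S. Both sides may be +oo. *)
Definition asymp_on {T : Type} (S : set T) (a b : T -> \bar R) : Prop :=
  exists C : R, 0 < C /\
    forall x, S x -> ((C^-1)%R%:E * b x <= a x)%E /\ (a x <= C%:E * b x)%E.

End RadialTent.

(* Main.v *)
(* Both norms are compared through mean value inequalities for |g|^(1/2), where
   g is f or f'; these follow from Goursat's theorem, which also yields that f'
   is analytic.

   Tent bounded by radial. In the k-th dyadic ring 2^-(k+1) < 1-|z| <= 2^-k, the
   value of |g|^(1/2) at a point of the Stolz region at theta is at most an
   average, over an arc of length comparable to 2^-k around theta, of the radial
   averages a_k of |g|^(1/2) over a slightly larger ring. By the one-third trick
   such arcs lie in an interval of one of two dyadic grids, so the average is at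
   most a sum of two conditional expectations of a_k. Stein's inequality in
   L^(2q)(l^(2p)) (the exponents exceed 1 thanks to the square root) removes the
   conditional expectations, and Jensen's inequality bounds the remaining sum of
   a_k^(2p) by the radial integral of |g|^p.

   Radial bounded by tent. For r near 1 a square of side comparable to 1-r around
   the point r xi lies in the Stolz region at xi, because M > 1/2; the mean value
   inequality on it bounds the outer part of the radial integral. The inner part
   is bounded by the maximum principle, from an annulus on which |g| is
   controlled by the tent integrals over nearby boundary points. *)


From HB Require Import structures.
Require Import Defs.
From mathcomp Require Import all_boot all_order all_algebra.
From mathcomp Require Import complex.
From mathcomp Require Import all_classical all_reals all_analysis.
From mathcomp Require Import measurable_realfun ring lra.
Set Implicit Arguments.
Unset Strict Implicit.
Unset Printing Implicit Defensive.
Import Order.TTheory GRing.Theory Num.Theory.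
Import numFieldNormedType.Exports.
Import ComplexField.Normc.
Local Open Scope classical_set_scope.
Local Open Scope ring_scope.
Local Open Scope complex_scope.
Local Notation Re := (@complex.Re _).
Local Notation Im := (@complex.Im _).

(** * Complex differentiability *)

Section ComplexDifferentiability.
Context {R : realType}.
Implicit Types (z w l a : R[i]) (F G : R[i] -> R[i]).

(** In Cauchy's formula the integral of [dz / (z - a)] stays as an unevaluated factor; only a
    positive lower bound for its modulus is used. Polar averages come from squares in the coordinate
    [ln r +i* t]: composing with the exponential keeps holomorphy, and Tonelli on a product of
    intervals replaces a change of variables in the plane. The second assertion concerns
    [f'(z) (1 - |z|)], which is not holomorphic. All estimates therefore carry a pair [G], [h] with
    [|h| = |G| (1 - |z|)^kappa]: mean values and the maximum principle are applied to [G], while the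
    weight is nearly constant on a dyadic ring. The cases [kappa = 0] and [kappa = 1] give the two
    assertions. Stein's inequality is proved by absorbing half of its left side, which requires that
    side to be finite. Hence it is stated for finitely many bounded functions, with a constant that
    does not see the bounds, and infinite sums are reached by monotone convergence. *)

Lemma ler_normcD z w : normc (z + w) <= normc z + normc w.
Proof. exact: (@le_normcD R z w). Qed.

Lemma normc_opp z : normc (- z) = normc z.
Proof. exact: (@normcN R z). Qed.

Lemma normcBC z w : normc (z - w) = normc (w - z).
Proof. by rewrite -normc_opp opprB. Qed.

Lemma normc_ge0 z : 0 <= normc z.
Proof. by case: z => a b; exact: sqrtr_ge0. Qed.

Lemma normc_real (x : R) : normc x%:C = `|x|.
Proof. by rewrite /normc /= expr0n /= addr0 sqrtr_sqr. Qed.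

Lemma normc_i : normc ('i : R[i]) = 1.
Proof. by rewrite /normc /= expr0n /= expr1n add0r sqrtr1. Qed.

Lemma ler_normcB z w : normc z - normc w <= normc (z - w).
Proof. by rewrite lerBlDr (le_trans _ (ler_normcD _ _))// subrK. Qed.

Lemma normr_Re_le z : `|Re z| <= normc z.
Proof.
by case: z => a b /=; rewrite -sqrtr_sqr ler_wsqrtr// lerDl sqr_ge0.
Qed.

Lemma normr_Im_le z : `|Im z| <= normc z.
Proof.
by case: z => a b /=; rewrite -sqrtr_sqr ler_wsqrtr// lerDr sqr_ge0.
Qed.

Lemma normc_le_ReIm z : normc z <= `|Re z| + `|Im z|.
Proof.
have -> : z = (Re z)%:C + 'i * (Im z)%:C by rewrite {1}(complexE z).
rewrite (le_trans (ler_normcD _ _))// normcM normc_i mul1r !normc_real.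
by rewrite /= !(mul0r, mul1r, subr0, addr0, add0r).
Qed.

Lemma normc_gt0 z : (0 < normc z) = (z != 0).
Proof.
rewrite lt_neqAle normc_ge0 andbT eq_sym.
apply/negb_inj; rewrite !negbK; apply/eqP/eqP => [/eq0_normc//|->].
exact: normc0.
Qed.

Lemma normr_normc z : `|z| = (normc z)%:C.
Proof. by rewrite normc_def /normc; case: z. Qed.

(** The increment is multiplied out, so that [w = z] is no exception and real-valued moduli suffice;
    [is_derive_cdiff] identifies this with the library derivative. *)
Definition cdiff F z l := forall e, 0 < e ->
  exists2 d, 0 < d & forall w, normc (w - z) < d ->
    normc (F w - F z - l * (w - z)) <= e * normc (w - z).

Definition holo F z := exists l, cdiff F z l.

Definition ccont F z := forall e, 0 < e ->
  exists2 d, 0 < d & forall w, normc (w - z) < d -> normc (F w - F z) < e.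

Lemma holo_ccont F z : holo F z -> ccont F z.
Proof.
move=> [l Fl] e e0; have [d d0 Hd] := Fl 1 ltr01.
have l1 : 0 < normc l + 1 by rewrite ltr_wpDl ?normc_ge0.
exists (Num.min d (e / (normc l + 1))); first by rewrite lt_min d0 divr_gt0.
move=> w; rewrite lt_min => /andP[/Hd wd we].
rewrite -[X in normc X](subrK (l * (w - z))).
rewrite (le_lt_trans (ler_normcD _ _))// normcM.
rewrite (@le_lt_trans _ _ ((normc l + 1) * normc (w - z)))//.
  by rewrite [leRHS]mulrDl addrC lerD2l.
by rewrite mulrC -ltr_pdivlMr.
Qed.

Lemma is_derive_cdiff F z l :
  is_derive (z : R[i]^o) 1 (F : R[i]^o -> R[i]^o) l <-> cdiff F z l.
Proof.
split.
- case=> /cvg_ex[l' Fl'] Dl.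
  have {Dl} ll' : l' = l by rewrite -Dl; apply/esym/cvg_lim => //; exact: norm_hausdorff.
  rewrite {}ll' in Fl'; move: Fl' => /cvgrPdist_le Fl e e0.
  have e0' : (0 : R[i]) < e%:C by rewrite ltcR.
  have /nbhs_ballP[d /= d0 Hd] := Fl _ e0'.
  have dE : d = (Re d)%:C by rewrite RRe_real// gtr0_real.
  exists (Re d); first by move: d0; rewrite dE ltcR.
  move=> w wd; have [->|wz] := eqVneq w z.
    by rewrite !subrr mulr0 subrr normc0 mulr0.
  have := Hd (w - z).
  rewrite /ball /= sub0r normrN normr_normc dE ltcR => /(_ wd).
  rewrite subr_eq0 => /(_ wz); rewrite /GRing.scale /= mulr1 subrK.
  rewrite normr_normc lecR => H.
  have wz0 : w - z != 0 by rewrite subr_eq0.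
  rewrite -(ler_pdivrMr _ _ _).
  rewrite -normcV -normcM mulrBl mulfK// normcBC mulrC.
  exact: H.
  by rewrite normc_gt0.
- move=> Fl; suff H : (fun h : R[i]^o => h^-1 *: ((F \o shift z) (h *: (1 : R[i]^o)) - F z : R[i]^o)) @ 0^' --> (l : R[i]^o).
    by apply: DeriveDef; [apply/cvg_ex; exists l|apply/cvg_lim => //; exact: norm_hausdorff].
  apply/cvgrPdist_le => e e0.
  have eE : e = (Re e)%:C by rewrite RRe_real// gtr0_real.
  have [|d d0 Hd] := Fl (Re e); first by move: e0; rewrite eE ltcR.
  apply/nbhs_ballP; exists d%:C; first by rewrite /= ltcR.
  move=> h; rewrite /ball /= sub0r normrN normr_normc ltcR => hd h0.
  rewrite /GRing.scale /= mulr1.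
  have := Hd (h + z); rewrite addrK => /(_ hd) H.
  rewrite normr_normc eE lecR.
  have h1 : 0 < normc h by rewrite normc_gt0.
  rewrite -(ler_pM2r h1); apply: le_trans H.
  by rewrite -normcM mulrBl mulrAC mulVf// mul1r normcBC.
Qed.

Lemma cdiff_cderiv F z l : cdiff F z l -> cderiv F z = l.
Proof. by move=> /is_derive_cdiff[_ <-]; rewrite /cderiv derive1E. Qed.

Lemma derivable_holo F z :
  derivable (F : R[i]^o -> R[i]^o) z 1 <-> holo F z.
Proof.
split; last by case=> l /is_derive_cdiff[].
by move=> Fz; exists ('D_1 (F : R[i]^o -> R[i]^o) z); apply/is_derive_cdiff; exact: derivableP.
Qed.

Lemma holo_cderiv F z : holo F z -> cdiff F z (cderiv F z).
Proof. by case=> l Fl; rewrite (cdiff_cderiv Fl). Qed.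

Lemma cdiffM F G z l m : cdiff F z l -> cdiff G z m ->
  cdiff (fun w => F w * G w) z (F z * m + G z * l).
Proof.
by move=> /is_derive_cdiff Fl /is_derive_cdiff Gm; apply/is_derive_cdiff; exact: is_deriveM.
Qed.

Lemma cdiff_near F G z l : (exists2 d, 0 < d & forall w, normc (w - z) < d -> F w = G w) ->
  cdiff F z l -> cdiff G z l.
Proof.
move=> [d d0 FG] Fl e e0; have [d' d'0 Hd] := Fl _ e0.
exists (Num.min d d'); first by rewrite lt_min d0.
move=> w; rewrite lt_min => /andP[wd wd']; rewrite -FG// -FG; first exact: Hd.
by rewrite subrr normc0.
Qed.

Lemma holoP F z : holo F z <-> differentiable (F : R[i]^o -> R[i]^o) (z : R[i]^o).
Proof. by rewrite -derivable_holo; exact: derivable1_diffP. Qed.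

Lemma holoD F G z : holo F z -> holo G z -> holo (fun w => F w + G w) z.
Proof. by rewrite !holoP; exact: differentiableD. Qed.

Lemma holoB F G z : holo F z -> holo G z -> holo (fun w => F w - G w) z.
Proof. by rewrite !holoP; exact: differentiableB. Qed.

Lemma holoM F G z : holo F z -> holo G z -> holo (fun w => F w * G w) z.
Proof. by rewrite !holoP; exact: differentiableM. Qed.

Lemma holoV F z : holo F z -> F z != 0 -> holo (fun w => (F w)^-1) z.
Proof. by rewrite !holoP; exact: differentiableV. Qed.

Lemma holo_cst c z : holo (fun _ => c) z.
Proof. by rewrite !holoP; exact: differentiable_cst. Qed.

Lemma holo_id z : holo id z.
Proof. by rewrite -derivable_holo; exact: derivable_id. Qed.

Lemma holo_comp F G z : holo F z -> holo G (F z) -> holo (G \o F) z.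
Proof. by rewrite !holoP; exact: differentiable_comp. Qed.

End ComplexDifferentiability.

(** * Integrals of complex functions over real segments *)

Section ComplexIntegral.
Context {R : realType}.
Local Notation mu := (@lebesgue_measure R).
Implicit Types (a b m x : R) (z w l : R[i]) (F G : R -> R[i]).

(** The point [y] is not confined to [[a, b]]: the integrands are restrictions of functions
    continuous at points of the plane, and this form passes to subintervals at once. *)
Definition pcont a b F := forall x, a <= x <= b -> forall e, 0 < e ->
  exists2 d, 0 < d & forall y, `|y - x| < d -> normc (F y - F x) < e.

Definition cint a b F : R[i] :=
  (\int[mu]_(x in `[a, b]) Re (F x)) +i* (\int[mu]_(x in `[a, b]) Im (F x)).

(** Real part, imaginary part and modulus are all 1-Lipschitz, so one argument serves the three. *)
Lemma pcont_lip (h : R[i] -> R) a b F : (forall z w, `|h z - h w| <= normc (z - w)) ->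
  pcont a b F -> {within `[a, b], continuous (h \o F)}.
Proof.
move=> hl Fc; apply: continuous_in_subspaceT => x; rewrite inE /= in_itv /= => xab.
apply/cvgrPdist_lt => e e0; have [d d0 Hd] := Fc _ xab _ e0.
apply/nbhs_ballP; exists d => // y; rewrite /ball /= => xy.
rewrite (le_lt_trans (hl _ _))// normcBC Hd// distrC//.
Qed.

Lemma complex_ReB z w : Re (z - w) = Re z - Re w. Proof. by case: z w => ? ? []. Qed.
Lemma complex_ImB z w : Im (z - w) = Im z - Im w. Proof. by case: z w => ? ? []. Qed.
Lemma complex_ReD z w : Re (z + w) = Re z + Re w. Proof. by case: z w => ? ? []. Qed.
Lemma complex_ImD z w : Im (z + w) = Im z + Im w. Proof. by case: z w => ? ? []. Qed.
Lemma complex_ReM z w : Re (z * w) = Re z * Re w - Im z * Im w.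
Proof. by case: z w => ? ? []. Qed.
Lemma complex_ImM z w : Im (z * w) = Re z * Im w + Im z * Re w.
Proof. by case: z w => ? ? []. Qed.

Lemma pcont_Re a b F : pcont a b F -> {within `[a, b], continuous (Re \o F)}.
Proof. by apply: pcont_lip => z w; rewrite -complex_ReB; exact: normr_Re_le. Qed.

Lemma pcont_Im a b F : pcont a b F -> {within `[a, b], continuous (Im \o F)}.
Proof. by apply: pcont_lip => z w; rewrite -complex_ImB; exact: normr_Im_le. Qed.

Lemma pcont_normc a b F : pcont a b F -> {within `[a, b], continuous (@normc R \o F)}.
Proof.
apply: pcont_lip => z w; rewrite ler_norml ler_normcB andbT lerNl opprB normcBC.
exact: ler_normcB.
Qed.

Lemma within_integrable a b (f : R -> R) :
  {within `[a, b], continuous f} -> mu.-integrable `[a, b] (EFin \o f).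
Proof. by apply: continuous_compact_integrable; exact: segment_compact. Qed.

Lemma integrable_Re a b F : pcont a b F -> mu.-integrable `[a, b] (EFin \o (Re \o F)).
Proof. by move=> /pcont_Re; exact: within_integrable. Qed.

Lemma integrable_Im a b F : pcont a b F -> mu.-integrable `[a, b] (EFin \o (Im \o F)).
Proof. by move=> /pcont_Im; exact: within_integrable. Qed.

Lemma Rintegral_split a m b (f : R -> R) : a <= m -> m <= b ->
  mu.-integrable `[a, b] (EFin \o f) ->
  \int[mu]_(x in `[a, b]) f x =
  \int[mu]_(x in `[a, m]) f x + \int[mu]_(x in `[m, b]) f x.
Proof.
move=> am mb fi.
have mbi : mu.-integrable [set` Interval (BRight m) (BRight b)] (EFin \o f).
  by apply: integrableS fi => //; apply: subset_itvr; rewrite bnd_simp.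
rewrite -(@Rintegral_itv_obnd_cbnd _ m)//.
rewrite -(@Rintegral_itvB R f (BLeft a) (BRight b) m fi) ?bnd_simp//.
by rewrite addrC subrK.
Qed.

Lemma eq_cint a b F G : (forall x, a <= x <= b -> F x = G x) ->
  cint a b F = cint a b G.
Proof.
move=> FG; congr (_ +i* _); apply: eq_Rintegral => x;
  by rewrite inE /= in_itv /= => /FG ->.
Qed.

Lemma cint_split a m b F : a <= m -> m <= b -> pcont a b F ->
  cint a b F = cint a m F + cint m b F.
Proof.
move=> am mb Fc; rewrite /cint (@Rintegral_split a m b)//; last exact: integrable_Re.
by rewrite (@Rintegral_split a m b)//; exact: integrable_Im.
Qed.

Lemma cintD a b F G : pcont a b F -> pcont a b G ->
  cint a b (fun x => F x + G x) = cint a b F + cint a b G.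
Proof.
move=> Fc Gc; rewrite /cint; congr (_ +i* _).
- under eq_Rintegral do rewrite complex_ReD.
  by rewrite RintegralD//; exact: integrable_Re.
- under eq_Rintegral do rewrite complex_ImD.
  by rewrite RintegralD//; exact: integrable_Im.
Qed.

Lemma pcontD a b F G : pcont a b F -> pcont a b G -> pcont a b (fun x => F x + G x).
Proof.
move=> Fc Gc x xab e e0.
have e20 : 0 < e / 2 by rewrite divr_gt0.
have [d d0 Hd] := Fc _ xab _ e20; have [d' d'0 Hd'] := Gc _ xab _ e20.
exists (Num.min d d'); first by rewrite lt_min d0.
move=> y; rewrite lt_min => /andP[/Hd h1 /Hd' h2].
rewrite opprD addrACA (le_lt_trans (ler_normcD _ _))//.
by rewrite [ltRHS](splitr e) ltrD.
Qed.

Lemma cintM a b F l : pcont a b F -> cint a b (fun x => l * F x) = l * cint a b F.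
Proof.
move=> Fc; have iR := integrable_Re Fc; have iI := integrable_Im Fc.
have mab : measurable (`[a, b]%classic : set R) by [].
have -> : l * cint a b F = (Re l * Re (cint a b F) - Im l * Im (cint a b F)) +i*
    (Re l * Im (cint a b F) + Im l * Re (cint a b F)) by case: l (cint a b F) => ? ? [].
rewrite /cint /=; congr (_ +i* _).
- under eq_Rintegral do rewrite complex_ReM.
  rewrite RintegralB//; last 2 first.
  + exact: (@integrableZl _ _ _ mu _ mab _ (EFin \o (Re \o F))).
  + exact: (@integrableZl _ _ _ mu _ mab _ (EFin \o (Im \o F))).
  by rewrite !RintegralZl.
- under eq_Rintegral do rewrite complex_ImM.
  rewrite RintegralD//; last 2 first.
  + exact: (@integrableZl _ _ _ mu _ mab _ (EFin \o (Im \o F))).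
  + exact: (@integrableZl _ _ _ mu _ mab _ (EFin \o (Re \o F))).
  by rewrite !RintegralZl.
Qed.

Lemma lebesgue_itvcc a b : a <= b -> mu `[a, b]%classic = (b - a)%:E.
Proof.
rewrite le_eqVlt => /predU1P[->|ab].
  by rewrite set_itv1 lebesgue_measure_set1 subrr.
by rewrite lebesgue_measure_itv /= lte_fin ab EFinB.
Qed.

Lemma Rintegral_itv_cst a b (r : R) : a <= b ->
  \int[mu]_(x in `[a, b]) r = r * (b - a).
Proof.
by move=> ab; rewrite Rintegral_cst//; congr *%R; rewrite -[RHS]/(fine (b - a)%:E); congr fine; exact: lebesgue_itvcc.
Qed.

Lemma cint_cst a b l : a <= b -> cint a b (fun=> l) = l * (b - a)%:C.
Proof.
move=> ab; rewrite /cint !Rintegral_itv_cst//.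
by case: l => u v /=; simpc.
Qed.

Lemma normr_Rintegral_le a b (f : R -> R) B : a <= b ->
  {within `[a, b], continuous f} -> (forall x, a <= x <= b -> `|f x| <= B) ->
  `|\int[mu]_(x in `[a, b]) f x| <= B * (b - a).
Proof.
move=> ab fc fB; have fi := within_integrable fc.
apply: (le_trans (le_normr_Rintegral _ fi)) => //.
have <- : \int[mu]_(x in `[a, b]) B = B * (b - a).
  exact: Rintegral_itv_cst.
apply: le_Rintegral => //.
- exact: (integrable_abse fi).
- apply: within_integrable; apply: continuous_subspaceT => x; exact: cvg_cst.
Qed.

(** The factor 2 is the price of bounding real and imaginary parts separately; it is harmless, since
    no sharp constant is ever sought. *)
Lemma normc_cint_le a b F B : a <= b -> pcont a b F ->
  (forall x, a <= x <= b -> normc (F x) <= B) ->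
  normc (cint a b F) <= 2 * B * (b - a).
Proof.
move=> ab Fc FB; rewrite (le_trans (normc_le_ReIm _))//= -mulrA mulr_natl mulr2n.
rewrite lerD//; apply: normr_Rintegral_le => //.
- exact: pcont_Re.
- by move=> x /FB; apply: le_trans; exact: normr_Re_le.
- exact: pcont_Im.
- by move=> x /FB; apply: le_trans; exact: normr_Im_le.
Qed.

Lemma normc_cint_le_integral a b F : a <= b -> pcont a b F ->
  normc (cint a b F) <= 2 * \int[mu]_(x in `[a, b]) normc (F x).
Proof.
move=> ab Fc; rewrite (le_trans (normc_le_ReIm _))//= mulr_natl mulr2n.
have iN := within_integrable (pcont_normc Fc).
have iR := integrable_Re Fc; have iI := integrable_Im Fc.
rewrite lerD//.
- apply: (le_trans (le_normr_Rintegral _ iR)) => //.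
  apply: le_Rintegral => //; first exact: (integrable_abse iR).
  by move=> x _; exact: normr_Re_le.
- apply: (le_trans (le_normr_Rintegral _ iI)) => //.
  apply: le_Rintegral => //; first exact: (integrable_abse iI).
  by move=> x _; exact: normr_Im_le.
Qed.

End ComplexIntegral.

(** * Cauchy's theorem and formula *)

Section Goursat.
Context {R : realType}.
Implicit Types (x y : R) (z w l a : R[i]) (F G : R[i] -> R[i]).

Definition crect x1 x2 y1 y2 : set R[i] :=
  [set z | x1 <= Re z <= x2 /\ y1 <= Im z <= y2].

(* Integral of [F dz] along the positively oriented boundary of
   [crect x1 x2 y1 y2], opposite sides being grouped. *)
Definition bint F x1 x2 y1 y2 : R[i] :=
  cint x1 x2 (fun x => F (x +i* y1) - F (x +i* y2)) +
  'i * cint y1 y2 (fun y => F (x2 +i* y) - F (x1 +i* y)).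

Lemma complexB x y x' y' : (x +i* y) - (x' +i* y') = (x - x') +i* (y - y').
Proof. by []. Qed.

Lemma pcont_horizontal F x1 x2 y : (forall x, x1 <= x <= x2 -> ccont F (x +i* y)) ->
  pcont x1 x2 (fun x => F (x +i* y)).
Proof.
move=> Fc x /Fc xF e /xF[d d0 Hd]; exists d => // x' xx'; apply: Hd.
by rewrite complexB subrr complexr0 normc_real.
Qed.

Lemma pcont_vertical F x y1 y2 : (forall y, y1 <= y <= y2 -> ccont F (x +i* y)) ->
  pcont y1 y2 (fun y => F (x +i* y)).
Proof.
move=> Fc y /Fc yF e /yF[d d0 Hd]; exists d => // y' yy'; apply: Hd.
by rewrite complexB subrr /normc expr0n add0r sqrtr_sqr.
Qed.

Lemma pcontN x1 x2 (f : R -> R[i]) : pcont x1 x2 f -> pcont x1 x2 (fun x => - f x).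
Proof.
by move=> fc x xab e /(fc _ xab)[d d0 Hd]; exists d => // y /Hd; rewrite -opprD normc_opp.
Qed.

Lemma pcontB x1 x2 (f g : R -> R[i]) : pcont x1 x2 f -> pcont x1 x2 g ->
  pcont x1 x2 (fun x => f x - g x).
Proof. by move=> fc gc; apply: pcontD => //; exact: pcontN. Qed.

(** Continuity of integrands is asked for on the boundary alone, so that kernels with a pole inside
    the rectangle are admissible. *)
Definition crbd x1 x2 y1 y2 : set R[i] :=
  [set z | crect x1 x2 y1 y2 z /\ (Re z = x1 \/ Re z = x2 \/ Im z = y1 \/ Im z = y2)].

Lemma crbd_h F x1 x2 y1 y2 y : (forall z, crbd x1 x2 y1 y2 z -> ccont F z) ->
  y1 <= y <= y2 -> y = y1 \/ y = y2 -> pcont x1 x2 (fun x => F (x +i* y)).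
Proof.
move=> Fc y12 yy; apply: pcont_horizontal => x xx; apply: Fc; split => //=.
by right; right.
Qed.

Lemma crbd_v F x1 x2 y1 y2 x : (forall z, crbd x1 x2 y1 y2 z -> ccont F z) ->
  x1 <= x <= x2 -> x = x1 \/ x = x2 -> pcont y1 y2 (fun y => F (x +i* y)).
Proof.
move=> Fc x12 [|] xx; apply: pcont_vertical => y yy; apply: Fc; split => //=;
  by [|left|right|right; left|right; right; left|right; right; right].
Qed.

(** The cut at [m] is traversed once in each direction, and the two contributions cancel. *)
Lemma bint_split_x F x1 x2 y1 y2 m : y1 <= y2 -> x1 <= m <= x2 ->
  (forall z, crbd x1 m y1 y2 z -> ccont F z) ->
  (forall z, crbd m x2 y1 y2 z -> ccont F z) ->
  bint F x1 x2 y1 y2 = bint F x1 m y1 y2 + bint F m x2 y1 y2.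
Proof.
move=> y12 /andP[x1m mx2] Fl Fr; have x12 := le_trans x1m mx2.
have h y : y = y1 \/ y = y2 -> pcont x1 x2 (fun x => F (x +i* y)).
  move=> yy; apply: pcont_horizontal => x /andP[xl xr].
  have yyy : y1 <= y <= y2 by case: yy => ->; rewrite lexx y12.
  have [xm|/ltW mx] := leP x m.
    by apply: Fl; split; [split => //=; rewrite xl|right; right].
  by apply: Fr; split; [split => //=; rewrite mx|right; right].
rewrite /bint (@cint_split _ x1 m x2)//; last first.
  by apply: pcontB; apply: h; [left|right].
rewrite addrACA -mulrDr; congr (_ + 'i * _).
rewrite addrC -cintD; last 2 first.
- by apply: pcontB; [apply: crbd_v Fr _ _|apply: crbd_v Fr _ _]; rewrite ?lexx ?mx2; by [|left|right].
- by apply: pcontB; [apply: crbd_v Fl _ _|apply: crbd_v Fl _ _]; rewrite ?lexx ?x1m; by [|left|right].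
by apply: eq_cint => y _; rewrite addrA subrK.
Qed.

Lemma bint_split_y F x1 x2 y1 y2 m : x1 <= x2 -> y1 <= m <= y2 ->
  (forall z, crbd x1 x2 y1 m z -> ccont F z) ->
  (forall z, crbd x1 x2 m y2 z -> ccont F z) ->
  bint F x1 x2 y1 y2 = bint F x1 x2 y1 m + bint F x1 x2 m y2.
Proof.
move=> x12 /andP[y1m my2] Fl Fr; have y12 := le_trans y1m my2.
have h x : x = x1 \/ x = x2 -> pcont y1 y2 (fun y => F (x +i* y)).
  move=> xx; apply: pcont_vertical => y /andP[yl yr].
  have xxx : x1 <= x <= x2 by case: xx => ->; rewrite lexx x12.
  have [ym|/ltW my] := leP y m.
    by apply: Fl; split => /=; [split => //=; rewrite yl|case: xx; by [|left|right|right; left|right; right; left|right; right; right]].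
  by apply: Fr; split => /=; [split => //=; rewrite my|case: xx; by [|left|right|right; left|right; right; left|right; right; right]].
rewrite /bint (@cint_split _ y1 m y2)//; last first.
  by apply: pcontB; apply: h; [right|left].
rewrite addrACA -mulrDr; congr (_ + 'i * _).
rewrite -cintD; last 2 first.
- by apply: pcontB; [apply: crbd_h Fl _ _|apply: crbd_h Fl _ _]; rewrite ?lexx ?y1m; by [|left|right].
- by apply: pcontB; [apply: crbd_h Fr _ _|apply: crbd_h Fr _ _]; rewrite ?lexx ?my2; by [|left|right].
by apply: eq_cint => y _; rewrite addrA subrK.
Qed.

Section Boundary.
Variables (x1 x2 y1 y2 : R).
Hypotheses (x12 : x1 <= x2) (y12 : y1 <= y2).

Lemma crbd_pcont F : (forall z, crbd x1 x2 y1 y2 z -> ccont F z) ->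
  pcont x1 x2 (fun x => F (x +i* y1) - F (x +i* y2)) /\
  pcont y1 y2 (fun y => F (x2 +i* y) - F (x1 +i* y)).
Proof.
by move=> Fc; split; apply: pcontB; (apply: crbd_h Fc _ _ || apply: crbd_v Fc _ _);
  rewrite ?lexx ?x12 ?y12; by [|left|right].
Qed.

Lemma crbd_sides z : (exists2 x, x1 <= x <= x2 & z = x +i* y1 \/ z = x +i* y2) \/
  (exists2 y, y1 <= y <= y2 & z = x1 +i* y \/ z = x2 +i* y) -> crbd x1 x2 y1 y2 z.
Proof.
by move=> [] [t tt] [] ->; split => /=; try split; rewrite //= ?lexx ?x12 ?y12;
  by [|left|right|right; left|right; right; left|right; right; right].
Qed.

Lemma normc_bint_le F B : (forall z, crbd x1 x2 y1 y2 z -> ccont F z) ->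
  (forall z, crbd x1 x2 y1 y2 z -> normc (F z) <= B) ->
  normc (bint F x1 x2 y1 y2) <= 4 * B * ((x2 - x1) + (y2 - y1)).
Proof.
move=> Fc FB; have [ph pv] := crbd_pcont Fc.
have BB z w : crbd x1 x2 y1 y2 z -> crbd x1 x2 y1 y2 w ->
    normc (F z - F w) <= 2 * B.
  move=> /FB zB /FB wB; rewrite (le_trans (ler_normcD _ _))// normc_opp.
  by rewrite mulr_natl mulr2n lerD.
rewrite (le_trans (ler_normcD _ _))// normcM normc_i mul1r mulrDr.
(* One factor 2 bounds the difference of the values on opposite sides, the other comes from
   [normc_cint_le]. *)
rewrite (_ : 4 * B = 2 * (2 * B)); last by ring.
apply: lerD; apply: normc_cint_le => // t tt; apply: BB; apply: crbd_sides;
  by [left; exists t => //; left|left; exists t => //; right|right; exists t => //; left|right; exists t => //; right].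
Qed.

Lemma bintD F G : (forall z, crbd x1 x2 y1 y2 z -> ccont F z) ->
  (forall z, crbd x1 x2 y1 y2 z -> ccont G z) ->
  bint (fun z => F z + G z) x1 x2 y1 y2 = bint F x1 x2 y1 y2 + bint G x1 x2 y1 y2.
Proof.
move=> Fc Gc; have [Fh Fv] := crbd_pcont Fc; have [Gh Gv] := crbd_pcont Gc.
rewrite /bint addrACA -mulrDr -!cintD//.
rewrite (@eq_cint _ x1 x2 _ (fun x => F (x +i* y1) - F (x +i* y2) + (G (x +i* y1) - G (x +i* y2)))).
rewrite (@eq_cint _ y1 y2 _ (fun y => F (x2 +i* y) - F (x1 +i* y) + (G (x2 +i* y) - G (x1 +i* y)))) //.
  by move=> y _; rewrite opprD addrACA.
by move=> x _; rewrite opprD addrACA.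
Qed.

Lemma bintM F l : (forall z, crbd x1 x2 y1 y2 z -> ccont F z) ->
  bint (fun z => l * F z) x1 x2 y1 y2 = l * bint F x1 x2 y1 y2.
Proof.
move=> Fc; have [Fh Fv] := crbd_pcont Fc.
rewrite /bint mulrDr mulrCA.
rewrite (@eq_cint _ x1 x2 _ (fun x => l * (F (x +i* y1) - F (x +i* y2)))); last first.
  by move=> x _; rewrite mulrBr.
rewrite (@eq_cint _ y1 y2 _ (fun y => l * (F (x2 +i* y) - F (x1 +i* y)))); last first.
  by move=> y _; rewrite mulrBr.
by rewrite !cintM.
Qed.

Lemma eq_bint F G : (forall z, crbd x1 x2 y1 y2 z -> F z = G z) ->
  bint F x1 x2 y1 y2 = bint G x1 x2 y1 y2.
Proof.
move=> FG; rewrite /bint; congr (_ + 'i * _); apply: eq_cint => t tt;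
  (rewrite !FG//; apply: crbd_sides);
  by [left; exists t => //; left|left; exists t => //; right|right; exists t => //; left|right; exists t => //; right].
Qed.

End Boundary.

(** Between opposite sides an affine function changes by a constant, so both grouped integrals are
    explicit, and they are opposite. *)
Lemma bint_affine a l w x1 x2 y1 y2 : x1 <= x2 -> y1 <= y2 ->
  bint (fun z => a + l * (z - w)) x1 x2 y1 y2 = 0.
Proof.
move=> x12 y12; rewrite /bint.
rewrite (@eq_cint _ x1 x2 _ (fun=> l * ('i * (y1 - y2)%:C))); last first.
  move=> x _; rewrite opprD addrACA subrr add0r -mulrBr opprB addrA subrK.
  by rewrite complexB subrr; simpc.
rewrite (@eq_cint _ y1 y2 _ (fun=> l * (x2 - x1)%:C)); last first.
  move=> y _; rewrite opprD addrACA subrr add0r -mulrBr opprB addrA subrK.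
  by rewrite complexB subrr.
rewrite !cint_cst// -(opprB y2 y1) rmorphN /=; ring.
Qed.

Lemma ltr_expn2 (s d : R) : 0 < d -> exists n, s / 2 ^+ n < d.
Proof.
move=> d0; exists (Num.bound `|s / d|).
rewrite ltr_pdivrMr ?exprn_gt0// mulrC -ltr_pdivrMr//.
have := ltn_expl (Num.bound `|s / d|) (isT : (1 < 2)%N).
rewrite -(ltr_nat R) natrX; apply: lt_trans.
by rewrite (le_lt_trans (ler_norm _))// archi_boundP.
Qed.

Lemma le_sum4 (s a b c d : R) : s <= a + b + (c + d) ->
  [\/ s <= 4 * a, s <= 4 * b, s <= 4 * c | s <= 4 * d].
Proof.
move=> H; have [|h1] := leP s (4 * a); first by constructor 1.
have [|h2] := leP s (4 * b); first by constructor 2.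
have [|h3] := leP s (4 * c); first by constructor 3.
by constructor 4; lra.
Qed.

Lemma ler_dist_itv (a b x y : R) : a <= x <= b -> a <= y <= b -> `|x - y| <= b - a.
Proof. by move=> /andP[? ?] /andP[? ?]; rewrite ler_norml; lra. Qed.

(** Quadrisection: a nonzero integral leaves at least a quarter of its modulus to some quarter of
    the rectangle. The nested quarters shrink to a point, where differentiability makes the
    integrals smaller than this allows. *)
Theorem Goursat F x1 x2 y1 y2 : x1 < x2 -> y1 < y2 ->
  (forall z, crect x1 x2 y1 y2 z -> holo F z) -> bint F x1 x2 y1 y2 = 0.
Proof.
move=> x12 y12 Fh; apply/eqP/negPn/negP => n0.
pose rt := ((R * R) * (R * R))%type.
(* Half the perimeter: it halves at each step and bounds the distance between any two points of the
   rectangle. *)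
pose wd (r : rt) : R := (r.1.2 - r.1.1) + (r.2.2 - r.2.1).
pose I (r : rt) := bint F r.1.1 r.1.2 r.2.1 r.2.2.
pose sub (r r' : rt) := [/\ r.1.1 <= r'.1.1, r'.1.2 <= r.1.2,
  r.2.1 <= r'.2.1 & r'.2.2 <= r.2.2].
pose r0 : rt := ((x1, x2), (y1, y2)).
pose ok (r : rt) := [/\ r.1.1 < r.1.2, r.2.1 < r.2.2 & sub r0 r].
have okc r : ok r -> forall z, crect r.1.1 r.1.2 r.2.1 r.2.2 z -> ccont F z.
  move=> [_ _ [/= s1 s2 s3 s4]] z [/andP[z1 z2] /andP[z3 z4]].
  apply: holo_ccont; apply: Fh; split; apply/andP; split.
  - exact: le_trans z1. - exact: le_trans s2.
  - exact: le_trans z3. - exact: le_trans s4.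
(* The existential stands before the hypothesis [ok r], so that [choice] produces a total function
   that can be iterated. *)
have step r : exists r', ok r -> [/\ ok r', sub r r', wd r' = wd r / 2 &
    normc (I r) <= 4 * normc (I r')].
  have [okr|] := pselect (ok r); last by exists r.
  have Fc := okc _ okr; case: okr => a12 b12 [/= s1 s2 s3 s4].
  pose mx := (r.1.1 + r.1.2) / 2; pose my := (r.2.1 + r.2.2) / 2.
  have a1m : r.1.1 < mx by rewrite /mx; lra.
  have ma2 : mx < r.1.2 by rewrite /mx; lra.
  have b1m : r.2.1 < my by rewrite /my; lra.
  have mb2 : my < r.2.2 by rewrite /my; lra.
  pose q1 : rt := ((r.1.1, mx), (r.2.1, my)).
  pose q2 : rt := ((mx, r.1.2), (r.2.1, my)).
  pose q3 : rt := ((r.1.1, mx), (my, r.2.2)).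
  pose q4 : rt := ((mx, r.1.2), (my, r.2.2)).
  have IE : I r = I q1 + I q2 + (I q3 + I q4).
    have Fc' (a1 a2 b1 b2 : R) : r.1.1 <= a1 -> a2 <= r.1.2 -> r.2.1 <= b1 -> b2 <= r.2.2 ->
        forall z, crbd a1 a2 b1 b2 z -> ccont F z.
      move=> ? ? ? ? z [[/andP[? ?] /andP[? ?]] _]; apply: Fc; split; apply/andP; split;
        apply: le_trans; eassumption.
    have [? ? ? ?] := And4 (ltW a1m) (ltW ma2) (ltW b1m) (ltW mb2).
    have [? ?] := (ltW a12, ltW b12).
    rewrite /I (@bint_split_y F _ _ _ _ my) ?(ltW a12) ?(ltW b1m) ?(ltW mb2)//;
      try exact: Fc'.
    congr (_ + _); rewrite (@bint_split_x F _ _ _ _ mx) ?(ltW b1m) ?(ltW a1m) ?(ltW ma2)//;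
      exact: Fc'.
  have ok4 : [/\ ok q1, ok q2, ok q3 & ok q4].
    have m1 := le_trans s1 (ltW a1m); have m2 := le_trans (ltW ma2) s2.
    have m3 := le_trans s3 (ltW b1m); have m4 := le_trans (ltW mb2) s4.
    by split; split.
  have sub4 : [/\ sub r q1, sub r q2, sub r q3 & sub r q4].
    by split; split; rewrite //= ltW.
  have wd4 : [/\ wd q1 = wd r / 2, wd q2 = wd r / 2, wd q3 = wd r / 2 & wd q4 = wd r / 2].
    by split; rewrite /wd /= /mx /my; field.
  have : normc (I r) <= normc (I q1) + normc (I q2) + (normc (I q3) + normc (I q4)).
    rewrite IE (le_trans (ler_normcD _ _))// lerD// ler_normcD//.
  case: ok4 sub4 wd4 => o1 o2 o3 o4 [u1 u2 u3 u4] [v1 v2 v3 v4] le4.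
  by have [h|h|h|h] := le_sum4 le4; [exists q1|exists q2|exists q3|exists q4].
have [f Hf] := choice step.
pose r n := iter n f r0.
have okr n : ok (r n).
  elim: n => [|n IH]; first by split => //; split => /=.
  by have [] := Hf _ IH.
have subS n : sub (r n) (r n.+1) by have [] := Hf _ (okr n).
have subn m n : (m <= n)%N -> sub (r m) (r n).
  elim: n => [|n IH]; first by rewrite leqn0 => /eqP ->; split.
  rewrite leq_eqVlt => /predU1P[->|]; first by split.
  rewrite ltnS => /IH [a b c d]; have [a' b' c' d'] := subS n; split.
  - exact: le_trans a'. - exact: le_trans b.
  - exact: le_trans c'. - exact: le_trans d.
have wdn n : wd (r n) = wd r0 / 2 ^+ n.
  elim: n => [|n IH]; first by rewrite expr0 divr1.
  by have [_ _ -> _] := Hf _ (okr n); rewrite IH exprS invfM mulrA mulrAC.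
have In n : normc (I r0) / 4 ^+ n <= normc (I (r n)).
  elim: n => [|n IH]; first by rewrite expr0 divr1.
  have [_ _ _ H] := Hf _ (okr n).
  rewrite exprS invfM mulrCA mulrC ler_pdivrMr// [leRHS]mulrC.
  exact: le_trans H.
have cross1 m n : (r m).1.1 <= (r n).1.2.
  have [a _ _ _] := subn _ _ (leq_maxl m n).
  have [_ b _ _] := subn _ _ (leq_maxr m n).
  have [c _ _] := okr (maxn m n).
  by rewrite (le_trans a)// (le_trans _ b)// ltW.
have cross2 m n : (r m).2.1 <= (r n).2.2.
  have [_ _ a _] := subn _ _ (leq_maxl m n).
  have [_ _ _ b] := subn _ _ (leq_maxr m n).
  have [_ c _] := okr (maxn m n).
  by rewrite (le_trans a)// (le_trans _ b)// ltW.
(* Every left end lies below every right end, so the supremum of the left ends belongs to all the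
   nested intervals. *)
pose X := sup (range (fun n => (r n).1.1)).
pose Y := sup (range (fun n => (r n).2.1)).
have Xin n : (r n).1.1 <= X <= (r n).1.2.
  apply/andP; split.
    apply: ub_le_sup; last by exists n.
    by exists (r 0%N).1.2 => _ [m _ <-]; exact: cross1.
  apply: ge_sup; first by exists (r 0%N).1.1; exists 0%N.
  by move=> _ [m _ <-]; exact: cross1.
have Yin n : (r n).2.1 <= Y <= (r n).2.2.
  apply/andP; split.
    apply: ub_le_sup; last by exists n.
    by exists (r 0%N).2.2 => _ [m _ <-]; exact: cross2.
  apply: ge_sup; first by exists (r 0%N).2.1; exists 0%N.
  by move=> _ [m _ <-]; exact: cross2.
pose z := X +i* Y.
have [l Fl] : holo F z by apply: Fh; split; [exact: (Xin 0%N)|exact: (Yin 0%N)].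
have w0 : 0 < wd r0 by rewrite /wd /=; lra.
have I0 : 0 < normc (I r0) by rewrite normc_gt0.
pose K := normc (I r0) / wd r0 ^+ 2.
have K0 : 0 < K by rewrite divr_gt0// exprn_gt0.
(* With tolerance [K / 8], [normc_bint_le] gives at most [4 (K / 8) wd^2 = K wd^2 / 2], half of the
   lower bound [K wd^2] inherited from the subdivision. *)
have [|d d0 Hd] := Fl (K / 8); first by rewrite divr_gt0.
have [n wnd] := ltr_expn2 (wd r0) d0.
rewrite -wdn in wnd.
have [a12 b12 _] := okr n.
have Fc := okc _ (okr n).
have wn0 : 0 < wd (r n) by rewrite /wd; lra.
(* The affine part integrates to 0 by [bint_affine], so only the remainder of the expansion at [z]
   has to be estimated. *)
pose A w := F z + l * (w - z).
have Ah w : holo A w.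
  by apply: holoD; [exact: holo_cst|apply: holoM; [exact: holo_cst|apply: holoB; [exact: holo_id|exact: holo_cst]]].
have Ac w : ccont A w by exact: holo_ccont.
have Bc w : crect (r n).1.1 (r n).1.2 (r n).2.1 (r n).2.2 w -> ccont (fun w => F w - A w) w.
  move=> wr; have [_ _ [s1 s2 s3 s4]] := okr n; apply: holo_ccont; apply: holoB => //.
  case: wr => /andP[? ?] /andP[? ?]; apply: Fh; split; apply/andP; split;
    apply: le_trans; eassumption.
have IE : I (r n) = bint (fun w => F w - A w) (r n).1.1 (r n).1.2 (r n).2.1 (r n).2.2.
  rewrite /I (@eq_bint _ _ _ _ (ltW a12) (ltW b12) F (fun w => (F w - A w) + A w)); last first.
    by move=> w _; rewrite subrK.
  rewrite bintD ?ltW//; last by move=> w [wr _]; exact: Bc.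
  by rewrite /A bint_affine ?ltW// addr0.
have : normc (I (r n)) <= 4 * (K / 8 * wd (r n)) * wd (r n).
  rewrite IE; apply: normc_bint_le; rewrite ?ltW// => w [wr _]; first exact: Bc.
  case: wr => wx wy.
  have wz : normc (w - z) <= wd (r n).
    rewrite (le_trans (normc_le_ReIm _))// complex_ReB complex_ImB /wd lerD//.
      exact: ler_dist_itv.
    exact: ler_dist_itv.
  rewrite /A opprD addrA (le_trans (Hd _ _))//; first exact: le_lt_trans wnd.
  by rewrite ler_pM2l// divr_gt0.
apply/negP; rewrite -ltNge; apply: lt_le_trans (In n).
have -> : normc (I r0) / 4 ^+ n = K * (wd (r n)) ^+ 2.
  rewrite wdn /K expr_div_n -exprM mulnC exprM (_ : 2 ^+ 2 = 4 :> R); last by rewrite -natrX.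
  by field; rewrite (gt_eqF w0) expf_neq0.
rewrite -subr_gt0 (_ : _ - _ = K * wd (r n) ^+ 2 / 2); last by field.
by rewrite divr_gt0// mulr_gt0// exprn_gt0.
Qed.

End Goursat.

Section Cauchy.
Context {R : realType}.
Implicit Types (x y : R) (z w l a b : R[i]) (F G : R[i] -> R[i]).

Lemma complex_eqE z : z = Re z +i* Im z. Proof. by case: z. Qed.

(** Four cuts surround the possible singularity by a small square; on the four rectangles cut off,
    Goursat's theorem applies. *)
Lemma bint_shrink G x1 x2 y1 y2 (a1 a2 e : R) : 0 < e ->
  x1 < a1 - e -> a1 + e < x2 -> y1 < a2 - e -> a2 + e < y2 ->
  (forall z, crect x1 x2 y1 y2 z -> z <> a1 +i* a2 -> holo G z) ->
  bint G x1 x2 y1 y2 = bint G (a1 - e) (a1 + e) (a2 - e) (a2 + e).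
Proof.
move=> e0 xl xr yl yr Gh.
have [ml mr] : a1 - e < a1 /\ a1 < a1 + e by split; lra.
have [nl nr] : a2 - e < a2 /\ a2 < a2 + e by split; lra.
have Gc (b1 b2 c1 c2 : R) : x1 <= b1 -> b2 <= x2 -> y1 <= c1 -> c2 <= y2 ->
    b1 != a1 -> b2 != a1 -> c1 != a2 -> c2 != a2 ->
    forall z, crbd b1 b2 c1 c2 z -> ccont G z.
  move=> xb bx yc cy n1 n2 n3 n4 z [[/andP[z1 z2] /andP[z3 z4]] zb].
  apply: holo_ccont; apply: Gh.
    by split; apply/andP; split; apply: le_trans; eassumption.
  move=> za; rewrite za /= in zb.
  by case: zb => [|[|[|]]] E; [rewrite E eqxx in n1|rewrite E eqxx in n2|
    rewrite E eqxx in n3|rewrite E eqxx in n4].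
have G0 (b1 b2 c1 c2 : R) : b1 < b2 -> c1 < c2 -> x1 <= b1 -> b2 <= x2 -> y1 <= c1 -> c2 <= y2 ->
    [\/ b2 < a1, a1 < b1, c2 < a2 | a2 < c1] -> bint G b1 b2 c1 c2 = 0.
  move=> b12 c12 xb bx yc cy H; apply: Goursat => // z [/andP[z1 z2] /andP[z3 z4]].
  apply: Gh; first by split; apply/andP; split; apply: le_trans; eassumption.
  move=> za; move: z1 z2 z3 z4; rewrite za /= => z1 z2 z3 z4.
  by case: H; rewrite ltNge ?z1 ?z2 ?z3 ?z4.
have xla := lt_trans xl ml; have xra := lt_trans mr xr.
have yla := lt_trans yl nl; have yra := lt_trans nr yr.
have xx := lt_trans xla xra; have yy := lt_trans yla yra.
have lr := lt_trans ml mr; have nlr := lt_trans nl nr.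
have lx := lt_trans lr xr; have ly := lt_trans nlr yr.
have xr' := lt_trans xl lr; have yr' := lt_trans yl nlr.
rewrite (@bint_split_x _ G x1 x2 y1 y2 (a1 - e)); first last.
- by apply: Gc; rewrite ?lexx ?ltW// ?(lt_eqF xla) ?(gt_eqF xra) ?(lt_eqF yla) ?(gt_eqF yra) ?(lt_eqF ml).
- by apply: Gc; rewrite ?lexx ?ltW// ?(lt_eqF xla) ?(gt_eqF xra) ?(lt_eqF yla) ?(gt_eqF yra) ?(lt_eqF ml).
- by rewrite !ltW.
- exact: ltW.
rewrite G0// ?ltW//; last by constructor 1.
rewrite add0r (@bint_split_x _ G _ x2 y1 y2 (a1 + e)); first last.
- by apply: Gc; rewrite ?lexx ?ltW// ?(lt_eqF xla) ?(gt_eqF xra) ?(lt_eqF yla) ?(gt_eqF yra) ?(gt_eqF mr).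
- by apply: Gc; rewrite ?lexx ?ltW// ?(lt_eqF ml) ?(gt_eqF xra) ?(lt_eqF yla) ?(gt_eqF yra) ?(gt_eqF mr).
- by rewrite !ltW.
- exact: ltW.
rewrite [X in _ + X]G0// ?ltW//; last by constructor 2.
rewrite addr0 (@bint_split_y _ G _ _ y1 y2 (a2 - e)); first last.
- by apply: Gc; rewrite ?lexx ?ltW// ?(lt_eqF ml) ?(gt_eqF xra) ?(lt_eqF nl) ?(gt_eqF yra) ?(gt_eqF mr).
- by apply: Gc; rewrite ?lexx ?ltW// ?(lt_eqF ml) ?(gt_eqF xra) ?(lt_eqF yla) ?(lt_eqF nl) ?(gt_eqF mr).
- by rewrite !ltW.
- exact: ltW.
rewrite G0// ?ltW//; last by constructor 3.
rewrite add0r (@bint_split_y _ G _ _ _ y2 (a2 + e)); first last.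
- by apply: Gc; rewrite ?lexx ?ltW// ?(lt_eqF ml) ?(gt_eqF nr) ?(lt_eqF nl) ?(gt_eqF yra) ?(gt_eqF mr).
- by apply: Gc; rewrite ?lexx ?ltW// ?(lt_eqF ml) ?(gt_eqF nr) ?(lt_eqF nl) ?(lt_eqF nl) ?(gt_eqF mr).
- by rewrite !ltW.
- exact: ltW.
rewrite [X in _ + X]G0// ?ltW//; last by constructor 4.
by rewrite addr0.
Qed.

Lemma holo_kernel a z n : z != a -> holo (fun z => ((z - a)^-1) ^+ n) z.
Proof.
move=> za; elim: n => [|n IH]; first exact: holo_cst.
rewrite (_ : (fun _ => _) = fun z => (z - a)^-1 * ((z - a)^-1) ^+ n); last first.
  by apply/funext => w; rewrite exprS.
apply: holoM => //; apply: holoV; last by rewrite subr_eq0.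
by apply: holoB; [exact: holo_id|exact: holo_cst].
Qed.

Lemma Rintegral_ge_cst (u v c : R) (f : R -> R) : u <= v ->
  {within `[u, v], continuous f} -> (forall t, u <= t <= v -> c <= f t) ->
  c * (v - u) <= \int[@lebesgue_measure R]_(t in `[u, v]) f t.
Proof.
move=> uv fc cf; rewrite -Rintegral_itv_cst//.
apply: le_Rintegral => //.
  apply: within_integrable; apply: continuous_subspaceT => x; exact: cvg_cst.
exact: within_integrable.
Qed.

(* The exact value is [2 pi 'i]; on each side of a square centred at [a] the
   relevant part of [dz / (z - a)] is bounded below by hand. *)
Lemma bint_inv_ge (a1 a2 e : R) : 0 < e ->
  4 <= normc (bint (fun z => (z - (a1 +i* a2))^-1) (a1 - e) (a1 + e) (a2 - e) (a2 + e)).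
Proof.
move=> e0; set F := fun z => _.
have x12 : a1 - e <= a1 + e by lra.
have y12 : a2 - e <= a2 + e by lra.
have Fc z : crbd (a1 - e) (a1 + e) (a2 - e) (a2 + e) z -> ccont F z.
  move=> zb; apply: holo_ccont; rewrite /F.
  rewrite (_ : (fun _ => _) = fun z => (z - (a1 +i* a2))^-1 ^+ 1); last first.
    by apply/funext => w; rewrite expr1.
  apply: holo_kernel; apply/eqP => za; move: zb; rewrite za => -[_ /=] [|[|[|]]]; lra.
have [ph pv] := crbd_pcont x12 y12 Fc.
apply: le_trans (normr_Im_le _); apply: le_trans (ler_norm _).
rewrite /bint complex_ImD complex_ImM /= mul0r add0r mul1r.
have key (s : R) : - e <= s <= e -> e^-1 <= 2 * e / (e ^+ 2 + s ^+ 2).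
  move=> /andP[s1 s2].
  have q0 : 0 < e ^+ 2 + s ^+ 2 by rewrite ltr_pwDl ?sqr_ge0// exprn_gt0.
  rewrite ler_pdivlMr// mulrC ler_pdivrMr//.
  have : s ^+ 2 <= e ^+ 2 by rewrite -subr_ge0 subr_sqr mulr_ge0//; lra.
  by rewrite -mulrA -expr2; lra.
(* For the imaginary part, each pair of opposite sides has an integrand of at least [e^-1] over a
   length [2 e], hence contributes at least 2. *)
have -> : (4 : R) = e^-1 * ((a1 + e) - (a1 - e)) + e^-1 * ((a2 + e) - (a2 - e)).
  by field; rewrite gt_eqF.
apply: lerD; apply: Rintegral_ge_cst => //.
- exact: (pcont_Im ph).
- move=> t tt.
  rewrite (_ : a2 - e - a2 = - e); last by lra.
  rewrite (_ : a2 + e - a2 = e); last by lra.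
  rewrite sqrrN opprK mulNr opprK -mulrDl [e + e](_ : _ = 2 * e); last by ring.
  by rewrite [X in _ / X]addrC; apply: key; lra.
- exact: (pcont_Re pv).
- move=> t tt.
  rewrite (_ : a1 - e - a1 = - e); last by lra.
  rewrite (_ : a1 + e - a1 = e); last by lra.
  rewrite sqrrN mulNr opprK -mulrDl [e + e](_ : _ = 2 * e); last by ring.
  by apply: key; lra.
Qed.

Lemma crect_interior x1 x2 y1 y2 (a1 a2 : R) : x1 < a1 < x2 -> y1 < a2 < y2 ->
  exists2 d, 0 < d & forall e, 0 < e -> e < d ->
    [/\ x1 < a1 - e, a1 + e < x2, y1 < a2 - e & a2 + e < y2].
Proof.
move=> /andP[h1 h2] /andP[h3 h4].
exists (Num.min (Num.min (a1 - x1) (x2 - a1)) (Num.min (a2 - y1) (y2 - a2))).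
  by rewrite !lt_min !subr_gt0 h1 h2 h3.
move=> e e0; rewrite !lt_min => /andP[/andP[? ?] /andP[? ?]]; split; lra.
Qed.

Lemma bint_inv_ge_rect x1 x2 y1 y2 a : x1 < Re a < x2 -> y1 < Im a < y2 ->
  4 <= normc (bint (fun z => (z - a)^-1) x1 x2 y1 y2).
Proof.
case: a => a1 a2 ax ay; rewrite /= in ax ay; have [d d0 Hd] := crect_interior ax ay.
have [||h1 h2 h3 h4] := Hd (d / 2); [by lra|by lra|].
rewrite (@bint_shrink _ _ _ _ _ a1 a2 (d / 2))//; first by apply: bint_inv_ge; lra.
  by lra.
move=> z _ /eqP za.
have := @holo_kernel (a1 +i* a2) z 1 za.
by congr (holo _ z); apply/funext => w; rewrite expr1.
Qed.

(** The last factor plays the part of [2 pi 'i]. After shrinking to a square of half-side [s], the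
    two sides differ by the integral of [(F z - F a) / (z - a)], which tends to 0 with [s] by
    continuity of [F] at [a]. *)
Theorem Cauchy_formula F x1 x2 y1 y2 a : x1 < Re a < x2 -> y1 < Im a < y2 ->
  (forall z, crect x1 x2 y1 y2 z -> holo F z) ->
  bint (fun z => F z * (z - a)^-1) x1 x2 y1 y2 =
  F a * bint (fun z => (z - a)^-1) x1 x2 y1 y2.
Proof.
case: a => a1 a2 ax ay Fh; rewrite /= in ax ay; set a := a1 +i* a2.
have ar : crect x1 x2 y1 y2 a.
  by case/andP: ax => ? ?; case/andP: ay => ? ?; split => /=; rewrite !ltW.
have kh z : z <> a -> holo (fun z => (z - a)^-1) z.
  move=> /eqP za; have := @holo_kernel a z 1 za.
  by congr (holo _ z); apply/funext => w; rewrite expr1.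
apply/eqP; rewrite -subr_eq0; apply/eqP; apply: eq0_normc; apply/eqP.
rewrite eq_le normc_ge0 andbT; apply/ler_addgt0Pr => e e0; rewrite add0r.
(* On the boundary the integrand is at most [(e / 16) / s], and the side lengths add up to [4 s];
   with the factor 4 of [normc_bint_le] the bound is exactly [e]. *)
have e16 : 0 < e / 16 by rewrite divr_gt0.
have [d d0 Hd] := holo_ccont (Fh _ ar) e16.
have [d' d'0 Hd'] := crect_interior ax ay.
pose s := Num.min (d / 4) (d' / 2).
have s0 : 0 < s by rewrite lt_min; lra.
have sd : s <= d / 4 by rewrite ge_min lexx.
have sd' : s < d' by rewrite gt_min; apply/orP; right; lra.
have [h1 h2 h3 h4] := Hd' _ s0 sd'.
rewrite !(@bint_shrink _ _ _ _ _ a1 a2 s)//; last 2 first.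
- by move=> z zr za; exact: kh.
- by move=> z zr za; apply: holoM; [exact: Fh|exact: kh].
have x12 : a1 - s <= a1 + s by lra.
have y12 : a2 - s <= a2 + s by lra.
have subr z : crbd (a1 - s) (a1 + s) (a2 - s) (a2 + s) z -> crect x1 x2 y1 y2 z.
  by move=> [[/andP[? ?] /andP[? ?]] _]; split; apply/andP; split; lra.
have za z : crbd (a1 - s) (a1 + s) (a2 - s) (a2 + s) z -> s <= normc (z - a).
  move=> [_]; case: z => z1 z2 /= H.
  have [H1|H1] : s <= `|z1 - a1| \/ s <= `|z2 - a2|.
    have dB (b : R) : b - s - b = - s by ring.
    have dD (b : R) : b + s - b = s by ring.
    by case: H => [->|[->|[->|->]]]; [left|left|right|right];
      rewrite ?dB ?dD ?normrN (gtr0_norm s0).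
  - exact: le_trans H1 (normr_Re_le ((z1 - a1) +i* (z2 - a2))).
  - exact: le_trans H1 (normr_Im_le ((z1 - a1) +i* (z2 - a2))).
have za0 z : crbd (a1 - s) (a1 + s) (a2 - s) (a2 + s) z -> z <> a.
  by move=> /za H E; move: H; rewrite E subrr normc0 leNgt s0.
have kc z : crbd (a1 - s) (a1 + s) (a2 - s) (a2 + s) z -> ccont (fun z => (z - a)^-1) z.
  by move=> /za0 /kh; exact: holo_ccont.
have Fkc c z : crbd (a1 - s) (a1 + s) (a2 - s) (a2 + s) z ->
    ccont (fun z => (F z - c) * (z - a)^-1) z.
  move=> zr; apply: holo_ccont; apply: holoM; last by apply: kh; exact: za0.
  by apply: holoB; [apply: Fh; exact: subr|exact: holo_cst].
rewrite -(bintM x12 y12)//.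
rewrite (_ : bint (fun z => F z * _) _ _ _ _ =
  bint (fun z => (F z - F a) * (z - a)^-1 + F a * (z - a)^-1) (a1 - s) (a1 + s) (a2 - s) (a2 + s)); last first.
  by apply: eq_bint => // z _; rewrite mulrBl subrK.
rewrite bintD//; last 2 first.
- by move=> z zr; exact: Fkc.
- move=> z zr; apply: holo_ccont; apply: holoM; first exact: holo_cst.
  by apply: kh; exact: za0.
rewrite addrK.
apply: (@le_trans _ _ (4 * (e / 16 / s) * ((a1 + s - (a1 - s)) + (a2 + s - (a2 - s))))).
  apply: normc_bint_le => //; first exact: Fkc.
  move=> z zr; rewrite normcM normcV ler_pM ?normc_ge0 ?invr_ge0 ?normc_ge0//.
    apply/ltW/Hd; apply: (@le_lt_trans _ _ (2 * s)); last by lra.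
    case: zr => -[zx zy] _; rewrite (le_trans (normc_le_ReIm _))//.
    by rewrite complex_ReB complex_ImB mulr_natl mulr2n lerD// ler_distl.
  by rewrite lef_pV2 ?posrE// ?za// (lt_le_trans s0)// za.
have -> : 4 * (e / 16 / s) * ((a1 + s - (a1 - s)) + (a2 + s - (a2 - s))) = e; last by [].
by field; rewrite gt_eqF.
Qed.

End Cauchy.

(** * The derivative of a holomorphic function is holomorphic *)

Section HolomorphicDerivative.
Context {R : realType}.
Implicit Types (z w l a b : R[i]) (F G : R[i] -> R[i]).

Lemma continuous_of_plane (T : R[i] -> R) (w : R * R) :
  (forall e, 0 < e -> exists2 d, 0 < d & forall z, normc (z - of_plane w) < d ->
     `|T z - T (of_plane w)| < e) ->
  {for w, continuous (fun w : R * R => T (of_plane w))}.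
Proof.
move=> Tc; apply/cvgrPdist_lt => e e0; have [d d0 Hd] := Tc _ e0.
have d20 : 0 < d / 2 by rewrite divr_gt0.
case: w Hd {Tc} => u v Hd.
exists (ball u (d / 2), ball v (d / 2)); first by split; exact: nbhsx_ballx.
move=> [u' v'] [/= h1 h2]; rewrite distrC; apply: Hd.
rewrite (le_lt_trans (normc_le_ReIm _))// /of_plane complexB /= (splitr d).
by rewrite ltrD// distrC.
Qed.

Lemma ccont_normc F z : ccont F z -> forall e, 0 < e ->
  exists2 d, 0 < d & forall w, normc (w - z) < d -> `|normc (F w) - normc (F z)| < e.
Proof.
move=> Fc e /Fc[d d0 Hd]; exists d => // w /Hd; apply: le_lt_trans.
by rewrite ler_norml ler_normcB andbT lerNl opprB normcBC ler_normcB.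
Qed.

Lemma crect_bounded F (x1 x2 y1 y2 : R) :
  (forall z, crect x1 x2 y1 y2 z -> ccont F z) ->
  exists B, forall z, crect x1 x2 y1 y2 z -> normc (F z) <= B.
Proof.
move=> Fc; pose A : set (R * R) := `[x1, x2] `*` `[y1, y2].
have cA : compact A by apply: compact_setX; exact: segment_compact.
have [A0|A0] := pselect (A !=set0); last first.
  exists 0 => z [zx zy]; case: A0; exists (Re z, Im z).
  by split; rewrite /= in_itv.
have fc : {within A, continuous (fun w : R * R => normc (F (of_plane w)))}.
  apply: continuous_in_subspaceT => w; rewrite inE => -[/=].
  rewrite !in_itv /= => w1 w2; apply: (@continuous_of_plane (fun z => normc (F z))).
  by apply: ccont_normc; apply: Fc.
have [c _ Hc] := compact_EVT_max A0 cA fc.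
exists (normc (F (of_plane c))) => z [zx zy].
have := Hc (Re z, Im z); rewrite inE /of_plane /=.
rewrite -(complex_eqE z); apply.
by split; rewrite /= in_itv.
Qed.

(** Exact remainder of the first-order expansion in [b] at [a]; its factor [(b - a) ^+ 2] yields
    differentiation under the integral. The powers 1 and 2 suffice: they occur in Cauchy's formula
    and in its derivative. *)
Lemma kernel_expansion1 (z a b : R[i]) : z != a -> z != b ->
  (z - b)^-1 ^+ 1 - (z - a)^-1 ^+ 1 - (b - a) * (1%:R * (z - a)^-1 ^+ 2) =
  (b - a) ^+ 2 * ((z - a)^-1 ^+ 2 * (z - b)^-1).
Proof. by move=> za zb; field; rewrite !subr_eq0 zb za. Qed.

Lemma kernel_expansion2 (z a b : R[i]) : z != a -> z != b ->
  (z - b)^-1 ^+ 2 - (z - a)^-1 ^+ 2 - (b - a) * (2%:R * (z - a)^-1 ^+ 3) =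
  (b - a) ^+ 2 * ((z - a)^-1 ^+ 2 * (z - b)^-1 * ((z - b)^-1 + (z - a)^-1 *+ 2)).
Proof. by move=> za zb; field; rewrite !subr_eq0 zb za. Qed.

Lemma normcX z n : normc (z ^+ n) = normc z ^+ n.
Proof. by elim: n => [|n IH]; rewrite ?expr0 ?normc1// !exprS normcM IH. Qed.

(** Both [z - a] and [z - b] have modulus at least [d / 2], so the remainder is at most the cubic
    term for [n = 1] and the quartic one for [n = 2]; the sum covers both. *)
Lemma kernel_bound (z a b : R[i]) (d : R) n : 0 < d -> (n = 1 \/ n = 2)%N ->
  d <= normc (z - a) -> normc (b - a) <= d / 2 ->
  normc ((z - b)^-1 ^+ n - (z - a)^-1 ^+ n - (b - a) * (n%:R * (z - a)^-1 ^+ n.+1)) <=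
  normc (b - a) ^+ 2 * ((2 / d) ^+ 3 + 3 * (2 / d) ^+ 4).
Proof.
move=> d0 n12 za ba.
have zb : d / 2 <= normc (z - b).
  have := ler_normcD (z - b) (b - a); rewrite addrA subrK; lra.
have u0 : z != a by rewrite -subr_eq0 -normc_gt0; lra.
have v0 : z != b by rewrite -subr_eq0 -normc_gt0; lra.
pose D := 2 / d; have D0 : 0 < D by rewrite divr_gt0.
have uD : normc (z - a)^-1 <= D.
  rewrite normcV -[D]invrK lef_pV2 ?posrE ?invr_gt0// ?normc_gt0 ?subr_eq0//.
  by rewrite /D invf_div; lra.
have vD : normc (z - b)^-1 <= D.
  rewrite normcV -[D]invrK lef_pV2 ?posrE ?invr_gt0// ?normc_gt0 ?subr_eq0//.
  by rewrite /D invf_div.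
have uvD : normc ((z - a)^-1 ^+ 2 * (z - b)^-1) <= D ^+ 3.
  rewrite normcM normcX [D ^+ 3]exprSr ler_pM ?normc_ge0 ?exprn_ge0 ?normc_ge0//.
  by apply: lerXn2r; rewrite ?nnegrE ?normc_ge0 ?(ltW D0).
have D30 : 0 <= D ^+ 3 by rewrite exprn_ge0 ?ltW.
have D40 : 0 <= D ^+ 4 by rewrite exprn_ge0 ?ltW.
case: n12 => ->.
  rewrite kernel_expansion1// normcM normcX ler_wpM2l ?exprn_ge0 ?normc_ge0//.
  by rewrite (le_trans uvD)// lerDl mulr_ge0.
rewrite kernel_expansion2// normcM normcX ler_wpM2l ?exprn_ge0 ?normc_ge0//.
rewrite normcM (@le_trans _ _ (D ^+ 3 * (3 * D)))//; last first.
  by rewrite mulrCA -exprSr lerDr.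
rewrite ler_pM ?normc_ge0// (le_trans (ler_normcD _ _))// mulr2n.
have := ler_normcD (z - a)^-1 (z - a)^-1; lra.
Qed.

(** Differentiation under the integral sign: the kernel remainder is uniform on the boundary, where
    [F] is bounded by compactness. *)
Lemma cdiff_bint_kernel F (x1 x2 y1 y2 : R) (a : R[i]) n : (n = 1 \/ n = 2)%N ->
  x1 < Re a < x2 -> y1 < Im a < y2 ->
  (forall z, crect x1 x2 y1 y2 z -> ccont F z) ->
  cdiff (fun b => bint (fun z => F z * (z - b)^-1 ^+ n) x1 x2 y1 y2) a
    (bint (fun z => n%:R * F z * (z - a)^-1 ^+ n.+1) x1 x2 y1 y2).
Proof.
move=> n12 ax ay Fc.
have [B HB] := crect_bounded Fc.
have [x12 y12] : x1 <= x2 /\ y1 <= y2 by split; lra.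
have Fb z : crbd x1 x2 y1 y2 z -> ccont F z by move=> [/Fc].
have [d d0 Hd] := crect_interior ax ay.
have d20 : 0 < d / 2 by rewrite divr_gt0.
have [||h1 h2 h3 h4] := Hd (d / 2) => //; first by lra.
have za z : crbd x1 x2 y1 y2 z -> d / 2 <= normc (z - a).
  move=> [_ H]; have [H1|H1] : d / 2 <= `|Re (z - a)| \/ d / 2 <= `|Im (z - a)|.
    rewrite complex_ReB complex_ImB; case: H => [->|[->|[->|->]]]; [left|left|right|right];
    rewrite ?[`|_ - Re a|]distrC ?[`|_ - Im a|]distrC; (rewrite ger0_norm; lra) || (rewrite distrC ger0_norm; lra).
  - exact: le_trans H1 (normr_Re_le _).
  - exact: le_trans H1 (normr_Im_le _).
have B0 : 0 <= B.
  by apply: le_trans (HB (x1 +i* y1) _); [exact: normc_ge0|split; rewrite /= lexx].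
pose K := (2 / (d / 2)) ^+ 3 + 3 * (2 / (d / 2)) ^+ 4.
have K0 : 0 < K.
  have D0 : 0 < 2 / (d / 2) by rewrite divr_gt0.
  apply: addr_gt0; first exact: exprn_gt0.
  by apply: mulr_gt0 => //; exact: exprn_gt0.
pose L := (x2 - x1) + (y2 - y1).
have L0 : 0 <= L by rewrite /L; lra.
move=> e e0.
have Q0 : 0 < 4 * (B * K) * L + 1.
  by rewrite ltr_wpDl// !mulr_ge0// ltW.
(* The first bound keeps [b] within half the distance from [a] to the boundary, as [kernel_bound]
   demands; the second turns the quadratic remainder into [e * normc (b - a)]. *)
exists (Num.min (d / 4) (e / (4 * (B * K) * L + 1))).
  by rewrite lt_min divr_gt0// divr_gt0.
move=> b; rewrite lt_min => /andP[bd be].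
have bd2 : normc (b - a) <= d / 2 / 2 by lra.
have kc c m z : normc (c - a) <= d / 4 -> crbd x1 x2 y1 y2 z ->
    ccont (fun z => F z * (z - c)^-1 ^+ m) z.
  move=> cd zb.
  have zc : z != c.
    apply/eqP => zc; have := za _ zb; rewrite zc; lra.
  have [l Fl] : exists l : R, l = 0 by exists 0.
  have kz := holo_ccont (holo_kernel m zc); have Fz := Fb _ zb.
  move=> e' e'0.
  pose N := normc (F z) + normc ((z - c)^-1 ^+ m) + 1.
  have N0 : 0 < N by rewrite /N; have := normc_ge0 (F z); have := normc_ge0 ((z - c)^-1 ^+ m); lra.
  pose s := Num.min 1 (e' / (2 * N)).
  have s0 : 0 < s by rewrite lt_min ltr01 divr_gt0// mulr_gt0.
  have [d1 d10 H1] := kz _ s0; have [d2 d20' H2] := Fz _ s0.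
  exists (Num.min d1 d2); first by rewrite lt_min d10.
  move=> w; rewrite lt_min => /andP[/H1 k1 /H2 f1].
  set k := (fun z => (z - c)^-1 ^+ m) in k1 *.
  rewrite (_ : F w * k w - F z * k z = (F w - F z) * (k w - k z) +
    ((F w - F z) * k z + F z * (k w - k z))); last by ring.
  rewrite (le_lt_trans (ler_normcD _ _))//.
  have : normc (F w - F z) * normc (k w - k z) <= s * 1.
    rewrite ler_pM ?normc_ge0 ?ltW// (lt_le_trans k1)// ge_min lexx//.
  have := ler_normcD ((F w - F z) * k z) (F z * (k w - k z)).
  rewrite !normcM.
  have : normc (F w - F z) * normc (k z) <= s * normc (k z) by rewrite ler_wpM2r ?normc_ge0 ?ltW.
  have : normc (F z) * normc (k w - k z) <= normc (F z) * s by rewrite ler_wpM2l ?normc_ge0 ?ltW.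
  have : s * N <= e' / 2.
    rewrite -ler_pdivlMr// (_ : e' / 2 / N = e' / (2 * N)); last by rewrite invfM mulrA.
    by rewrite ge_min lexx orbT.
  rewrite /N -/(k z); lra.
have ca z : crbd x1 x2 y1 y2 z -> ccont (fun z => F z * (z - a)^-1 ^+ n) z.
  by apply: kc; rewrite subrr normc0; lra.
have cb z : crbd x1 x2 y1 y2 z -> ccont (fun z => F z * (z - b)^-1 ^+ n) z.
  by apply: kc; lra.
have cM l G z : ccont G z -> ccont (fun z => l * G z) z.
  move=> Gc e' e'0.
  have l1 : 0 < normc l + 1 by rewrite ltr_wpDl ?normc_ge0.
  have [d' d'0 H'] := Gc _ (divr_gt0 e'0 l1); exists d' => // w /H'.
  rewrite ltr_pdivlMr// -mulrBr normcM; apply: le_lt_trans.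
  by rewrite mulrDr mulr1 mulrC lerDl normc_ge0.
have cS z : crbd x1 x2 y1 y2 z -> ccont (fun z => n%:R * F z * (z - a)^-1 ^+ n.+1) z.
  move=> zb; rewrite (_ : (fun _ => _) = fun z => n%:R * (F z * (z - a)^-1 ^+ n.+1)).
    by apply: cM; apply: kc => //; rewrite subrr normc0; lra.
  by apply/funext => w; rewrite mulrA.
have cD G1 G2 z : ccont G1 z -> ccont G2 z -> ccont (fun z => G1 z + G2 z) z.
  move=> G1c G2c e' e'0; have e2 : 0 < e' / 2 by rewrite divr_gt0.
  have [d1 d10 H1] := G1c _ e2; have [d2 d20' H2] := G2c _ e2.
  exists (Num.min d1 d2); first by rewrite lt_min d10.
  move=> w; rewrite lt_min => /andP[/H1 k1 /H2 f1].
  by rewrite opprD addrACA (le_lt_trans (ler_normcD _ _))// (splitr e') ltrD.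
pose H z := (F z * (z - b)^-1 ^+ n + (-1) * (F z * (z - a)^-1 ^+ n)) +
  (- (b - a)) * (n%:R * F z * (z - a)^-1 ^+ n.+1).
have Hc z : crbd x1 x2 y1 y2 z -> ccont H z.
  move=> zb; apply: (cD (fun z => _ + _)); last by apply: cM; exact: cS.
  by apply: cD; [exact: cb|apply: cM; exact: ca].
have <- : bint H x1 x2 y1 y2 = bint (fun z => F z * (z - b)^-1 ^+ n) x1 x2 y1 y2 -
   bint (fun z => F z * (z - a)^-1 ^+ n) x1 x2 y1 y2 -
   bint (fun z => n%:R * F z * (z - a)^-1 ^+ n.+1) x1 x2 y1 y2 * (b - a).
  rewrite /H (bintD x12 y12 (F := fun z => _ + _)); last 2 first.
  - by move=> z zb; apply: cD; [exact: cb|apply: cM; exact: ca].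
  - by move=> z zb; apply: cM; exact: cS.
  rewrite (bintD x12 y12)//; last by move=> z zb; apply: cM; exact: ca.
  by rewrite !(bintM x12 y12)// mulN1r mulNr mulrC.
have HE z : H z = F z * ((z - b)^-1 ^+ n - (z - a)^-1 ^+ n - (b - a) * (n%:R * (z - a)^-1 ^+ n.+1)).
  by rewrite /H; ring.
rewrite (@le_trans _ _ (4 * (B * (normc (b - a) ^+ 2 * K)) * L))//.
  apply: normc_bint_le => // z zb; rewrite HE normcM.
  rewrite ler_pM ?normc_ge0//; first by apply: HB; case: zb.
  exact: kernel_bound (za _ zb) bd2.
rewrite (_ : 4 * _ * L = (4 * (B * K) * L) * normc (b - a) * normc (b - a)); last by ring.
rewrite ler_wpM2r ?normc_ge0// mulrC.
move: be; rewrite ltr_pdivlMr// => be; apply: le_trans (ltW be).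
by rewrite ler_wpM2l ?normc_ge0// lerDl.
Qed.

(** Writing [I G n b] for the integral of [G] against [(z - b)^-n], Cauchy's formula reads
    [F * I 1 1 = I F 1]. Differentiating it and solving for the derivative of [F] leaves an
    expression in [F] and in [I] with exponents 1 and 2, all holomorphic. The term with [I 1 2]
    appears because [I 1 1] has not been evaluated. *)
Theorem holo_cderiv_holo F a (r : R) : 0 < r ->
  (forall z, normc (z - a) < r -> holo F z) -> holo (cderiv F) a.
Proof.
move=> r0 Fh; pose s := r / 3; have s0 : 0 < s by rewrite divr_gt0.
pose x1 := Re a - s; pose x2 := Re a + s; pose y1 := Im a - s; pose y2 := Im a + s.
have ax : x1 < Re a < x2 by rewrite /x1 /x2; lra.
have ay : y1 < Im a < y2 by rewrite /y1 /y2; lra.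
have rh z : crect x1 x2 y1 y2 z -> holo F z.
  move=> [zx zy]; apply: Fh; rewrite (le_lt_trans (normc_le_ReIm _))//.
  rewrite complex_ReB complex_ImB (@le_lt_trans _ _ (s + s))//; last by rewrite /s; lra.
  by rewrite lerD// ler_distl.
have one_h z : holo (fun _ => 1) z by exact: holo_cst.
pose I G n b := bint (fun z => G z * (z - b)^-1 ^+ n) x1 x2 y1 y2.
have inr b : normc (b - a) < s -> x1 < Re b < x2 /\ y1 < Im b < y2.
  move=> bs; have := le_lt_trans (normr_Re_le _) bs; have := le_lt_trans (normr_Im_le _) bs.
  by rewrite complex_ReB complex_ImB !ltr_distl /x1 /x2 /y1 /y2 => /andP[-> ->] /andP[-> ->].
have Ih G n b : (n = 1 \/ n = 2)%N -> normc (b - a) < s -> (forall z, crect x1 x2 y1 y2 z -> holo G z) ->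
    cdiff (I G n) b (bint (fun z => n%:R * G z * (z - b)^-1 ^+ n.+1) x1 x2 y1 y2).
  move=> n12 /inr[bx by_] Gh; apply: cdiff_bint_kernel => // z /Gh; exact: holo_ccont.
have J1 b : I (fun=> 1) 1%N b = bint (fun z => (z - b)^-1) x1 x2 y1 y2.
  rewrite /I; have -> : (fun z : R[i] => 1 * (z - b)^-1 ^+ 1) = fun z => (z - b)^-1 by apply/funext => z; rewrite expr1 mul1r.
  by [].
have FI b : normc (b - a) < s -> F b * I (fun=> 1) 1%N b = I F 1%N b.
  move=> /inr[bx by_]; rewrite J1 -(Cauchy_formula bx by_ rh) /I.
  have -> : (fun z => F z * (z - b)^-1 ^+ 1) = fun z => F z * (z - b)^-1 by apply/funext => z; rewrite expr1.
  by [].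
have I0 b : normc (b - a) < s -> I (fun=> 1) 1%N b != 0.
  move=> /inr[bx by_]; rewrite J1 -normc_gt0.
  exact: lt_le_trans (bint_inv_ge_rect bx by_).
have I2E G b : bint (fun z => 1%:R * G z * (z - b)^-1 ^+ 2) x1 x2 y1 y2 = I G 2%N b.
  rewrite /I; have -> : (fun z => 1%:R * G z * (z - b)^-1 ^+ 2) = fun z => G z * (z - b)^-1 ^+ 2 by apply/funext => z; rewrite mul1r.
  by [].
have DF b : normc (b - a) < s ->
    cderiv F b = (I F 2%N b - F b * I (fun=> 1) 2%N b) * (I (fun=> 1) 1%N b)^-1.
  move=> bs.
  have hF : holo F b by apply: Fh; apply: lt_trans bs _; rewrite /s; lra.
  have h1 := Ih (fun=> 1) 1%N b (or_introl erefl) bs (fun z _ => one_h z).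
  have h2 := Ih F 1%N b (or_introl erefl) bs rh.
  have h3 := cdiffM (holo_cderiv hF) h1.
  have h4 : cdiff (I F 1%N) b (F b * I (fun=> 1) 2%N b + I (fun=> 1) 1%N b * cderiv F b).
    rewrite -I2E; apply: cdiff_near h3.
    exists (s - normc (b - a)); first by rewrite subr_gt0.
    move=> w ws; apply: FI; have := ler_normcD (w - b) (b - a); rewrite addrA subrK; lra.
  move: (cdiff_cderiv h4); rewrite (cdiff_cderiv h2) I2E => ->.
  by rewrite addrAC subrr add0r mulrC mulKf// I0.
have aa : normc (a - a) < s by rewrite subrr normc0.
have H : holo (fun b => (I F 2%N b - F b * I (fun=> 1) 2%N b) * (I (fun=> 1) 1%N b)^-1) a.
  have hF : holo F a by apply: Fh; rewrite subrr normc0.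
  have J G n : (n = 1 \/ n = 2)%N -> (forall z, crect x1 x2 y1 y2 z -> holo G z) -> holo (I G n) a.
    by move=> n12 Gh; eexists; exact: Ih.
  apply: holoM; last by apply: holoV; [apply: J; [left|]|exact: I0].
  by apply: holoB; [apply: J; [right|]|apply: holoM => //; apply: J; [right|]].
case: H => l Hl; exists l; apply: cdiff_near Hl; exists s => // w ws.
by rewrite DF.
Qed.

End HolomorphicDerivative.

(** * Local mean value inequalities *)

Section IntegralMonotone.
Context d (T : measurableType d) (R : realType) (mu : {measure set T -> \bar R}).
Local Open Scope ereal_scope.

(** The integral of a nonnegative function is a supremum over the simple functions below its
    extension by zero, and this supremum is monotone for arbitrary functions. It therefore also
    compares integrals over angles of expressions such as [tent_power]. *)
Lemma le_integral_ge0 (D D' : set T) (f g : T -> \bar R) :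
  (forall x, D x -> 0 <= f x) -> (forall x, D' x -> 0 <= g x) ->
  (forall x, D x -> f x != 0 -> D' x /\ f x <= g x) ->
  \int[mu]_(x in D) f x <= \int[mu]_(x in D') g x.
Proof.
move=> f0 g0 fg; rewrite !ge0_integralE//; apply: le_ereal_sup => _ [h hf <-].
exists h => // x; apply: (le_trans (hf x)); rewrite !patchE.
case: ifPn => [/set_mem Dx|_]; last first.
  by case: ifPn => // /set_mem /g0.
have [->|fx0] := eqVneq (f x) 0; first by case: ifPn => // /set_mem /g0.
by have [D'x ?] := fg _ Dx fx0; rewrite ifT//; exact/mem_set.
Qed.

End IntegralMonotone.

(** * Measurability in the plane through open squares *)

Section PlaneMeasurability.
Context {R : realType}.
Local Notation mR := (measurableTypeR R).

(** Squares instead of discs: being products of intervals, they suit both Tonelli's theorem and the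
    product sigma-algebra. *)
Definition box (w : R * R) (d : R) : set (R * R) :=
  [set w' | `|w'.1 - w.1| < d /\ `|w'.2 - w.2| < d].

Definition box_open (U : set (R * R)) := forall w, U w ->
  exists2 d, 0 < d & box w d `<=` U.

Lemma measurable_box w d : measurable (box w d : set (mR * mR)).
Proof.
have -> : box w d = ball w.1 d `*` ball w.2 d.
  by apply/seteqP; split => -[x y]; rewrite /box /ball /= ![`|_ - x|]distrC ![`|_ - y|]distrC.
by apply: measurableX; rewrite ball_itv; exact: measurable_itv.
Qed.

(** The product sigma-algebra is generated by rectangles, so an open set is written as the countable
    union of the squares with rational centre and radius [1 / (n + 1)] that it contains. *)
Lemma measurable_box_open (U : set (R * R)) : box_open U ->
  measurable (U : set (mR * mR)).
Proof.
move=> oU.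
pose B (n : nat) (q q' : rat) : set (R * R) :=
  let b := box (ratr q, ratr q') n.+1%:R^-1 in if `[< b `<=` U >] then b else set0.
have -> : U = \bigcup_n \bigcup_q \bigcup_q' B n q q'.
  apply/seteqP; split => [w Uw|w [n _ [q _ [q' _]]]]; last first.
    by rewrite /B; case: asboolP => // bU /bU.
  have [e e0 eU] := oU _ Uw.
  (* A square of radius [1 / (n + 1)] whose centre is that close to [w] stays within
     [2 / (n + 1) < e] of [w]. *)
  pose n := Num.bound (2 / e).
  have n0 : (0 : R) < n.+1%:R^-1 by rewrite invr_gt0.
  have ne : n.+1%:R^-1 < e / 2.
    rewrite -[e / 2]invrK ltf_pV2 ?posrE ?invr_gt0 ?divr_gt0// invf_div.
    rewrite (@lt_trans _ _ n%:R) ?ltr_nat// -[ltRHS]/(n%:R).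
    by rewrite archi_boundP// divr_ge0// ltW.
  have Hs (x : R) : x - n.+1%:R^-1 < x + n.+1%:R^-1.
    by rewrite ltrBlDr -addrA ltrDl addr_gt0.
  have [q] := @rat_in_itvoo R (w.1 - n.+1%:R^-1) (w.1 + n.+1%:R^-1) (Hs _).
  rewrite in_itv /= -ltr_distl => qw.
  have [q'] := @rat_in_itvoo R (w.2 - n.+1%:R^-1) (w.2 + n.+1%:R^-1) (Hs _).
  rewrite in_itv /= -ltr_distl => qw'.
  exists n => //; exists q => //; exists q' => //; rewrite /B /=.
  case: asboolP => [_|]; first by split => /=; rewrite distrC.
  move: ne qw qw'; set s := n.+1%:R^-1; move: s => s ne qw qw'.
  case=> w' [/= h1 h2]; apply: eU; split.
    rewrite (_ : _ - _ = (w'.1 - ratr q) + (ratr q - w.1)); last by ring.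
    by rewrite (le_lt_trans (ler_normD _ _))//; lra.
  rewrite (_ : _ - _ = (w'.2 - ratr q') + (ratr q' - w.2)); last by ring.
  by rewrite (le_lt_trans (ler_normD _ _))//; lra.
apply: bigcupT_measurable => n; apply: bigcupT_measurable_rat => q.
apply: bigcupT_measurable_rat => q'; rewrite /B; case: ifPn => _ //.
exact: measurable_box.
Qed.

Definition box_continuous (U : set (R * R)) (f : R * R -> R) := forall w, U w ->
  forall e, 0 < e -> exists2 d, 0 < d & forall w', box w d w' -> `|f w' - f w| < e.

Lemma measurable_box_continuous (U : set (R * R)) (f : R * R -> R) :
  box_open U -> box_continuous U f ->
  measurable_fun (U : set (mR * mR)) (f : (mR * mR) -> mR).
Proof.
move=> oU fc; apply: (measurability (@measurable_realfun.RGenOInfty.G R)).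
  exact: measurable_realfun.RGenOInfty.measurableE.
move=> _ [_ [a ->] <-]; apply: measurable_box_open => w [Uw /=].
rewrite in_itv /= andbT => afw.
have [d d0 dU] := oU _ Uw.
have [|d' d'0 Hd'] := fc _ Uw (f w - a); first by rewrite subr_gt0.
exists (Num.min d d'); first by rewrite lt_min d0.
move=> w' [h1 h2]; split.
  by apply: dU; split; [move: h1|move: h2]; rewrite lt_min => /andP[].
rewrite /= in_itv /= andbT.
have /Hd' : box w d' w' by split; [move: h1|move: h2]; rewrite lt_min => /andP[].
by rewrite ltr_norml => /andP[+ _]; lra.
Qed.

End PlaneMeasurability.

Section MeanValue.
Context {R : realType}.
Local Notation mR := (measurableTypeR R).
Local Notation mu := (@lebesgue_measure R).
Local Notation mu2 := (mu \x mu)%E.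
Implicit Types (z l a b : R[i]) (F G : R[i] -> R[i]).

Definition to_plane z : R * R := (Re z, Im z).

Lemma to_planeK z : of_plane (to_plane z) = z. Proof. by case: z. Qed.

Lemma EFin_Rintegral (D : set mR) (f : R -> R) : measurable D -> mu.-integrable D (EFin \o f) ->
  (\int[mu]_(x in D) f x)%:E = (\int[mu]_(x in D) (f x)%:E)%E.
Proof. by move=> mD fi; rewrite /Rintegral fineK//; exact: integrable_fin_num. Qed.

Lemma integral_itv_cst (u v c : R) : u <= v ->
  (\int[mu]_(_ in `[u, v]) c%:E)%E = (c * (v - u))%:E.
Proof.
move=> uv; rewrite integral_cst//= EFinM; congr (_ * _)%E.
exact: lebesgue_itvcc.
Qed.

(** Used to select a line on which an integral hardly exceeds its average; the slack [e] makes the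
    contradiction strict. *)
Lemma integral_pigeonhole (G : R -> \bar R) (u v A e : R) : u < v -> 0 < e ->
  0 <= A -> (forall x, 0 <= G x)%E -> (\int[mu]_x G x <= A%:E)%E ->
  exists2 x, u <= x <= v & (G x <= ((A + e) / (v - u))%:E)%E.
Proof.
move=> uv e0 A0 G0 GA; apply: contrapT => nH.
have H x : u <= x <= v -> (((A + e) / (v - u))%:E <= G x)%E.
  by move=> xuv; rewrite leNgt; apply/negP => /ltW Gx; apply: nH; exists x.
have : (((A + e) / (v - u) * (v - u))%:E <= A%:E)%E.
  rewrite -integral_itv_cst ?(ltW uv)//; apply: (le_trans _ GA); apply: le_integral_ge0 => //.
  - move=> x _; rewrite lee_fin; apply: divr_ge0; last by rewrite subr_ge0 (ltW uv).
    by rewrite addr_ge0 ?(ltW e0).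
  - move=> x; rewrite /= in_itv /= => xuv _; split => //.
    exact: H.
by rewrite divfK ?subr_eq0 ?gt_eqF// lee_fin gerDl leNgt e0.
Qed.

Lemma normc_cintB_le (u v : R) (f g : R -> R[i]) : u <= v -> pcont u v f -> pcont u v g ->
  normc (cint u v (fun x => f x - g x)) <=
  2 * (\int[mu]_(x in `[u, v]) normc (f x) + \int[mu]_(x in `[u, v]) normc (g x)).
Proof.
move=> uv fc gc; have fgc := pcontB fc gc.
rewrite (le_trans (normc_cint_le_integral uv fgc))// ler_pM2l//.
have fi := within_integrable (pcont_normc fc).
have gi := within_integrable (pcont_normc gc).
have fgi := within_integrable (pcont_normc fgc).
rewrite -RintegralD//; apply: le_Rintegral => //.
- exact: (@integrableD _ _ _ mu _ _ (EFin \o (@normc R \o f)) (EFin \o (@normc R \o g))).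
- by move=> x _; rewrite (le_trans (ler_normcD _ _))// normc_opp.
Qed.

Lemma normc_bint_le_integral F (x1 x2 y1 y2 : R) : x1 <= x2 -> y1 <= y2 ->
  (forall z, crbd x1 x2 y1 y2 z -> ccont F z) ->
  normc (bint F x1 x2 y1 y2) <= 2 *
    ((\int[mu]_(x in `[x1, x2]) normc (F (x +i* y1)) +
      \int[mu]_(x in `[x1, x2]) normc (F (x +i* y2))) +
     (\int[mu]_(y in `[y1, y2]) normc (F (x2 +i* y)) +
      \int[mu]_(y in `[y1, y2]) normc (F (x1 +i* y)))).
Proof.
move=> x12 y12 Fc; rewrite (le_trans (ler_normcD _ _))// normcM normc_i mul1r mulrDr.
apply: lerD; apply: normc_cintB_le => //.
- by apply: crbd_h Fc _ _; [rewrite lexx|left].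
- by apply: crbd_h Fc _ _; [rewrite lexx y12|right].
- by apply: crbd_v Fc _ _; [rewrite lexx x12|right].
- by apply: crbd_v Fc _ _; [rewrite lexx|left].
Qed.

Lemma box_open_box (w : R * R) d : box_open (box w d).
Proof.
move=> w' [h1 h2]; exists (Num.min (d - `|w'.1 - w.1|) (d - `|w'.2 - w.2|)).
  by rewrite lt_min !subr_gt0 h1.
move=> w'' [k1 k2]; split.
  move: k1; rewrite lt_min ltrBrDr => /andP[k1 _]; apply: le_lt_trans k1.
  by rewrite -{1}(subrK w'.1 w''.1) -addrA ler_normD.
move: k2; rewrite lt_min !ltrBrDr => /andP[_ k2]; apply: le_lt_trans k2.
by rewrite -{1}(subrK w'.2 w''.2) -addrA ler_normD.
Qed.

Definition holo_box F a d := forall z, box (to_plane a) d (to_plane z) -> holo F z.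

Lemma box_continuous_normc F (U : set (R * R)) :
  (forall w, U w -> ccont F (of_plane w)) ->
  box_continuous U (fun w => normc (F (of_plane w))).
Proof.
move=> Fc w /Fc /ccont_normc H e /H[d d0 Hd]; exists (d / 2); first by rewrite divr_gt0.
move=> w' [h1 h2]; apply: Hd; rewrite (le_lt_trans (normc_le_ReIm _))//.
by rewrite complex_ReB complex_ImB (splitr d) ltrD.
Qed.

Lemma measurable_normc_box F a d : holo_box F a d ->
  measurable_fun (box (to_plane a) d : set (mR * mR))
    ((fun w => normc (F (of_plane w))) : mR * mR -> mR).
Proof.
move=> Fh; apply: measurable_box_continuous; first exact: box_open_box.
apply: box_continuous_normc => w bw; apply: holo_ccont; apply: Fh.
by case: w bw.
Qed.

(** In each of four strips of width [d / 4] a line is chosen on which the integral of [|F|] is at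
    most about [4 / d] times the area integral [A]. The four lines bound a rectangle with sides at
    distance at least [d / 4] from [a], so Cauchy's formula and [bint_inv_ge_rect] give
    [4 |F a| <= 2 * 4 * (4 / d) * (4 / d) * A], whence 32. *)
Lemma mean_value_L1 F a d : 0 < d -> holo_box F a d ->
  ((normc (F a) * d ^+ 2)%:E <=
   32%:E * \int[mu2]_(w in box (to_plane a) d) (normc (F (of_plane w)))%:E)%E.
Proof.
move=> d0 Fh; set S := box _ _.
pose g : mR * mR -> \bar R := (fun w => (normc (F (of_plane w)))%:E) \_ S.
have g0 w : (0 <= g w)%E by rewrite /g patchE; case: ifP => // _; rewrite lee_fin normc_ge0.
have mg : measurable_fun [set: mR * mR] g.
  have mF := (measurable_EFinP _ _).2 (measurable_normc_box Fh).
  have mB := measurable_box (to_plane a) d.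
  exact: (measurable_restrictT _ mB).1 mF.
rewrite integral_mkcond -/g.
have [Ioo|Ifin] := eqVneq (\int[mu2]_w g w)%E +oo%E.
  by rewrite Ioo mulry gtr0_sg// mul1e leey.
have I0 : (0 <= \int[mu2]_w g w)%E by exact: integral_ge0.
have {Ifin} Ifin : (\int[mu2]_w g w)%E \is a fin_num.
  by rewrite ge0_fin_numE// ltey.
set A := fine (\int[mu2]_w g w)%E.
have A0 : 0 <= A by rewrite fine_ge0.
have EA : (\int[mu2]_w g w)%E = A%:E by rewrite fineK.
rewrite EA -EFinM lee_fin; apply/ler_addgt0Pr => e e0.
(* The slack is multiplied by 32 at the end and becomes [e]. *)
have e32 : 0 < e / 32 by rewrite divr_gt0.
have F1 : (\int[mu]_x fubini_F mu g x <= A%:E)%E.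
  by rewrite -(@fubini_tonelli1 _ _ _ _ R mu mu g mg g0) EA.
have F2 : (\int[mu]_y fubini_G mu g y <= A%:E)%E.
  by rewrite -(@fubini_tonelli2 _ _ _ _ R mu mu g mg g0) EA.
have G10 x : (0 <= fubini_F mu g x)%E by apply: integral_ge0 => y _; exact: g0.
have G20 x : (0 <= fubini_G mu g x)%E by apply: integral_ge0 => y _; exact: g0.
have [a1 [a2 aE]] : exists a1 a2 : R, a = a1 +i* a2 by case: (a) => u v; exists u, v.
have SE x y : S (x, y) = (`|x - a1| < d /\ `|y - a2| < d) by rewrite /S aE.
have Sin x y : `|x - a1| < d -> `|y - a2| < d -> S (x, y) by rewrite SE.
have [|x2 x2i Hx2] := @integral_pigeonhole _ (a1 + d / 4) (a1 + d / 2) A (e / 32) _ e32 A0 G10 F1.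
  by lra.
have [|x1 x1i Hx1] := @integral_pigeonhole _ (a1 - d / 2) (a1 - d / 4) A (e / 32) _ e32 A0 G10 F1.
  by lra.
have [|y2 y2i Hy2] := @integral_pigeonhole _ (a2 + d / 4) (a2 + d / 2) A (e / 32) _ e32 A0 G20 F2.
  by lra.
have [|y1 y1i Hy1] := @integral_pigeonhole _ (a2 - d / 2) (a2 - d / 4) A (e / 32) _ e32 A0 G20 F2.
  by lra.
have lenE (s : R) : s = d / 4 -> (A + e / 32) / s = (A + e / 32) * (4 / d).
  by move=> ->; rewrite invf_div.
have l1 : a1 + d / 2 - (a1 + d / 4) = d / 4 by clear; lra.
have l2 : a1 - d / 4 - (a1 - d / 2) = d / 4 by clear; lra.
have l3 : a2 + d / 2 - (a2 + d / 4) = d / 4 by clear; lra.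
have l4 : a2 - d / 4 - (a2 - d / 2) = d / 4 by clear; lra.
rewrite l1 (lenE _ erefl) in Hx2; rewrite l2 (lenE _ erefl) in Hx1.
rewrite l3 (lenE _ erefl) in Hy2; rewrite l4 (lenE _ erefl) in Hy1.
have x1a : x1 < a1 by clear -x1i d0; lra. have ax2 : a1 < x2 by clear -x2i d0; lra.
have y1a : y1 < a2 by clear -y1i d0; lra. have ay2 : a2 < y2 by clear -y2i d0; lra.
have x12 : x1 <= x2 by exact/ltW/(lt_trans x1a).
have y12 : y1 <= y2 by exact/ltW/(lt_trans y1a).
have xS x : x1 <= x <= x2 -> `|x - a1| < d by move=> xx; rewrite ltr_distl; clear -xx x1i x2i d0; lra.
have yS y : y1 <= y <= y2 -> `|y - a2| < d by move=> yy; rewrite ltr_distl; clear -yy y1i y2i d0; lra.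
have rS z : crect x1 x2 y1 y2 z -> holo F z.
  by move=> [zx zy]; apply: Fh; split; rewrite /= aE /=; [exact: xS|exact: yS].
have f1 : d / 4 <= `|x1 - a1| by rewrite distrC ger0_norm; clear -x1i d0; lra.
have f2 : d / 4 <= `|x2 - a1| by rewrite ger0_norm; clear -x2i d0; lra.
have f3 : d / 4 <= `|y1 - a2| by rewrite distrC ger0_norm; clear -y1i d0; lra.
have f4 : d / 4 <= `|y2 - a2| by rewrite ger0_norm; clear -y2i d0; lra.
have za z : crbd x1 x2 y1 y2 z -> d / 4 <= normc (z - a).
  move=> [_ H]; have [H1|H1] : d / 4 <= `|Re (z - a)| \/ d / 4 <= `|Im (z - a)|.
    by rewrite complex_ReB complex_ImB aE /=; case: H => [->|[->|[->|->]]];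
      [left|left|right|right].
  - exact: le_trans H1 (normr_Re_le _).
  - exact: le_trans H1 (normr_Im_le _).
pose G z := F z * (z - a)^-1.
have Gc z : crbd x1 x2 y1 y2 z -> ccont G z.
  move=> zb; have zna : z != a.
    by apply/eqP => E; have := za _ zb; rewrite E subrr normc0 leNgt divr_gt0.
  apply: holo_ccont; apply: holoM; first by apply: rS; case: zb.
  by have := holo_kernel 1 zna; rewrite (_ : (fun _ => _) = (fun z => (z - a)^-1))//; apply/funext => w; rewrite expr1.
have GF z : crbd x1 x2 y1 y2 z -> normc (G z) <= 4 / d * normc (F z).
  move=> zb; rewrite /G normcM mulrC ler_wpM2r ?normc_ge0// normcV.
  have zn0 : 0 < normc (z - a) by apply: lt_le_trans (za _ zb); rewrite divr_gt0.
  by rewrite -[4 / d]invf_div lef_pV2 ?posrE ?divr_gt0// za.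
have Fc z : crbd x1 x2 y1 y2 z -> ccont F z by move=> [/rS /holo_ccont].
have side (u v : R) (p : R -> R[i]) (H : \bar R) : u <= v ->
    (forall t, u <= t <= v -> crbd x1 x2 y1 y2 (p t)) ->
    pcont u v (fun t => F (p t)) -> pcont u v (fun t => G (p t)) ->
    (\int[mu]_(t in `[u, v]) (normc (F (p t)))%:E <= H)%E ->
    (H <= ((A + e / 32) * (4 / d))%:E)%E ->
    \int[mu]_(t in `[u, v]) normc (G (p t)) <= 4 / d * ((A + e / 32) * (4 / d)).
  move=> uv pb Fp Gp FH HA.
  have iF := within_integrable (pcont_normc Fp).
  have iG := within_integrable (pcont_normc Gp).
  have FA : \int[mu]_(t in `[u, v]) normc (F (p t)) <= (A + e / 32) * (4 / d).
    by rewrite -lee_fin EFin_Rintegral// (le_trans FH).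
  rewrite (@le_trans _ _ (4 / d * \int[mu]_(t in `[u, v]) normc (F (p t))))//; last first.
    by rewrite ler_pM2l ?divr_gt0.
  rewrite -RintegralZl//; apply: le_Rintegral => //.
  - exact: (@integrableZl _ _ _ mu _ _ (4 / d) (EFin \o (fun t => normc (F (p t))))).
  - by move=> t; rewrite /= in_itv /= => /pb /GF.
have sideE (u v : R) (p : R -> R * R) : (forall t, u <= t <= v -> S (p t)) ->
   (\int[mu]_(t in `[u, v]) (normc (F (of_plane (p t))))%:E <= \int[mu]_t g (p t))%E.
  move=> pS; apply: le_integral_ge0 => //.
  - by move=> t _; rewrite lee_fin normc_ge0.
  - move=> t; rewrite /= in_itv /= => /pS Sp _; split => //.
    by rewrite /g patchE ifT//; exact/mem_set.
have bh y : y1 <= y <= y2 -> y = y1 \/ y = y2 -> forall t, x1 <= t <= x2 -> crbd x1 x2 y1 y2 (t +i* y).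
  by move=> yy yE t tx; split; [split|right; right].
have bv x : x1 <= x <= x2 -> x = x1 \/ x = x2 -> forall t, y1 <= t <= y2 -> crbd x1 x2 y1 y2 (x +i* t).
  by move=> xx xE t tx; split; [split|case: xE; [left|right; left]].
have y1i' : y1 <= y1 <= y2 by rewrite lexx.
have y2i' : y1 <= y2 <= y2 by rewrite lexx y12.
have x1i' : x1 <= x1 <= x2 by rewrite lexx.
have x2i' : x1 <= x2 <= x2 by rewrite lexx x12.
have s1 := side x1 x2 (fun t => t +i* y1) _ x12 (bh _ y1i' (or_introl erefl))
  (crbd_h Fc y1i' (or_introl erefl)) (crbd_h Gc y1i' (or_introl erefl))
  (sideE x1 x2 (fun t => (t, y1)) (fun t tt => Sin _ _ (xS _ tt) (yS _ y1i'))) Hy1.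
have s2 := side x1 x2 (fun t => t +i* y2) _ x12 (bh _ y2i' (or_intror erefl))
  (crbd_h Fc y2i' (or_intror erefl)) (crbd_h Gc y2i' (or_intror erefl))
  (sideE x1 x2 (fun t => (t, y2)) (fun t tt => Sin _ _ (xS _ tt) (yS _ y2i'))) Hy2.
have s3 := side y1 y2 (fun t => x1 +i* t) _ y12 (bv _ x1i' (or_introl erefl))
  (crbd_v Fc x1i' (or_introl erefl)) (crbd_v Gc x1i' (or_introl erefl))
  (sideE y1 y2 (fun t => (x1, t)) (fun t tt => Sin _ _ (xS _ x1i') (yS _ tt))) Hx1.
have s4 := side y1 y2 (fun t => x2 +i* t) _ y12 (bv _ x2i' (or_intror erefl))
  (crbd_v Fc x2i' (or_intror erefl)) (crbd_v Gc x2i' (or_intror erefl))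
  (sideE y1 y2 (fun t => (x2, t)) (fun t tt => Sin _ _ (xS _ x2i') (yS _ tt))) Hx2.
have ax : x1 < Re a < x2 by rewrite aE /= x1a.
have ay : y1 < Im a < y2 by rewrite aE /= y1a.
have := normc_bint_le_integral x12 y12 Gc.
rewrite /G (Cauchy_formula ax ay rS) normcM => H.
have H4 : 4 * normc (F a) <= normc (F a) * normc (bint (fun z => (z - a)^-1) x1 x2 y1 y2).
  by rewrite mulrC ler_wpM2l ?normc_ge0//; exact: bint_inv_ge_rect.
have {H H4} H : 4 * normc (F a) <= 8 * (4 / d * ((A + e / 32) * (4 / d))).
  apply: (le_trans H4); apply: (le_trans H); rewrite /G in s1 s2 s3 s4.
  move: (lerD (lerD s1 s2) (lerD s4 s3)); clear; lra.
have -> : 32 * A + e = (8 * (4 / d * ((A + e / 32) * (4 / d)))) / 4 * d ^+ 2.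
  by field; rewrite gt_eqF.
by rewrite ler_pM2r ?exprn_gt0// ler_pdivlMr// mulrC.
Qed.

End MeanValue.

Section MeanValueSqrt.
Context {R : realType}.
Local Notation mR := (measurableTypeR R).
Local Notation mu := (@lebesgue_measure R).
Local Notation mu2 := (mu \x mu)%E.
Implicit Types (z l a b : R[i]) (F G : R[i] -> R[i]).

Lemma box_subset (w w' : R * R) (d d' : R) :
  `|w.1 - w'.1| + d <= d' -> `|w.2 - w'.2| + d <= d' -> box w d `<=` box w' d'.
Proof.
move=> h1 h2 w'' [k1 k2]; split.
  rewrite -(subrK w.1 w''.1) -addrA (le_lt_trans (ler_normD _ _))//; lra.
rewrite -(subrK w.2 w''.2) -addrA (le_lt_trans (ler_normD _ _))//; lra.
Qed.

Lemma measurable_sqrt_box F a d : holo_box F a d ->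
  measurable_fun (box (to_plane a) d : set (mR * mR))
    ((fun w => Num.sqrt (normc (F (of_plane w)))) : mR * mR -> mR).
Proof.
move=> Fh; apply: measurableT_comp; last exact: measurable_normc_box.
by apply: continuous_measurable_fun; exact: sqrt_continuous.
Qed.

(* Applying the mean value inequality for |F| around a near-maximum of
   (D - |z - a|)^4 |F z|, where |F| cannot grow much, lowers the exponent. *)
Lemma mean_value_sqrt F a d : 0 < d -> holo_box F a d ->
  ((Num.sqrt (normc (F a)) * d ^+ 2)%:E <=
   (32 * 192)%:E * \int[mu2]_(w in box (to_plane a) d) (Num.sqrt (normc (F (of_plane w))))%:E)%E.
Proof.
move=> d0 Fh; set I := (\int[mu2]_(w in _) _)%E.
have I0 : (0 <= I)%E by apply: integral_ge0 => w _; rewrite lee_fin sqrtr_ge0.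
have [Fa0|Fa0] := eqVneq (normc (F a)) 0.
  by rewrite Fa0 sqrtr0 mul0r mule_ge0// lee_fin mulr_ge0 ?ler0n.
have {}Fa0 : 0 < normc (F a) by rewrite lt_neqAle eq_sym Fa0 normc_ge0.
pose D := d / 2; have D0 : 0 < D by rewrite divr_gt0.
have Dd : D < d by rewrite /D; clear -d0; lra.
pose N z := Num.max `|Re z - Re a| `|Im z - Im a|.
have N0 z : 0 <= N z by rewrite /N le_max normr_ge0.
have Na : N a = 0 by rewrite /N !subrr normr0 maxxx.
have [B HB] : exists B, forall z, N z < D -> normc (F z) <= B.
  have [|B HB] := @crect_bounded _ F (Re a - D) (Re a + D) (Im a - D) (Im a + D).
    move=> z [zx zy]; apply: holo_ccont; apply: Fh; split => /=;
      by apply: le_lt_trans Dd; rewrite ler_distl.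
  exists B => z; rewrite /N gt_max => /andP[z1 z2]; apply: HB.
  by split; rewrite -ler_distl ltW.
(* The exponent 4 makes [Num.sqrt (psi z)] carry [(D - N z) ^+ 2], the scale of an area. *)
pose psi z := (D - N z) ^+ 4 * normc (F z).
pose P := [set psi z | z in [set z | N z < D]].
have Pa : P (psi a) by exists a => //=; rewrite Na.
have psia : 0 < psi a by rewrite /psi Na subr0 mulr_gt0// exprn_gt0.
have Pub : has_ubound P.
  exists (D ^+ 4 * B) => _ [z Nz <-]; apply: ler_pM => //.
  - by rewrite exprn_ge0// subr_ge0 ltW.
  - exact: normc_ge0.
  - by apply: lerXn2r; rewrite ?nnegrE ?subr_ge0 ?(ltW Nz) ?(ltW D0)// gerBl.
  - exact: HB.
have hsP : has_sup P by split; [exists (psi a)|].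
have A0 : 0 < sup P by apply: lt_le_trans psia _; exact: ub_le_sup.
have [|_ [z0 Nz0 <-] Hz0] := @sup_adherent _ P (sup P / 2) _ hsP; first by rewrite divr_gt0.
have {}Hz0 : sup P / 2 < psi z0 by move: Hz0; clear; lra.
have psiz0 : 0 < psi z0 by apply: lt_trans Hz0; rewrite divr_gt0.
pose e := (D - N z0) / 2; have e0 : 0 < e by rewrite divr_gt0// subr_gt0.
have DNe : D - N z0 = 2 * e by rewrite /e; clear; lra.
have sub : box (to_plane z0) e `<=` box (to_plane a) d.
  have k : N z0 + e <= d by move: DNe Dd e0; clear; lra.
  have : Num.max `|Re z0 - Re a| `|Im z0 - Im a| <= d - e by rewrite -/(N z0) lerBrDr.
  by rewrite ge_max => /andP[k1 k2]; apply: box_subset; rewrite /= -lerBrDr.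
have Fh0 : holo_box F z0 e by move=> z /sub /Fh.
have psiE : psi z0 = 16 * e ^+ 4 * normc (F z0).
  by rewrite /psi DNe exprMn -natrX.
have Fz0 : 0 < normc (F z0).
  by move: psiz0; rewrite psiE pmulr_rgt0// mulr_gt0// exprn_gt0.
(* The distance [D - N] is at least [e] on this square, against [2 e] at its centre, and [psi z0] is
   at least half the supremum: this costs [2 ^ 4 * 2]. *)
have growth w : box (to_plane z0) e w -> normc (F (of_plane w)) <= 32 * normc (F z0).
  move=> [/= w1 w2].
  have Nw : N (of_plane w) <= N z0 + e.
    rewrite /N ge_max /=; apply/andP; split.
      rewrite -(subrK (Re z0) w.1) -addrA (le_trans (ler_normD _ _))// [leRHS]addrC lerD ?(ltW w1)//.
      by rewrite le_max lexx.
    rewrite -(subrK (Im z0) w.2) -addrA (le_trans (ler_normD _ _))// [leRHS]addrC lerD ?(ltW w2)//.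
    by rewrite le_max lexx orbT.
  have DNw : e <= D - N (of_plane w) by move: Nw DNe; clear; lra.
  have Pw : psi (of_plane w) <= sup P.
    by apply: ub_le_sup => //; exists (of_plane w) => //=; move: DNw e0; clear; lra.
  have e4 : 0 < e ^+ 4 by rewrite exprn_gt0.
  rewrite -(ler_pM2l e4) (@le_trans _ _ (psi (of_plane w)))//.
    rewrite /psi ler_wpM2r ?normc_ge0//; apply: lerXn2r => //; rewrite ?nnegrE ?(ltW e0)//.
    exact: le_trans (ltW e0) DNw.
  by apply: (le_trans Pw); move: Hz0; rewrite psiE mulrCA; clear; lra.
have L1 := mean_value_L1 e0 Fh0.
pose c := Num.sqrt (normc (F z0)).
have c0 : 0 < c by rewrite sqrtr_gt0.
have cE : normc (F z0) = c ^+ 2 by rewrite sqr_sqrtr ?normc_ge0.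
(* By the growth bound [|F|] is at most [6 c] times its square root; with the constant 32 of
   [mean_value_L1] this makes 192, and one factor [c] then cancels. *)
have s32 : Num.sqrt 32 <= 6 :> R.
  by rewrite (_ : 6 = Num.sqrt (6 ^+ 2)) ?ler_wsqrtr ?sqrtr_sqr ?ger0_norm// -natrX ler_nat.
have bound : (\int[mu2]_(w in box (to_plane z0) e) (normc (F (of_plane w)))%:E <=
   (6 * c)%:E * I)%E.
  have mB := measurable_box (to_plane a) d.
  have mS := (measurable_EFinP _ _).2 (measurable_sqrt_box Fh).
  have c6 : 0 <= 6 * c by rewrite mulr_ge0// ltW.
  have -> : ((6 * c)%:E * I = \int[mu2]_(w in box (to_plane a) d)
      ((6 * c)%:E * (Num.sqrt (normc (F (of_plane w))))%:E))%E.
    by rewrite ge0_integralZl//; move=> w _; rewrite lee_fin sqrtr_ge0.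
  apply: le_integral_ge0.
  - by move=> w _; rewrite lee_fin normc_ge0.
  - by move=> w _; rewrite mule_ge0// lee_fin sqrtr_ge0.
  move=> w bw _; split; first exact: sub.
  rewrite -EFinM lee_fin -{1}(sqr_sqrtr (normc_ge0 (F (of_plane w)))) expr2.
  rewrite ler_wpM2r ?sqrtr_ge0//.
  apply: (@le_trans _ _ (Num.sqrt (32 * normc (F z0)))); first by rewrite ler_wsqrtr// growth.
  by rewrite sqrtrM// ler_wpM2r ?sqrtr_ge0.
have key : ((c * e ^+ 2)%:E <= 192%:E * I)%E.
  have : ((c ^+ 2 * e ^+ 2)%:E <= (c * 192)%:E * I)%E.
    rewrite -cE (le_trans L1)// (@le_trans _ _ (32%:E * ((6 * c)%:E * I))%E)//.
      by rewrite lee_wpmul2l// lee_fin.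
    by rewrite muleA -EFinM (_ : 32 * (6 * c) = c * 192)//; ring.
  rewrite (_ : c ^+ 2 * e ^+ 2 = c * (c * e ^+ 2)); last by ring.
  by rewrite (EFinM c) (EFinM c 192) -muleA lee_pmul2l.
rewrite (@le_trans _ _ (32%:E * (c * e ^+ 2)%:E)%E)//; last first.
  rewrite (@le_trans _ _ (32%:E * (192%:E * I))%E)//.
    by rewrite lee_wpmul2l// lee_fin.
  by rewrite muleA -EFinM.
rewrite -EFinM lee_fin.
(* The factor 4 replaces 2 to give the root a rational value, [8 e^2 c]. Since [D = d / 2], it
   becomes [32 e^2 c], the first factor of the constant. *)
have : Num.sqrt (psi a) <= Num.sqrt (4 * psi z0).
  rewrite ler_wsqrtr// (@le_trans _ _ (sup P))//; first exact: ub_le_sup.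
  by move: Hz0 psiz0; clear; lra.
have -> : Num.sqrt (psi a) = D ^+ 2 * Num.sqrt (normc (F a)).
  rewrite /psi Na subr0 sqrtrM ?exprn_ge0 ?(ltW D0)// -[4%N]/(2 * 2)%N exprM sqrtr_sqr.
  by rewrite ger0_norm// exprn_ge0 ?ltW.
have -> : Num.sqrt (4 * psi z0) = 8 * (e ^+ 2 * c).
  have -> : 4 * psi z0 = (8 * (e ^+ 2 * c)) ^+ 2 by rewrite psiE cE; ring.
  by rewrite sqrtr_sqr ger0_norm// mulr_ge0// mulr_ge0 ?exprn_ge0 ?(ltW e0) ?(ltW c0).
by rewrite /D expr_div_n -natrX; clear; lra.
Qed.

End MeanValueSqrt.

(** * Exponential polar coordinates *)

Section ComplexExponential.
Context {R : realType}.
Implicit Types (z l a b : R[i]) (F G : R[i] -> R[i]).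

Lemma normc_polar (r t : R) : normc (polar r t) = `|r|.
Proof.
by rewrite /polar /normc !exprMn -mulrDr cos2Dsin2 mulr1 sqrtr_sqr.
Qed.

Lemma polarD (r s t u : R) : polar (r * s) (t + u) = polar r t * polar s u.
Proof.
apply/eqP; rewrite eq_complex complex_ReM complex_ImM /= cosD sinD.
by apply/andP; split; apply/eqP; ring.
Qed.

Lemma polarD2pi (r t : R) : polar r (t + 2 * pi) = polar r t.
Proof.
have -> : t + 2 * pi = t + pi *+ 2 by rewrite mulr_natl.
by rewrite /polar cosD sinD cos2pi sin2pi !mulr1 !mulr0 subr0 addr0.
Qed.

Definition cexp z := polar (expR (Re z)) (Im z).

Lemma cexpD z w : cexp (z + w) = cexp z * cexp w.
Proof. by rewrite /cexp complex_ReD complex_ImD expRD polarD. Qed.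

Lemma normc_cexp z : normc (cexp z) = expR (Re z).
Proof. by rewrite normc_polar ger0_norm// expR_ge0. Qed.

Lemma is_derive_bound (f : R -> R) (x l e : R) : is_derive x 1 f l -> 0 < e ->
  exists2 d, 0 < d & forall h, `|h| < d -> `|f (h + x) - f x - l * h| <= e * `|h|.
Proof.
move=> [/cvg_ex[l' Fl'] Dl] e0.
have {Dl} ll' : l' = l by rewrite -Dl; apply/esym/cvg_lim.
rewrite {}ll' in Fl'; move: Fl' => /cvgrPdist_le/(_ _ e0)/nbhs_ballP[d /= d0 Hd].
exists d => // h hd; have [->|h0] := eqVneq h 0.
  by rewrite add0r subrr mulr0 subrr normr0 mulr0.
have := Hd h; rewrite /ball /= sub0r normrN => /(_ hd h0).
rewrite /GRing.scale /= mulr1 => H.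
have h1 : 0 < `|h| by rewrite normr_gt0.
rewrite -(ler_pM2r h1) -normrM mulrBl mulrAC mulVf// mul1r in H.
by rewrite distrC.
Qed.

Lemma cdiff_cexp0 : cdiff cexp 0 1.
Proof.
move=> e e0.
(* The real part will err by at most [3 s |w|] and the imaginary part by at most [5 s |w|], hence
   the 8. *)
have [s [s0 s1 se]] : exists s, [/\ 0 < s, s <= 1 & s * 8 <= e].
  exists (Num.min (e / 8) 1); split; first by rewrite lt_min ltr01 andbT divr_gt0.
    by rewrite ge_min lexx orbT.
  by rewrite -ler_pdivlMr// ge_min lexx.
have [d1 d10 H1] := is_derive_bound (is_derive_expR (0 : R)) s0.
have [d2 d20 H2] := is_derive_bound (is_derive_cos (0 : R)) s0.
have [d3 d30 H3] := is_derive_bound (is_derive_sin (0 : R)) s0.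
exists (Num.min (Num.min d1 d2) (Num.min d3 s)).
  by rewrite !lt_min d10 d20 d30.
move=> w; rewrite subr0 !lt_min => /andP[/andP[w1 w2] /andP[w3 w4]].
have uw := normr_Re_le w; have vw := normr_Im_le w.
set u := Re w in uw *; set v := Im w in vw *.
have {}H1 := H1 u (le_lt_trans uw w1); rewrite addr0 expR0 mul1r in H1.
have {}H2 := H2 v (le_lt_trans vw w2); rewrite addr0 cos0 sin0 oppr0 mul0r subr0 in H2.
have {}H3 := H3 v (le_lt_trans vw w3); rewrite addr0 sin0 cos0 subr0 mul1r in H3.
have us : `|u| <= s by exact: le_trans uw (ltW w4).
have E0 : cexp 0 = 1 by rewrite /cexp /polar /= expR0 cos0 sin0; simpc.
rewrite E0 mul1r; apply: (le_trans (normc_le_ReIm _)).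
rewrite 2!complex_ReB 2!complex_ImB /= -/u -/v subr0.
have cv : `|cos v| <= 1 by rewrite ler_norml cos_geN1 cos_le1.
set n := normc w in uw vw w1 w2 w3 w4 *.
have n0 : 0 <= n by exact: normc_ge0.
have R1 : `|expR u * cos v - 1 - u| <= 3 * s * n.
  rewrite (_ : _ - u = (expR u - 1 - u) * cos v + (1 + u) * (cos v - 1)); last by ring.
  rewrite (le_trans (ler_normD _ _))// !normrM (_ : 3 * s * n = (s * n) * 1 + 2 * (s * n)); last by ring.
  apply: lerD; apply: ler_pM => //.
  - by rewrite (le_trans H1)// ler_pM2l.
  - by rewrite (le_trans (ler_normD _ _))// normr1; move: us s1; clear; lra.
  - by rewrite (le_trans H2)// ler_pM2l.
have eu : `|expR u - 1| <= 2 * s.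
  rewrite -[X in `|X|](subrK u) (le_trans (ler_normD _ _))//.
  have : `|expR u - 1 - u| <= s * 1 by rewrite (le_trans H1)// ler_pM2l// (le_trans us).
  by move: us; clear; lra.
have R2 : `|expR u * sin v - v| <= 5 * s * n.
  rewrite (_ : _ - v = expR u * (sin v - v) + (expR u - 1) * v); last by ring.
  rewrite (le_trans (ler_normD _ _))// !normrM (_ : 5 * s * n = 3 * (s * n) + 2 * s * n); last by ring.
  apply: lerD; apply: ler_pM => //.
  - rewrite -[X in `|X|](subrK 1) (le_trans (ler_normD _ _))// normr1.
    by move: eu s1; clear; lra.
  - by rewrite (le_trans H3)// ler_pM2l.
apply: (le_trans (lerD R1 R2)).
by rewrite -mulrDl -mulrDl; apply: ler_wpM2r => //; move: se; clear; lra.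
Qed.

Lemma holo_cexp z : holo cexp z.
Proof.
have H0 : holo cexp 0 by exists 1; exact: cdiff_cexp0.
have H : holo (fun w => cexp z * (cexp \o (fun w => w - z)) w) z.
  apply: holoM; first exact: holo_cst.
  apply: holo_comp; last by rewrite subrr.
  by apply: holoB; [exact: holo_id|exact: holo_cst].
suff -> : cexp = (fun w => cexp z * (cexp \o (fun w => w - z)) w) by [].
by apply/funext => w /=; rewrite -cexpD addrC subrK.
Qed.

(** Goursat's theorem for [F \o cexp] on [[x0, x1] x [0, 2 pi]], with [x1 = ln rho]: the horizontal
    sides cancel by periodicity, and for [x0] very negative the left side is close to [2 pi F 0].
    The factor 2 is that of [normc_cint_le]. *)
Lemma circle_mean F (rho B : R) : 0 < rho < 1 ->
  (forall z, normc z < 1 -> holo F z) ->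
  (forall t, normc (F (polar rho t)) <= B) -> normc (F 0) <= 2 * B.
Proof.
move=> /andP[rho0 rho1] Fh FB; apply/ler_addgt0Pr => e e0.
have [d d0 Hd] : exists2 d, 0 < d & forall w, normc (w - 0) < d -> normc (F w - F 0) < e / 2.
  by apply: (holo_ccont (Fh 0 _)); [rewrite normc0|rewrite divr_gt0].
pose G := F \o cexp.
have Gh z : Re z < 0 -> holo G z.
  move=> z0; apply: holo_comp; first exact: holo_cexp.
  by apply: Fh; rewrite normc_cexp -expR0 ltr_expR.
pose x1 := ln rho.
have x10 : x1 < 0 by rewrite ln_lt0// rho0.
pose x0 := Num.min (x1 - 1) (ln (d / 2)).
have x01 : x0 < x1 by rewrite gt_min gtrBl ltr01.
have x0d : expR x0 < d.
  apply: (@le_lt_trans _ _ (d / 2)); last by rewrite ltr_pdivrMr// mulr_natr mulr2n ltrDl.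
  by rewrite -[leRHS]lnK ?posrE ?divr_gt0// ler_expR ge_min lexx orbT.
have p0 : 0 < 2 * pi :> R by rewrite mulr_gt0// pi_gt0.
have rh z : crect x0 x1 0 (2 * pi) z -> holo G z.
  by move=> [/andP[_ zx] _]; apply: Gh; exact: le_lt_trans zx x10.
have rc z : crbd x0 x1 0 (2 * pi) z -> ccont G z by move=> [/rh /holo_ccont].
have := Goursat x01 p0 rh; rewrite /bint.
rewrite (@eq_cint _ x0 x1 _ (fun=> 0)); last first.
  by move=> x _; rewrite /G /= /cexp /= -[in X in _ - F X](add0r (2 * pi)) polarD2pi subrr.
rewrite (cint_cst _ (ltW x01)) mul0r add0r => /eqP; rewrite mulf_eq0 => /orP[/eqP i0|/eqP H].
  have := @normc_i R; rewrite [X in normc X = _](i0 : _ = 0) normc0 => /eqP.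
  by rewrite eq_sym oner_eq0.
have v1 : pcont 0 (2 * pi) (fun y => G (x1 +i* y)).
  by apply: crbd_v rc _ _; [rewrite lexx ltW|right].
have v0 : pcont 0 (2 * pi) (fun y => G (x0 +i* y)).
  by apply: crbd_v rc _ _; [rewrite lexx ltW|left].
have cc (l : R[i]) : pcont 0 (2 * pi) (fun=> l).
  by move=> x _ e' e'0; exists 1 => // y _; rewrite subrr normc0.
have E : F 0 * (2 * pi)%:C = cint 0 (2 * pi) (fun y => G (x1 +i* y)) +
    cint 0 (2 * pi) (fun y => F 0 - G (x0 +i* y)).
  rewrite -cintD//; last by apply: pcontB.
  rewrite (@eq_cint _ _ _ _ (fun y => F 0 + (G (x1 +i* y) - G (x0 +i* y)))); last first.
    by move=> y _; rewrite addrCA.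
  rewrite cintD//; last by apply: pcontB.
  by rewrite H addr0 (cint_cst _ (ltW p0)) subr0.
have : normc (F 0 * (2 * pi)%:C) <= 2 * B * (2 * pi - 0) + 2 * (e / 2) * (2 * pi - 0).
  rewrite E (le_trans (ler_normcD _ _))//; apply: lerD; apply: normc_cint_le; rewrite ?ltW//.
  - by move=> y _; rewrite /G /= /cexp /= lnK.
  - exact: pcontB.
  - move=> y _; rewrite normcBC ltW//; apply: Hd.
    by rewrite subr0 normc_cexp.
rewrite normcM normc_real (gtr0_norm p0) !subr0 -mulrDl (ler_pM2r p0).
by rewrite (_ : 2 * (e / 2) = e)//; field.
Qed.

(* The maximum principle up to a factor, obtained by moving z to the origin
   with a Moebius map and averaging over a circle close to the boundary. *)
Lemma weak_maximum_principle F (r0 r1 B : R) : 0 < r0 < r1 -> r1 < 1 ->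
  (forall z, normc z < 1 -> holo F z) ->
  (forall z, r0 < normc z < r1 -> normc (F z) <= B) ->
  forall z, normc z <= r0 -> normc (F z) <= 2 * B.
Proof.
move=> /andP[r00 r01] r11 Fh FB z zr0.
have r10 : 0 < r1 by exact: lt_trans r01.
pose a := (r1^-1)%:C * z.
(* After division by [r1] the annulus becomes [s < |w| < 1]. *)
pose s := r0 / r1; have s0 : 0 < s by rewrite divr_gt0.
have s1 : s < 1 by rewrite ltr_pdivrMr// mul1r.
have as_ : normc a <= s.
  by rewrite /a normcM normc_real gtr0_norm ?invr_gt0// mulrC ler_wpM2r// invr_ge0 ltW.
(* This is [1 - rho^2] for the circle to be used. On it [1 - |psi w|^2] is at most [q / (1 - s)^2],
   which is less than [1 - s^2], so its Moebius image stays in the annulus where [F] is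
   controlled. *)
pose q := (1 - s ^+ 2) * (1 - s) ^+ 2 / 2.
have s2 : 0 < 1 - s ^+ 2 by rewrite subr_gt0 expr_lt1// ltW.
have s2' : 1 - s ^+ 2 < 1 by rewrite gtrBl exprn_gt0.
have t0 : 0 < 1 - s by rewrite subr_gt0.
have t1 : (1 - s) ^+ 2 < 1 by rewrite expr_lt1// ?ltW// gtrBl.
have q0 : 0 < q by rewrite divr_gt0// mulr_gt0// exprn_gt0.
have q1 : q < 1.
  rewrite /q ltr_pdivrMr// mul1r (@lt_trans _ _ 1)// ?ltr1n//.
  by have := ltr_pM (ltW s2) (exprn_ge0 2 (ltW t0)) s2' t1; rewrite mulr1.
pose rho := Num.sqrt (1 - q).
have rho2 : rho ^+ 2 = 1 - q by rewrite sqr_sqrtr// subr_ge0 ltW.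
have rho0 : 0 < rho by rewrite sqrtr_gt0 subr_gt0.
have rho1 : rho < 1 by rewrite -sqrtr1 ltr_sqrt// gtrBl.
have den w : normc w < 1 -> 1 - s <= normc (1 + conjc a * w).
  move=> w1.
  have aw : normc (conjc a * w) <= s.
    rewrite normcM -[leRHS]mulr1 ler_pM ?normc_ge0 ?(ltW w1)//.
    by move: as_; case: (a) => u v; rewrite /normc /= sqrrN.
  have := ler_normcB 1 (- (conjc a * w)); rewrite opprK normc_opp normc1.
  by move: aw; clear; lra.
pose psi w := (w + a) / (1 + conjc a * w).
have idt w : (normc (1 + conjc a * w)) ^+ 2 - (normc (w + a)) ^+ 2 =
    (1 - normc a ^+ 2) * (1 - normc w ^+ 2).
  have nE (u v : R) : normc (u +i* v) ^+ 2 = u ^+ 2 + v ^+ 2.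
    by rewrite /normc sqr_sqrtr// addr_ge0// sqr_ge0.
  case: w => w1 w2; case: (a) => a1 a2.
  rewrite (_ : 1 + _ = (1 + (a1 * w1 + a2 * w2)) +i* (a1 * w2 - a2 * w1)); last first.
    by apply/eqP; rewrite eq_complex /=; apply/andP; split; apply/eqP; ring.
  rewrite (_ : _ + _ +i* _ = (w1 + a1) +i* (w2 + a2))// !nE; ring.
have psi_lt w : normc w < 1 -> normc (psi w) ^+ 2 =
    1 - (1 - normc a ^+ 2) * (1 - normc w ^+ 2) / normc (1 + conjc a * w) ^+ 2.
  move=> w1; have d0 : 0 < normc (1 + conjc a * w) by exact: lt_le_trans (den _ w1).
  rewrite /psi normcM normcV -idt; field; exact: lt0r_neq0.
have na2 : 0 < 1 - normc a ^+ 2.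
  by apply: lt_le_trans s2 _; rewrite lerD2l lerN2 lerXn2r ?nnegrE ?normc_ge0// ltW.
have psi1 w : normc w < 1 -> normc (psi w) < 1.
  move=> w1; have d0 : 0 < normc (1 + conjc a * w) by exact: lt_le_trans (den _ w1).
  rewrite -(@ltr_pXn2r _ 2)// ?nnegrE ?normc_ge0// expr1n psi_lt// gtrBl.
  by rewrite divr_gt0 ?exprn_gt0// mulr_gt0// subr_gt0 expr_lt1// normc_ge0.
pose G w := F (r1%:C * psi w).
have Gh w : normc w < 1 -> holo G w.
  move=> w1; apply: (@holo_comp _ (fun w => r1%:C * psi w) F).
    apply: holoM; first exact: holo_cst.
    apply: holoM; first by apply: holoD; [exact: holo_id|exact: holo_cst].
    apply: holoV; last by rewrite -normc_gt0; exact: lt_le_trans (den _ w1).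
    by apply: holoD; [exact: holo_cst|apply: holoM; [exact: holo_cst|exact: holo_id]].
  apply: Fh; rewrite normcM normc_real gtr0_norm//.
  by have := ltr_pM (ltW r10) (normc_ge0 _) r11 (psi1 _ w1); rewrite mulr1.
have -> : F z = G 0.
  rewrite /G /psi mulr0 addr0 add0r divr1 /a mulrA -rmorphM /= divff ?mul1r//.
  exact: lt0r_neq0.
apply: (@circle_mean G rho B); rewrite ?rho0// => t.
have nw : normc (polar rho t) = rho by rewrite normc_polar gtr0_norm.
have w1 : normc (polar rho t) < 1 by rewrite nw.
apply: FB; rewrite normcM normc_real gtr0_norm//; apply/andP; split; last first.
  by rewrite -[ltRHS]mulr1 ltr_pM2l// psi1.
rewrite mulrC -ltr_pdivrMr// -/s -(@ltr_pXn2r _ 2)// ?nnegrE ?normc_ge0 ?ltW//.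
rewrite psi_lt// nw rho2 opprB addrCA subrr addr0 ltrBrDl -ltrBrDr.
have dd := den _ w1.
have dp : 0 < normc (1 + conjc a * polar rho t) by exact: lt_le_trans dd.
rewrite ltr_pdivrMr ?exprn_gt0//.
apply: (@le_lt_trans _ _ q).
  by rewrite -[leRHS]mul1r ler_wpM2r ?(ltW q0)// gerBl sqr_ge0.
apply: (@lt_le_trans _ _ ((1 - s ^+ 2) * (1 - s) ^+ 2)).
  by rewrite /q ltr_pdivrMr// ltr_pMr ?ltr1n// mulr_gt0// exprn_gt0.
rewrite ler_wpM2l ?(ltW s2)//; apply: lerXn2r => //; rewrite nnegrE ltW//.
Qed.

End ComplexExponential.

(** * Mean values over polar rectangles *)

Section PolarMeanValue.
Context {R : realType}.
Local Notation mR := (measurableTypeR R).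
Local Notation mu := (@lebesgue_measure R).
Implicit Types (z a : R[i]) (G : R[i] -> R[i]) (r t d : R).

Lemma expR_le_1D2x d : 0 <= d <= 1 / 2 -> expR d <= 1 + 2 * d.
Proof.
move=> /andP[d0 d1]; have d2 : 0 < 1 - d by lra.
have h := expR_ge1Dx (- d); rewrite expRN in h.
have : expR d <= (1 - d)^-1 by rewrite -[expR d]invrK lef_pV2// posrE invr_gt0 expR_gt0.
move=> /le_trans; apply; rewrite -div1r ler_pdivrMr//; nra.
Qed.

Lemma continuous_at_within (H : R -> R) (a b : R) :
  (forall x, a <= x <= b -> {for x, continuous H}) -> {within `[a, b], continuous H}.
Proof.
by move=> Hc; apply: continuous_in_subspaceT => x; rewrite inE /= in_itv; exact: Hc.
Qed.

(** Substitution by the exponential, whose Jacobian is at least [a] on [[ln a, ln b]]. *)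
Lemma integral_expR_le (H : R -> R) (a b : R) : 0 < a < b ->
  (forall x, a <= x <= b -> {for x, continuous H}) -> (forall x, 0 <= H x) ->
  (\int[mu]_(x in `[ln a, ln b]) (H (expR x))%:E <=
   a^-1%:E * \int[mu]_(x in `[a, b]) (H x)%:E)%E.
Proof.
move=> /andP[a0 ab] Hc H0; have b0 := lt_trans a0 ab.
have lab : ln a < ln b by rewrite ltr_ln.
have DE : (@expR R)^`()%classic = expR by apply/funext => y; rewrite derive1E; exact: derive_val.
have ea : expR (ln a) = a by rewrite lnK.
have eb : expR (ln b) = b by rewrite lnK.
have EE : (\int[mu]_(x in `[a, b]) (H x)%:E)%E =
    (\int[mu]_(x in `[ln a, ln b]) (((H \o expR) * expR) x)%:E)%E.
  have := @integration_by_substitution_increasing R expR H (ln a) (ln b).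
  rewrite ea eb DE; apply.
  - exact: ltW.
  - by move=> x y _ _; rewrite ltr_expR.
  - by move=> x _; exact: continuous_expR.
  - by apply/cvg_ex; eexists; exact: (cvg_at_right_filter (@continuous_expR R _)).
  - by apply/cvg_ex; eexists; exact: (cvg_at_left_filter (@continuous_expR R _)).
  - split; first by move=> x _; exact: derivable_expR.
    + exact: (cvg_at_right_filter (@continuous_expR R _)).
    + exact: (cvg_at_left_filter (@continuous_expR R _)).
  - exact: continuous_at_within.
have ai : 0 < a^-1 by rewrite invr_gt0.
have inE' x : ln a <= x <= ln b -> a <= expR x <= b.
  by move=> /andP[]; rewrite -(ler_expR (ln a) x) -(ler_expR x) ea eb => -> ->.
have cHe : {within `[ln a, ln b], continuous (H \o expR)}.
  apply: continuous_at_within => x /inE' xab.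
  apply: continuous_comp; [exact: continuous_expR|exact: Hc].
have mHe : measurable_fun (`[ln a, ln b] : set mR) (H \o expR).
  exact: subspace_continuous_measurable_fun.
have mHE := (measurable_EFinP _ _).2 mHe.
rewrite EE -ge0_integralZl//; last 3 first.
- apply/measurable_EFinP; apply: measurable_funM => //.
  by apply: measurable_funTS; apply: continuous_measurable_fun; exact: continuous_expR.
- by move=> x _; rewrite lee_fin; apply: mulr_ge0; [exact: H0|exact: expR_ge0].
- by rewrite lee_fin ltW.
apply: le_integral_ge0.
- by move=> x _; rewrite lee_fin.
- move=> x _; apply: mule_ge0; rewrite lee_fin ?(ltW ai)//.
  by apply: mulr_ge0; [exact: H0|exact: expR_ge0].
move=> x xab _; split => //; rewrite -EFinM lee_fin mulrCA ler_peMr//.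
rewrite mulrC ler_pdivlMr// mul1r.
by move: xab; rewrite /= in_itv /= => /inE' /andP[].
Qed.

Lemma measurable_fun_integral_slice (g : R * R -> \bar R) (A : set R) :
  measurable (A : set mR) -> measurable_fun (setT : set (mR * mR)) (g : mR * mR -> \bar R) ->
  (forall w, 0 <= g w)%E ->
  measurable_fun (setT : set mR) (fun y : mR => \int[mu]_(x in A) g (x, y))%E.
Proof.
move=> mA mg g0; pose h : mR * mR -> \bar R := g \_ (A `*` setT).
have mAT : measurable (A `*` setT : set (mR * mR)) by apply: measurableX.
have mh : measurable_fun (setT : set (mR * mR)) h.
  by apply: (measurable_restrictT _ mAT).1; exact: measurable_funTS.
have h0 w : (0 <= h w)%E by rewrite /h patchE; case: ifP.
have := @measurable_fun_fubini_tonelli_G _ _ _ _ R mu h mh h0.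
rewrite (_ : fubini_G _ _ = fun y : mR => \int[mu]_(x in A) g (x, y))%E//.
apply/funext => y; rewrite /fubini_G [RHS]integral_mkcond; apply: eq_integral => x _.
by rewrite /h !patchE; congr (if _ then _ else _); rewrite in_setX in_setT andbT.
Qed.

(* [dext phi] is [phi] cut off outside of the disc, so that measurability and
   integration need no domain condition. *)
Definition dext (phi : R[i] -> R) z : R := if normc z < 1 then phi z else 0.

Definition measurable_plane (phi : R[i] -> R) :=
  measurable_fun (setT : set (mR * mR)) ((fun w => phi (of_plane w)) : mR * mR -> mR).

Lemma measurable_polar (phi : R[i] -> R) : measurable_plane phi ->
  measurable_fun (setT : set (mR * mR))
    ((fun w => phi (polar w.1 w.2)) : mR * mR -> mR).
Proof.
move=> mphi.
rewrite (_ : (fun _ => _) = (fun w => phi (of_plane w)) \o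
  (fun w : mR * mR => (w.1 * cos w.2, w.1 * sin w.2) : mR * mR))//.
apply: measurableT_comp => //; apply: measurable_fun_pair.
- apply: measurable_funM => //; apply: measurableT_comp => //.
  by apply: continuous_measurable_fun; exact: continuous_cos.
- apply: measurable_funM => //; apply: measurableT_comp => //.
  by apply: continuous_measurable_fun; exact: continuous_sin.
Qed.

Lemma box_open_disc : box_open (of_plane @^-1` (@disc R)).
Proof.
move=> w; rewrite /disc /= => w1; exists ((1 - normc (of_plane w)) / 2).
  by rewrite divr_gt0// subr_gt0.
move=> w' [h1 h2].
have h : normc (of_plane w' - of_plane w) < 1 - normc (of_plane w).
  rewrite (le_lt_trans (normc_le_ReIm _))// complex_ReB complex_ImB.
  by rewrite (splitr (1 - _)) ltrD.
suff : normc (of_plane w') < 1 by [].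
by move: (le_lt_trans (ler_normcB _ _) h); rewrite ltrBlDr subrK.
Qed.

Lemma measurable_disc_set : measurable (of_plane @^-1` (@disc R) : set (mR * mR)).
Proof. by apply: measurable_box_open; exact: box_open_disc. Qed.

Lemma measurable_dext (phi : R[i] -> R) :
  box_continuous (of_plane @^-1` (@disc R)) (fun w => phi (of_plane w)) ->
  measurable_plane (dext phi).
Proof.
move=> phic; have mD := measurable_disc_set.
have mphi := measurable_box_continuous box_open_disc phic.
have := (measurable_restrictT _ mD).1 mphi; congr (measurable_fun _ _).
apply/funext => w; rewrite patchE /dext.
case: ifPn => [/set_mem ->//|/negP H]; case: ifPn => // w1.
by exfalso; apply: H; exact/mem_set.
Qed.

End PolarMeanValue.

Section PolarMeanValue2.
Context {R : realType}.
Local Notation mR := (measurableTypeR R).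
Local Notation mu := (@lebesgue_measure R).
Implicit Types (z a : R[i]) (G : R[i] -> R[i]) (r t d : R).

Definition dnormc G := dext (fun z => normc (G z)).

Lemma dnormc_ge0 G z : 0 <= dnormc G z.
Proof. by rewrite /dnormc /dext; case: ifP => // _; exact: normc_ge0. Qed.

Lemma dnormcE G z : normc z < 1 -> dnormc G z = normc (G z).
Proof. by rewrite /dnormc /dext => ->. Qed.

Lemma measurable_dnormc G : (forall z, normc z < 1 -> holo G z) ->
  measurable_plane (dnormc G).
Proof.
move=> Gh; apply: measurable_dext; apply: box_continuous_normc => w w1.
exact/holo_ccont/Gh.
Qed.

Lemma measurable_plane_sqrt (phi : R[i] -> R) : measurable_plane phi ->
  measurable_plane (fun z => Num.sqrt (phi z)).
Proof.
move=> mphi; apply: measurableT_comp; last exact: mphi.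
by apply: continuous_measurable_fun; exact: sqrt_continuous.
Qed.

Lemma continuous_sqrt_normc_polar G (y x : R) : ccont G (polar x y) ->
  {for x, continuous (fun s => Num.sqrt (normc (G (polar s y))))}.
Proof.
move=> /ccont_normc Gc; apply: continuous_comp; last exact: sqrt_continuous.
apply/cvgrPdist_lt => e /Gc[d d0 Hd]; apply/nbhs_ballP; exists d => // s.
rewrite /ball /= => xs; rewrite distrC; apply: Hd.
have -> : polar s y - polar x y = polar (s - x) y.
  by apply/eqP; rewrite eq_complex /= !mulrBl !eqxx.
by rewrite normc_polar distrC.
Qed.

(** [cexp] sends the square of radius [d] about [ln r +i* t] into the polar rectangle on the right,
    since [expR d <= 1 + 2 d]. [mean_value_sqrt] is applied to [G \o cexp] on the square; the extra
    factor 4 bounds the inverse of the Jacobian, as the radii are at least [1 / 4]. *)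
Lemma polar_mean_value G r t d : (forall z, normc z < 1 -> holo G z) ->
  1 / 2 <= r -> 0 < d <= 1 / 4 -> r + 2 * d < 1 ->
  ((Num.sqrt (dnormc G (polar r t)) * d ^+ 2)%:E <=
   (4 * (32 * 192))%:E * \int[mu]_(y in `[(t - d)%R, (t + d)%R])
     \int[mu]_(x in `[(r - 2 * d)%R, (r + 2 * d)%R])
       (Num.sqrt (dnormc G (polar x y)))%:E)%E.
Proof.
move=> Gh r2 /andP[d0 d4] rd.
have r0 : 0 < r by move: r2; clear; lra.
have r1 : r < 1 by move: rd d0; clear; lra.
have ed : expR d <= 1 + 2 * d by apply: expR_le_1D2x; move: d0 d4; clear; lra.
have eNd : 1 - d <= expR (- d) by have := expR_ge1Dx (- d).
have eNd1 : expR (- d) < 1 by rewrite -expR0 ltr_expR oppr_lt0.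
have ed1 : 1 < expR d by rewrite -expR0 ltr_expR.
pose a := r * expR (- d); pose b := r * expR d.
have a0 : 0 < a by rewrite mulr_gt0// expR_gt0.
have ab : a < b by rewrite ltr_pM2l// (lt_trans eNd1).
have b1 : b <= r + 2 * d.
  rewrite (@le_trans _ _ (r * (1 + 2 * d)))//; first by rewrite ler_wpM2l// ltW.
  rewrite mulrDr mulr1 lerD2l; apply: ler_piMl; last exact: ltW.
  by apply: mulr_ge0 => //; exact: ltW.
have a2 : r - 2 * d <= a.
  rewrite (@le_trans _ _ (r * (1 - d)))//; last by rewrite ler_wpM2l// ltW.
  by move: r1 d0; clear; nra.
have a4 : a^-1 <= 4.
  rewrite -[4]invrK lef_pV2 ?posrE ?invr_gt0// (@le_trans _ _ (r * (1 - d)))//.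
    by move: r2 d4 d0; clear; nra.
  by rewrite ler_wpM2l// ltW.
have lna : ln a = ln r - d by rewrite lnM ?posrE ?expR_gt0// expRK.
have lnb : ln b = ln r + d by rewrite lnM ?posrE ?expR_gt0// expRK.
pose F z := G (cexp z).
pose c : R[i] := ln r +i* t.
have cE : cexp c = polar r t by rewrite /cexp /= lnK.
have Re0 z : Re z <= ln r + d -> normc (cexp z) < 1.
  move=> zr; rewrite normc_cexp; apply: (@le_lt_trans _ _ b); last exact: le_lt_trans rd.
  by rewrite -[leRHS]lnK ?posrE ?(lt_trans a0)// lnb ler_expR.
have Fh : holo_box F c d.
  move=> z [/= zx _]; apply: (@holo_comp _ cexp G); first exact: holo_cexp.
  by apply/Gh/Re0; move: zx; rewrite ltr_norml => /andP[_]; clear; lra.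
have pr1 : normc (polar r t) < 1 by rewrite normc_polar gtr0_norm.
have := mean_value_sqrt d0 Fh; rewrite {1}/F cE dnormcE// => /le_trans; apply.
set S := box _ _.
pose N z := Num.sqrt (dnormc G z).
have N0 z : 0 <= N z by exact: sqrtr_ge0.
have mN : measurable_plane N by apply: measurable_plane_sqrt; exact: measurable_dnormc.
pose g : mR * mR -> \bar R := (fun w => (Num.sqrt (normc (F (of_plane w))))%:E) \_ S.
have g0 w : (0 <= g w)%E by rewrite /g patchE; case: ifP => // _; rewrite lee_fin sqrtr_ge0.
have mg : measurable_fun (setT : set (mR * mR)) g.
  have mF := (measurable_EFinP _ _).2 (measurable_sqrt_box Fh).
  exact: (measurable_restrictT _ (measurable_box (to_plane c) d)).1 mF.
rewrite integral_mkcond -/g (@fubini_tonelli2 _ _ _ _ R mu mu g mg g0).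
pose K y := (\int[mu]_(x in `[(r - 2 * d)%R, (r + 2 * d)%R]) (N (polar x y))%:E)%E.
have K0 y : (0 <= K y)%E by apply: integral_ge0 => x _; rewrite lee_fin.
have mpN := (measurable_EFinP _ _).2 (measurable_polar mN).
have mK : measurable_fun (setT : set mR) (K : mR -> \bar R).
  apply: (@measurable_fun_integral_slice _ (EFin \o (fun w : mR * mR => N (polar w.1 w.2)))) => //.
  by move=> w; rewrite lee_fin.
have yK y : (fubini_G mu g y <= 4%:E * (K \_ `[(t - d)%R, (t + d)%R]) y)%E.
  rewrite /fubini_G; have [yt|yt] := ltP `|y - t| d; last first.
    rewrite integral0_eq.
      by rewrite mule_ge0 ?lee_fin// patchE; case: ifP.
    move=> x _; rewrite /g patchE; case: ifPn => // /set_mem [_ /=].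
    by rewrite ltNge yt.
  have yI : y \in (`[t - d, t + d]%classic : set R).
    by rewrite inE /= in_itv /= -ler_distl ltW.
  rewrite patchE yI.
  apply: (@le_trans _ _ (\int[mu]_(x in `[ln a, ln b]) (Num.sqrt (normc (G (polar (expR x) y))))%:E)%E).
    apply: le_integral_ge0.
    - by move=> x _; exact: g0.
    - by move=> x _; rewrite lee_fin sqrtr_ge0.
    move=> x _; rewrite /g patchE; case: ifPn; last by rewrite eqxx.
    move=> /set_mem [/= xr _] _; split => //.
    by rewrite in_itv /= lna lnb -ler_distl ltW.
  apply: (le_trans (@integral_expR_le _ (fun s => Num.sqrt (normc (G (polar s y)))) a b _ _ _)).
  - by rewrite a0.
  - move=> x /andP[ax xb]; apply: continuous_sqrt_normc_polar; apply/holo_ccont/Gh.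
    rewrite normc_polar gtr0_norm; last exact: lt_le_trans ax.
    exact: le_lt_trans (le_trans xb b1) rd.
  - by move=> x; exact: sqrtr_ge0.
  apply: lee_pmul.
  - by rewrite lee_fin invr_ge0 ltW.
  - by apply: integral_ge0 => x _; rewrite lee_fin sqrtr_ge0.
  - by rewrite lee_fin.
  apply: le_integral_ge0.
  - by move=> x _; rewrite lee_fin sqrtr_ge0.
  - by move=> x _; rewrite lee_fin.
  move=> x; rewrite /= !in_itv /= => /andP[ax xb] _; split.
    by rewrite (le_trans a2 ax) (le_trans xb b1).
  rewrite lee_fin /N dnormcE// normc_polar gtr0_norm; last exact: lt_le_trans ax.
  exact: le_lt_trans (le_trans xb b1) rd.
have mT : measurable (`[(t - d)%R, (t + d)%R] : set mR) by [].
rewrite (@le_trans _ _ ((32 * 192)%:E * \int[mu]_y (4%:E * (K \_ `[(t - d)%R, (t + d)%R]) y))%E)//.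
  apply: lee_wpmul2l; first by rewrite lee_fin mulr_ge0 ?ler0n.
  apply: le_integral_ge0 => //.
  - by move=> y _; apply: integral_ge0 => x _; exact: g0.
  - by move=> y _; rewrite mule_ge0 ?lee_fin// patchE; case: ifP.
rewrite ge0_integralZl//; last 2 first.
- by apply: (measurable_restrictT _ mT).1; exact: measurable_funTS.
- by move=> y _; rewrite patchE; case: ifP.
by rewrite -integral_mkcond muleA -EFinM [(_ * 4)%R]mulrC.
Qed.

End PolarMeanValue2.

(** * Stein's inequality for conditional expectations *)

Section SteinPointwise.
Context {R : realType}.
Implicit Types (a b x : R) (n : nat).

(** Convexity at the end [b], drawn from Young's inequality with exponents [v] and [v / (v - 1)],
    which also covers [a = 0]. *)
Lemma powR_tangent a b (v : R) : 1 <= v -> 0 <= a <= b ->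
  b `^ v - a `^ v <= v * ((b - a) * b `^ (v - 1)).
Proof.
move=> v1 /andP[a0 ab]; have b0 := le_trans a0 ab.
have v0 : 0 < v by exact: lt_le_trans v1.
have [->|vn1] := eqVneq v 1.
  by rewrite subrr powRr0 mulr1 mul1r !powRr1.
have v1' : 0 < v - 1 by rewrite subr_gt0 lt_neqAle eq_sym vn1.
have H : a * b `^ (v - 1) <= a `^ v / v + (b `^ (v - 1)) `^ (v / (v - 1)) / (v / (v - 1)).
  apply: conjugate_powR => //; first exact: powR_ge0.
    exact: divr_gt0.
  by field; rewrite !gt_eqF.
rewrite -powRrM mulrCA divff ?gt_eqF// mulr1 in H.
have bE : b * b `^ (v - 1) = b `^ v by rewrite mulr_powRB1.
have {}H := ler_wpM2l (ltW v0) H.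
have E : v * (a `^ v / v + b `^ v / (v / (v - 1))) = a `^ v + (v - 1) * b `^ v.
  by field; rewrite !gt_eqF.
rewrite E in H; rewrite mulrBl bE; move: H; clear; lra.
Qed.

Lemma powR_chord a b (e : R) : 0 < e <= 1 -> 0 <= a <= b ->
  e * ((b - a) * b `^ (e - 1)) <= b `^ e - a `^ e.
Proof.
move=> /andP[e0 e1] /andP[a0 ab]; have b0 := le_trans a0 ab.
have [->|en1] := eqVneq e 1.
  by rewrite subrr powRr0 mulr1 mul1r !powRr1.
have e1' : 0 < 1 - e by rewrite subr_gt0 lt_neqAle en1.
have [bz|bn0] := eqVneq b 0.
  have az : a = 0 by apply/le_anti; rewrite a0 -bz ab.
  by rewrite az bz !subrr mul0r mulr0.
have bp : 0 < b by rewrite lt_neqAle eq_sym bn0.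
have bE : b * b `^ (e - 1) = b `^ e by rewrite mulr_powRB1.
pose A := (a * b `^ (e - 1)) `^ e; pose B := (b `^ e) `^ (1 - e).
have H : A * B <= A `^ e^-1 / e^-1 + B `^ (1 - e)^-1 / (1 - e)^-1.
  apply: conjugate_powR; rewrite ?powR_ge0 ?invr_gt0// !invrK; ring.
have A1 : A `^ e^-1 = a * b `^ (e - 1).
  by rewrite /A -powRrM divff ?gt_eqF// powRr1// mulr_ge0// powR_ge0.
have B1 : B `^ (1 - e)^-1 = b `^ e.
  by rewrite /B -powRrM divff ?gt_eqF// powRr1// powR_ge0.
have AB : A * B = a `^ e.
  rewrite /A /B powRM ?powR_ge0// -!powRrM -mulrA -powRD; last by rewrite bn0 implybT.
  by rewrite (_ : _ + _ = 0) ?powRr0 ?mulr1//; ring.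
rewrite A1 B1 AB !invrK in H; rewrite mulrBl bE; move: H; clear; lra.
Qed.

Variables (x : nat -> R).
Hypothesis x0 : forall k, 0 <= x k.
Let H n := \sum_(k < n) x k.

Lemma partial_sum_ge0 n : 0 <= H n. Proof. exact: sumr_ge0. Qed.

Lemma partial_sumS n : H n.+1 = H n + x n. Proof. by rewrite /H big_ord_recr. Qed.

Lemma partial_sumB n : H n.+1 - H n = x n.
Proof. by rewrite partial_sumS addrAC subrr add0r. Qed.

Lemma partial_sum_le m n : (m <= n)%N -> H m <= H n.
Proof.
elim: n => [|n IH]; first by rewrite leqn0 => /eqP ->.
rewrite leq_eqVlt => /predU1P[->//|]; rewrite ltnS => /IH /le_trans; apply.
by rewrite partial_sumS lerDl.
Qed.

(** Discrete form of [H^v = v * \int H^(v-1) dH]: for [v >= 1] the tangent inequality telescopes;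
    for [v < 1] the factor [H^(v-1)] only decreases along the sum, and the constant 1 will do. *)
Lemma powR_partial_sum_le (v : R) n : 0 < v ->
  H n `^ v <= Num.max 1 v * \sum_(k < n) x k * H k.+1 `^ (v - 1).
Proof.
move=> v0; have [v1|v1] := leP 1 v.
  elim: n => [|n IH].
    by rewrite /H !big_ord0 mulr0 powR0// gt_eqF.
  rewrite big_ord_recr mulrDr -lerBlDl; apply: le_trans (lerB (lexx _) IH) _.
  have := @powR_tangent (H n) (H n.+1) v v1.
  rewrite partial_sum_ge0 partial_sum_le// => /(_ isT).
  by rewrite partial_sumB.
rewrite mul1r; have [Hn0|Hn0] := eqVneq (H n) 0.
  rewrite Hn0 powR0 ?gt_eqF//; apply: sumr_ge0 => k _.
  by rewrite mulr_ge0 ?powR_ge0.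
have Hn : 0 < H n by rewrite lt_neqAle eq_sym Hn0 partial_sum_ge0.
have -> : H n `^ v = \sum_(k < n) x k * H n `^ (v - 1).
  by rewrite -mulr_suml -/(H n) mulr_powRB1// ltW.
apply: ler_sum => k _; have [->|xk] := eqVneq (x k) 0; first by rewrite !mul0r.
apply: ler_wpM2l => //.
have Hk : 0 < H k.+1.
  by rewrite partial_sumS ltr_wpDl ?partial_sum_ge0// lt_neqAle eq_sym xk x0.
rewrite -(opprB 1 v) !powRN lef_pV2 ?posrE ?powR_gt0//.
by apply: ge0_ler_powR; rewrite ?nnegrE ?partial_sum_ge0 ?subr_ge0 ?(ltW v1) ?partial_sum_le.
Qed.

(** The opposite half of the same discrete integration, with concavity and monotonicity exchanging
    roles. *)
Lemma sum_powR_partial_sum_le (e : R) n : 0 < e ->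
  \sum_(k < n) x k * H k.+1 `^ (e - 1) <= Num.max 1 e^-1 * H n `^ e.
Proof.
move=> e0; have [e1|e1] := leP e 1.
  have ei1 : 1 <= e^-1 by rewrite -[1]invr1 lef_pV2 ?posrE.
  rewrite max_r// ler_pdivlMl//.
  elim: n => [|n IH].
    by rewrite /H !big_ord0 mulr0 powR0// gt_eqF.
  rewrite big_ord_recr mulrDr -lerBrDl; apply: le_trans (lerB (lexx _) IH).
  have := @powR_chord (H n) (H n.+1) e.
  rewrite e0 e1 partial_sum_ge0 partial_sum_le// => /(_ isT isT).
  by rewrite partial_sumB.
have ei1 : e^-1 <= 1 by rewrite -[1]invr1 lef_pV2 ?posrE// ltW.
rewrite max_l// mul1r -mulr_powRB1 ?partial_sum_ge0// /H mulr_suml.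
apply: ler_sum => k _; apply: ler_wpM2l => //.
apply: ge0_ler_powR; rewrite ?nnegrE ?partial_sum_ge0 ?subr_ge0 ?(ltW e1)//.
exact: (@partial_sum_le k.+1 n).
Qed.

End SteinPointwise.

Section FiniteHoelder.
Context {R : realType}.

Lemma hoelder_sum n (f g : nat -> R) (p q : R) : 0 < p -> 0 < q -> p^-1 + q^-1 = 1 ->
  (forall k, 0 <= f k) -> (forall k, 0 <= g k) ->
  \sum_(k < n) f k * g k <=
  (\sum_(k < n) f k `^ p) `^ p^-1 * (\sum_(k < n) g k `^ q) `^ q^-1.
Proof.
move=> p0 q0 pq f0 g0.
set F := \sum_(k < n) f k `^ p; set G := \sum_(k < n) g k `^ q.
have F0 : 0 <= F by apply: sumr_ge0 => k _; exact: powR_ge0.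
have G0 : 0 <= G by apply: sumr_ge0 => k _; exact: powR_ge0.
have zero (s : nat -> R) (r : R) : 0 < r -> (forall k, 0 <= s k) ->
    \sum_(k < n) s k `^ r = 0 -> forall k : 'I_n, s k = 0.
  move=> r0 s0 /eqP; rewrite psumr_eq0; last by move=> k _; exact: powR_ge0.
  by move=> /allP H k; have := H k (mem_index_enum _); rewrite implyTb => /eqP /powR_eq0_eq0.
have [Fz|Fn0] := eqVneq F 0.
  rewrite big1 ?mulr_ge0 ?powR_ge0// => k _.
  by rewrite (zero f p p0 f0 Fz k) mul0r.
have [Gz|Gn0] := eqVneq G 0.
  rewrite big1 ?mulr_ge0 ?powR_ge0// => k _.
  by rewrite (zero g q q0 g0 Gz k) mulr0.
have Fp : 0 < F by rewrite lt_neqAle eq_sym Fn0.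
have Gp : 0 < G by rewrite lt_neqAle eq_sym Gn0.
set u := F `^ p^-1; set w := G `^ q^-1.
have u0 : 0 < u by exact: powR_gt0.
have w0 : 0 < w by exact: powR_gt0.
have up : u `^ p = F by rewrite /u -powRrM mulVf ?gt_eqF// powRr1.
have wq : w `^ q = G by rewrite /w -powRrM mulVf ?gt_eqF// powRr1.
move: u w u0 w0 up wq => u w u0 w0 up wq.
rewrite -[leRHS]mulr1 -(ler_pdivrMl _ _ (mulr_gt0 u0 w0)) mulr_sumr.
apply: (@le_trans _ _ (\sum_(k < n) (f k `^ p / F / p + g k `^ q / G / q))); last first.
  rewrite big_split /= -!mulr_suml -/F -/G !divff// !div1r pq//.
apply: ler_sum => k _.
rewrite (_ : (u * w)^-1 * _ = (f k / u) * (g k / w)); last by field; rewrite !gt_eqF.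
apply: (le_trans (conjugate_powR _ _ p0 q0 pq)); rewrite ?divr_ge0 ?(ltW u0) ?(ltW w0)//.
rewrite !powRM ?invr_ge0 ?(ltW u0) ?(ltW w0)//.
have ui : u^-1 `^ p = F^-1.
  by rewrite -(powR_inv1 (ltW u0)) -powRrM mulN1r powRN up.
have wi : w^-1 `^ q = G^-1.
  by rewrite -(powR_inv1 (ltW w0)) -powRrM mulN1r powRN wq.
by rewrite ui wi.
Qed.

(* The weights [h_k^(p-1) H_k^(q/p-1)] depend on [h_0, ..., h_k] only; this is
   what lets conditional expectations be moved around in Stein's inequality. *)
Definition stein_weight (h : nat -> R) (p q : R) (k : nat) : R :=
  h k `^ (p - 1) * (\sum_(j < k.+1) h j `^ p) `^ (q / p - 1).

(** The first bound makes the mixed power linear in [h] once the weights are frozen. The second is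
    Hoelder's inequality in [k], then Young's inequality with exponents [q] and [q']; the part
    returned to [h] receives the coefficient [2^-1], so that it can be absorbed after
    integration. *)
Lemma stein_pointwise (p q : R) : 1 < p -> 1 < q ->
  exists c C : R, [/\ 0 < c, 0 < C & forall n (h b : nat -> R),
  (forall k, 0 <= h k) -> (forall k, 0 <= b k) ->
  (\sum_(k < n) h k `^ p) `^ (q / p) <=
    c * \sum_(k < n) stein_weight h p q k * h k /\
  c * \sum_(k < n) stein_weight h p q k * b k <=
    C * (\sum_(k < n) b k `^ p) `^ (q / p) +
    2^-1 * (\sum_(k < n) h k `^ p) `^ (q / p)].
Proof.
move=> p1 q1; have p0 : 0 < p by exact: lt_trans p1.
have q0 : 0 < q by exact: lt_trans q1.
have p1' : 0 < p - 1 by rewrite subr_gt0.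
have q1' : 0 < q - 1 by rewrite subr_gt0.
pose v := q / p; have v0 : 0 < v by exact: divr_gt0.
pose p' := p / (p - 1); have p'0 : 0 < p' by exact: divr_gt0.
pose q' := q / (q - 1); have q'0 : 0 < q' by exact: divr_gt0.
have pp' : p'^-1 + p^-1 = 1 by rewrite /p'; field; rewrite !gt_eqF.
have qq' : q^-1 + q'^-1 = 1 by rewrite /q'; field; rewrite !gt_eqF.
(* The weight raised to [p'] equals [h_k^p H_k^(e-1)], because [(q / p - 1) p' = (q - p) / (p - 1) =
   e - 1]. *)
pose e := (q - 1) / (p - 1); have e0 : 0 < e by exact: divr_gt0.
have [c [c0 Hc]] : exists c : R, 0 < c /\ forall (x : nat -> R) n, (forall k, 0 <= x k) ->
    (\sum_(j < n) x j) `^ v <= c * \sum_(k < n) x k * (\sum_(j < k.+1) x j) `^ (v - 1).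
  exists (Num.max 1 v); split; first by rewrite lt_max ltr01.
  by move=> x n x0; exact: powR_partial_sum_le.
have [d [d0 Hd]] : exists d : R, 0 < d /\ forall (x : nat -> R) n, (forall k, 0 <= x k) ->
    \sum_(k < n) x k * (\sum_(j < k.+1) x j) `^ (e - 1) <= d * (\sum_(j < n) x j) `^ e.
  exists (Num.max 1 e^-1); split; first by rewrite lt_max ltr01.
  by move=> x n x0; exact: sum_powR_partial_sum_le.
have [K [K0 KE]] : exists K : R, 0 < K /\ K = c * d `^ p'^-1.
  by exists (c * d `^ p'^-1); rewrite mulr_gt0// powR_gt0.
(* Scaling parameter for Young's inequality: after multiplication by [K] the second term has
   coefficient [K / (2 K) = 2^-1]. *)
have [m [m0 mE]] : exists m : R, 0 < m /\ m^-1 `^ q' = (2 * K)^-1.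
  have K20 : 0 < 2 * K by rewrite mulr_gt0.
  have n0 : 0 < (2 * K) `^ q'^-1 by rewrite powR_gt0.
  exists ((2 * K) `^ q'^-1); split => //.
  rewrite -(powR_inv1 (ltW n0)) -powRrM mulN1r powRN -powRrM mulVf ?gt_eqF//.
  by rewrite powRr1// ltW.
exists c, (K * m `^ q); split => //; first by rewrite mulr_gt0// powR_gt0.
move=> n h b h0 b0.
pose x k := h k `^ p; have x0 k : 0 <= x k by exact: powR_ge0.
pose H k := \sum_(j < k) x j.
have H0 k : 0 <= H k by exact: sumr_ge0.
rewrite -/(H n) -/v.
split.
  rewrite (eq_bigr (fun k : 'I_n => x k * H k.+1 `^ (v - 1))).
    exact: Hc.
  move=> k _; rewrite /stein_weight -/(H k.+1) -/v mulrAC; congr (_ * _).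
  by rewrite mulrC mulr_powRB1.
set Phi := \sum_(k < n) b k `^ p.
have Phi0 : 0 <= Phi by apply: sumr_ge0 => k _; exact: powR_ge0.
have w0 k : 0 <= stein_weight h p q k by rewrite mulr_ge0// powR_ge0.
have := @hoelder_sum n (stein_weight h p q) b p' p p'0 p0 pp' w0 b0.
rewrite -/Phi [X in _ <= X `^ _ * _](eq_bigr (fun k : 'I_n => x k * H k.+1 `^ (e - 1))); last first.
  move=> k _; rewrite /stein_weight -/(H k.+1) powRM ?powR_ge0// -!powRrM.
  congr (_ `^ _ * _ `^ _); rewrite /p' /e; field;
    by rewrite ?(gt_eqF p0) ?(gt_eqF p1').
move=> Hs.
have He : (\sum_(k < n) x k * H k.+1 `^ (e - 1)) `^ p'^-1 <= d `^ p'^-1 * H n `^ ((q - 1) / p).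
  have {}Hd := Hd x n x0; rewrite -/(H n) in Hd.
  apply: (@le_trans _ _ ((d * H n `^ e) `^ p'^-1)).
    apply: ge0_ler_powR; rewrite ?nnegrE ?invr_ge0 ?(ltW p'0) ?mulr_ge0 ?powR_ge0 ?(ltW d0)//.
    by apply: sumr_ge0 => k _; rewrite mulr_ge0 ?powR_ge0.
  rewrite (powRM _ (ltW d0) (powR_ge0 _ _)) -(powRrM (H n)).
  have -> : e * p'^-1 = (q - 1) / p.
    by rewrite /e /p'; field; rewrite (gt_eqF p0) (gt_eqF p1').
  exact: lexx.
have {Hs He} Hs : c * \sum_(k < n) stein_weight h p q k * b k <=
    K * (Phi `^ p^-1 * H n `^ ((q - 1) / p)).
  rewrite KE -mulrA ler_wpM2l ?(ltW c0)//; apply: (le_trans Hs).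
  rewrite [Phi `^ _ * _]mulrC mulrA.
  by rewrite ler_wpM2r ?powR_ge0.
apply: (le_trans Hs).
have [A [A0 AE EA]] : exists A, [/\ 0 <= A, A = m * Phi `^ p^-1 & A `^ q = m `^ q * Phi `^ v].
  exists (m * Phi `^ p^-1); split; [exact: mulr_ge0 (ltW m0) (powR_ge0 _ _)|exact: erefl|].
  by rewrite (powRM _ (ltW m0) (powR_ge0 _ _)) -(powRrM Phi) [p^-1 * _]mulrC.
have [B [B0 BE EB]] : exists B, [/\ 0 <= B, B = m^-1 * H n `^ ((q - 1) / p) &
    B `^ q' = (2 * K)^-1 * H n `^ v].
  have mi : 0 <= m^-1 by rewrite invr_ge0 ltW.
  exists (m^-1 * H n `^ ((q - 1) / p)); split; [exact: mulr_ge0 mi (powR_ge0 _ _)|exact: erefl|].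
  rewrite (powRM _ mi (powR_ge0 _ _)) mE -(powRrM (H n)).
  have -> : (q - 1) / p * q' = v.
    by rewrite /q' /v; field; rewrite (gt_eqF p0) (gt_eqF q1').
  exact: erefl.
have Y := conjugate_powR A0 B0 q0 q'0 qq'.
rewrite EA EB in Y.
have AB : A * B = Phi `^ p^-1 * H n `^ ((q - 1) / p).
  rewrite AE BE mulrACA (divff (lt0r_neq0 m0)) mul1r; exact: erefl.
rewrite AB in Y.
have qi : q^-1 <= 1 by rewrite -[1]invr1 lef_pV2 ?posrE ?(ltW q1).
have qi' : q'^-1 <= 1 by rewrite -qq' lerDr invr_ge0 (ltW q0).
have Phiv : 0 <= m `^ q * Phi `^ v by exact: mulr_ge0 (powR_ge0 _ _) (powR_ge0 _ _).
have Hv : 0 <= (2 * K)^-1 * H n `^ v.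
  by apply: mulr_ge0; [rewrite invr_ge0 mulr_ge0 ?(ltW K0)|exact: powR_ge0].
have KK : K * (2 * K)^-1 = 2^-1 by field; rewrite (gt_eqF K0).
clear -Y qi qi' Phiv Hv KK K0.
move: Y; set X := Phi `^ p^-1 * _; set U := m `^ q * _ in Phiv *.
move: (H n `^ v) Hv => W; set V := (2 * K)^-1 * W => Hv Y.
have {}Y : X <= U + V.
  by apply: (le_trans Y); apply: lerD; apply: ler_piMr.
rewrite -mulrA -/U (_ : 2^-1 * W = K * V); last by rewrite /V mulrA KK.
by rewrite -mulrDr ler_wpM2l// ltW.
Qed.

End FiniteHoelder.

(** * Conditional expectations along a refining sequence of countable partitions *)

Section SteinInequality.
Context d (T : measurableType d) (R : realType) (mu : {measure set T -> \bar R}).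
Variable D : set T.
Hypotheses (mD : measurable D) (fD : (mu D < +oo)%E).
Implicit Types (io : T -> nat) (b X : T -> R).

Definition cell io i := D `&` [set t | io t = i].

(* The conditional expectation of [b] with respect to the partition of [D]
   into the level sets of [io]; it is 0 on null cells since x / 0 = 0. *)
Definition cavg io b t : R :=
  fine (\int[mu]_(x in cell io (io t)) (b x)%:E)%E / fine (mu (cell io (io t))).

Definition cell_constant io X := forall t t', D t -> D t' -> io t = io t' -> X t = X t'.

Lemma cell_bigcup io : D = \bigcup_i cell io i.
Proof.
apply/seteqP; split => [t Dt|t [i _ []]//].
by exists (io t).
Qed.

Lemma trivIset_cell io : trivIset setT (cell io).
Proof. by move=> i j _ _ [t [[_ <-] [_ <-]]]. Qed.

Lemma cavg_constant io b : cell_constant io (cavg io b).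
Proof. by move=> t t' _ _; rewrite /cavg => ->. Qed.

Section OnePartition.
Variable io : T -> nat.
Hypothesis mcell : forall i, measurable (cell io i).

Lemma measurable_cell_constant X : cell_constant io X -> measurable_fun D X.
Proof.
move=> Xc _ Y mY.
have -> : D `&` X @^-1` Y = \bigcup_i
    (if `[< exists2 t, cell io i t & Y (X t) >] then cell io i else set0).
  apply/seteqP; split => [t [Dt Yt]|t [i _]].
    exists (io t) => //; case: asboolP => // H; exfalso; apply: H.
    by exists t.
  case: asboolP => // -[t' [Dt' it'] Yt'] [Dt it]; split => //=.
  by rewrite (Xc t t')// it it'.
apply: bigcupT_measurable => i; case: asboolP => // _; exact: mcell.
Qed.

Lemma fin_cell i : (mu (cell io i) < +oo)%E.
Proof.
by apply: le_lt_trans fD; apply: le_measure; rewrite ?inE//; apply: subIsetl.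
Qed.

Lemma integral_cell_fin b B i : (forall t, D t -> 0 <= b t <= B) ->
  (0 <= \int[mu]_(x in cell io i) (b x)%:E <= B%:E * mu (cell io i))%E.
Proof.
move=> bB; apply/andP; split.
  by apply: integral_ge0 => t [/bB/andP[? _] _]; rewrite lee_fin.
have [->|/set0P[t0 [/bB/andP[b0 bB0] _]]] := eqVneq (cell io i) set0.
  by rewrite integral_set0 measure0 mule0.
have B0 : 0 <= B by exact: le_trans bB0.
rewrite -integral_cst//; apply: le_integral_ge0.
- by move=> t [/bB/andP[? _] _]; rewrite lee_fin.
- by move=> t _; rewrite lee_fin.
- by move=> t ct _; split => //; case: ct => /bB/andP[_ ?] _; rewrite lee_fin.
Qed.

Lemma cavg_bounds b B t : 0 <= B -> (forall t, D t -> 0 <= b t <= B) ->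
  0 <= cavg io b t <= B.
Proof.
move=> B0 bB; have /andP[I0 IB] := @integral_cell_fin b B (io t) bB.
have m0 := measure_ge0 mu (cell io (io t)); have mf := fin_cell (io t).
have mfin : mu (cell io (io t)) \is a fin_num by rewrite ge0_fin_numE.
have Ifin : (\int[mu]_(x in cell io (io t)) (b x)%:E)%E \is a fin_num.
  rewrite ge0_fin_numE//; apply: le_lt_trans IB _.
  by rewrite -(fineK mfin) -EFinM ltry.
rewrite /cavg; apply/andP; split; first by rewrite divr_ge0// fine_ge0.
have [->|mz] := eqVneq (fine (mu (cell io (io t)))) 0; first by rewrite invr0 mulr0.
have mp : 0 < fine (mu (cell io (io t))) by rewrite lt_neqAle eq_sym mz fine_ge0.
by rewrite ler_pdivrMr// -lee_fin fineK// EFinM fineK.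
Qed.

(** On one cell [X] is a constant and the average times the measure is the integral of [b]. On a
    null cell both sides vanish because [b] is bounded, whatever value the quotient takes. *)
Lemma integral_cavg X b B : 0 <= B -> cell_constant io X -> (forall t, D t -> 0 <= X t) ->
  measurable_fun D b -> (forall t, D t -> 0 <= b t <= B) ->
  (\int[mu]_(t in D) (X t * cavg io b t)%:E = \int[mu]_(t in D) (X t * b t)%:E)%E.
Proof.
move=> B0 Xc X0 mb bB.
have mX := measurable_cell_constant Xc.
have mh := measurable_cell_constant (@cavg_constant io b).
have h0 t : 0 <= cavg io b t by have /andP[] := @cavg_bounds b B t B0 bB.
have m1 : measurable_fun D (fun t => (X t * cavg io b t)%:E).
  by apply/measurable_EFinP; exact: measurable_funM.
have m2 : measurable_fun D (fun t => (X t * b t)%:E).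
  by apply/measurable_EFinP; exact: measurable_funM.
have IE (f : T -> \bar R) : measurable_fun D f -> (forall t, D t -> (0 <= f t)%E) ->
    (\int[mu]_(t in D) f t = \sum_(i <oo) \int[mu]_(t in cell io i) f t)%E.
  move=> mf f0; have DE := cell_bigcup io.
  rewrite [X in (\int[mu]_(t in X) _ = _)%E]DE; apply: ge0_integral_bigcup => //.
  - by rewrite -DE.
  - by rewrite -DE.
  - exact: trivIset_cell.
rewrite !IE//.
- apply: eq_eseriesr => i _.
  have [->|/set0P[t0 ct0]] := eqVneq (cell io i) set0; first by rewrite !integral_set0.
  have Xi t : cell io i t -> X t = X t0.
    by move=> [Dt it]; case: ct0 => Dt0 it0; apply: Xc => //; rewrite it it0.
  have hi t : cell io i t -> cavg io b t = cavg io b t0.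
    by move=> [Dt it]; case: ct0 => Dt0 it0; apply: cavg_constant => //; rewrite it it0.
  have X00 : 0 <= X t0 by case: ct0 => /X0.
  rewrite (eq_integral (fun=> (X t0 * cavg io b t0)%:E)); last first.
    by move=> t /set_mem ct; rewrite Xi// hi.
  rewrite [RHS](eq_integral (fun t => (X t0)%:E * (b t)%:E)%E); last first.
    by move=> t /set_mem ct; rewrite Xi// EFinM.
  have mbc : measurable_fun (cell io i) (fun t => (b t)%:E).
    by apply/measurable_EFinP; apply: measurable_funS mb => //; exact: subIsetl.
  rewrite ge0_integralZl//; last by move=> t [/bB/andP[? _] _]; rewrite lee_fin.
  rewrite integral_cst//= EFinM -muleA; congr (_ * _)%E.
  have it0 : io t0 = i by case: ct0.
  rewrite /cavg it0.
  have /andP[I0 IB] := @integral_cell_fin b B i bB.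
  have mfin : mu (cell io i) \is a fin_num by rewrite ge0_fin_numE ?measure_ge0 ?fin_cell.
  have Ifin : (\int[mu]_(x in cell io i) (b x)%:E)%E \is a fin_num.
    rewrite ge0_fin_numE//; apply: le_lt_trans IB _.
    by rewrite -(fineK mfin) -EFinM ltry.
  rewrite -[X in (_ * X = _)%E](fineK mfin) -EFinM.
  have [mz|mz] := eqVneq (fine (mu (cell io i))) 0.
    rewrite mz mulr0; apply/esym/eqP; rewrite eq_le I0 andbT (le_trans IB)//.
    by rewrite -(fineK mfin) mz mule0.
  by rewrite divfK// fineK.
- by move=> t Dt; rewrite lee_fin mulr_ge0 ?X0//; have /andP[] := bB _ Dt.
- by move=> t Dt; rewrite lee_fin mulr_ge0 ?X0.
Qed.

End OnePartition.

(** Since the partitions refine, the weight [W k], built from the averages of index at most [k], is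
    constant on the cells of [io k]; in the linearised sum each average may thus be replaced by
    [b k] itself, after which the second half of [stein_pointwise] applies. *)
Theorem stein_inequality (p q : R) : 1 < p -> 1 < q ->
  exists2 C : R, 0 < C & forall (io : nat -> T -> nat) (b : nat -> T -> R) (B : nat -> R) n,
    (forall k i, measurable (cell (io k) i)) ->
    (forall k l t t', (k <= l)%N -> D t -> D t' -> io l t = io l t' -> io k t = io k t') ->
    (forall k, 0 <= B k) -> (forall k, measurable_fun D (b k)) ->
    (forall k t, 0 <= b k t) -> (forall k t, D t -> b k t <= B k) ->
    (\int[mu]_(t in D) ((\sum_(k < n) cavg (io k) (b k) t `^ p) `^ (q / p))%:E <=
     C%:E * \int[mu]_(t in D) ((\sum_(k < n) b k t `^ p) `^ (q / p))%:E)%E.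
Proof.
move=> p1 q1; have [c [C [c0 C0 HC]]] := @stein_pointwise R p q p1 q1.
exists (2 * C); first by rewrite mulr_gt0.
move=> io b B n mc ref B0 mb b0 bB.
pose h k t := cavg (io k) (b k) t.
have bb k t : D t -> 0 <= b k t <= B k by move=> Dt; rewrite b0 bB.
have hB k t : 0 <= h k t <= B k by apply: cavg_bounds => //; exact: bb.
have h0 k t : 0 <= h k t by case/andP: (hB k t).
pose W k t := stein_weight (fun j => h j t) p q k.
have W0 k t : 0 <= W k t by rewrite mulr_ge0// powR_ge0.
have Wc k : cell_constant (io k) (W k).
  move=> t t' Dt Dt' tt'.
  have hE j : (j <= k)%N -> h j t = h j t' by move=> jk; apply: cavg_constant => //; apply: ref tt'.
  rewrite /W /stein_weight (hE k (leqnn k)).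
  rewrite (eq_bigr (fun j : 'I_k.+1 => h j t' `^ p))//.
  by move=> j _; rewrite (hE j)// -ltnS.
have mh k : measurable_fun D (h k).
  exact: measurable_cell_constant (mc k) _ (@cavg_constant (io k) (b k)).
have mW k : measurable_fun D (W k) by exact: measurable_cell_constant (mc k) _ (Wc k).
have mpow (f : T -> R) (r : R) : measurable_fun D f -> measurable_fun D (fun t => f t `^ r).
  by move=> mf; exact: (measurableT_comp (measurable_powR r) mf).
have msum (f : nat -> T -> R) m : (forall k, measurable_fun D (f k)) ->
    measurable_fun D (fun t => \sum_(k < m) f k t).
  by move=> mf; apply: (@measurable_sum _ _ _ D _ (index_enum (ordinal m)) (fun k t => f k t)).
pose Hv t := (\sum_(k < n) h k t `^ p) `^ (q / p).
pose Pv t := (\sum_(k < n) b k t `^ p) `^ (q / p).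
have mH : measurable_fun D Hv by apply: (mpow _ (q / p)); apply: (msum (fun k t => h k t `^ p)) => k; exact: mpow.
have mP : measurable_fun D Pv by apply: (mpow _ (q / p)); apply: (msum (fun k t => b k t `^ p)) => k; exact: mpow.
have H0 t : 0 <= Hv t by exact: powR_ge0.
have P0 t : 0 <= Pv t by exact: powR_ge0.
pose M := (\sum_(k < n) B k `^ p) `^ (q / p).
have M0 : 0 <= M by exact: powR_ge0.
have HM t : Hv t <= M.
  apply: ge0_ler_powR.
  - by rewrite divr_ge0// ltW// (lt_trans ltr01).
  - by rewrite nnegrE sumr_ge0// => k _; exact: powR_ge0.
  - by rewrite nnegrE sumr_ge0// => k _; exact: powR_ge0.
  apply: ler_sum => k _; apply: ge0_ler_powR; rewrite ?nnegrE//.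
    by rewrite ltW// (lt_trans ltr01).
  by case/andP: (hB k t).
have HC1 t : Hv t <= c * \sum_(k < n) W k t * h k t.
  by have [H _] := HC n (fun k => h k t) (fun k => b k t) (fun k => h0 k t) (fun k => b0 k t); exact: H.
have HC2 t : c * \sum_(k < n) W k t * b k t <= C * Pv t + 2^-1 * Hv t.
  by have [_ H] := HC n (fun k => h k t) (fun k => b k t) (fun k => h0 k t) (fun k => b0 k t); exact: H.
suff main : (\int[mu]_(t in D) (Hv t)%:E <= (2 * C)%:E * \int[mu]_(t in D) (Pv t)%:E)%E by exact: main.
have S0 t : 0 <= c * \sum_(k < n) W k t * b k t.
  by rewrite mulr_ge0 ?(ltW c0)// sumr_ge0// => k _; rewrite mulr_ge0.
move: Hv Pv mH mP H0 P0 HM HC1 HC2 => Hv Pv mH mP H0 P0 HM HC1 HC2.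
move: M M0 HM => M M0 HM.
have [IH IHE] : exists IH, IH = (\int[mu]_(t in D) (Hv t)%:E)%E by eexists.
have [IP IPE] : exists IP, IP = (\int[mu]_(t in D) (Pv t)%:E)%E by eexists.
rewrite -IHE -IPE.
have IH0 : (0 <= IH)%E by rewrite IHE; apply: integral_ge0 => t _; rewrite lee_fin.
have IP0 : (0 <= IP)%E by rewrite IPE; apply: integral_ge0 => t _; rewrite lee_fin.
have swap : (\int[mu]_(t in D) (c * \sum_(k < n) W k t * h k t)%:E =
    \int[mu]_(t in D) (c * \sum_(k < n) W k t * b k t)%:E)%E.
  have E (f : nat -> T -> R) : (forall k, measurable_fun D (f k)) -> (forall k t, 0 <= f k t) ->
      (\int[mu]_(t in D) (c * \sum_(k < n) W k t * f k t)%:E =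
       c%:E * \sum_(k < n) \int[mu]_(t in D) (W k t * f k t)%:E)%E.
    move=> mf f0.
    have mWf k : measurable_fun D (fun t => (W k t * f k t)%:E).
      by apply/measurable_EFinP; exact: measurable_funM.
    rewrite -ge0_integral_sum//; last by move=> k t _; rewrite lee_fin mulr_ge0.
    rewrite -ge0_integralZl//; last 3 first.
    - exact: emeasurable_sum.
    - by move=> t _; apply: sume_ge0 => k _; rewrite lee_fin mulr_ge0.
    - by rewrite lee_fin ltW.
    by apply: eq_integral => t _; rewrite sumEFin -EFinM.
  rewrite !E//; congr (_ * _)%E; apply: eq_bigr => k _.
  by apply: (@integral_cavg _ (mc k) _ _ (B k)) => //; exact: bb.
have H1 : (IH <= \int[mu]_(t in D) (c * \sum_(k < n) W k t * b k t)%:E)%E.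
  rewrite -swap IHE; apply: le_integral_ge0.
  - by move=> t _; rewrite lee_fin.
  - by move=> t _; rewrite lee_fin (le_trans (H0 t)).
  - by move=> t Dt _; split => //; rewrite lee_fin.
have mHE := (measurable_EFinP D Hv).2 mH; have mPE := (measurable_EFinP D Pv).2 mP.
have H2 : (IH <= C%:E * IP + 2^-1%:E * IH)%E.
  apply: (le_trans H1); rewrite IHE IPE.
  rewrite -(@ge0_integralZl _ _ _ mu D mD _ mPE); last 2 first.
  - by move=> t _; rewrite /= lee_fin.
  - by rewrite lee_fin ltW.
  rewrite -(@ge0_integralZl _ _ _ mu D mD _ mHE); last 2 first.
  - by move=> t _; rewrite /= lee_fin.
  - by rewrite lee_fin invr_ge0.
  rewrite -ge0_integralD//; last 4 first.
  - by move=> t _; rewrite -EFinM lee_fin mulr_ge0 ?(ltW C0).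
  - exact: measurable_funeM.
  - by move=> t _; rewrite -EFinM lee_fin mulr_ge0 ?invr_ge0.
  - exact: measurable_funeM.
  apply: le_integral_ge0.
  - by move=> t _; rewrite lee_fin.
  - by move=> t _; rewrite -!EFinM -EFinD lee_fin addr_ge0// mulr_ge0 ?invr_ge0 ?(ltW C0).
  - by move=> t Dt _; split => //; rewrite -!EFinM -EFinD lee_fin.
(* Finiteness, from the bounds [B k] and the finite measure of [D], is what allows [2^-1 * IH] to be
   subtracted; this doubles [C]. *)
have IHfin : IH \is a fin_num.
  rewrite ge0_fin_numE// IHE.
  apply: (@le_lt_trans _ _ (\int[mu]_(t in D) M%:E)%E).
    apply: le_integral_ge0.
    - by move=> t _; rewrite lee_fin.
    - by move=> t _; rewrite lee_fin.
    - by move=> t Dt _; split => //; rewrite lee_fin.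
  have mfin : mu D \is a fin_num by rewrite ge0_fin_numE ?measure_ge0.
  by rewrite integral_cst// -(fineK mfin) -EFinM ltry.
clear IHE IPE.
move: H2 IP0; rewrite -(fineK IHfin); case: IP => [r| |] H2 // IP0.
- by move: H2; rewrite -!EFinM -EFinD !lee_fin; lra.
- by rewrite gt0_muley ?leey// lte_fin mulr_gt0.
Qed.

End SteinInequality.

(** * Dyadic grids on the circle *)

Section Periodic.
Context {R : realType}.
Local Notation mR := (measurableTypeR R).
Local Notation mu := (@lebesgue_measure R).
Implicit Types (G : R -> \bar R) (a b c T : R).

(** By uniqueness of Lebesgue measure it suffices to compare the two measures on half-open
    intervals. *)
Lemma lebesgue_measure_shift c (A : set R) : measurable (A : set mR) ->
  pushforward mu ((fun x => x + c) : mR -> mR) A = mu A.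
Proof.
move=> mA; have ms : measurable_fun (setT : set mR) ((fun x => x + c) : mR -> mR).
  by apply: (@measurable_funD _ _ R setT).
apply/esym.
pose sh : {mfun mR >-> mR} := HB.pack ((fun x => x + c) : mR -> mR) (isMeasurableFun.Build _ _ _ _ _ ms).
have H := @lebesgue_measure_unique R (pushforward mu sh).
apply: H mA => _ [[a b] _ <-].
rewrite /= /pushforward /=.
have -> : (fun x : R => x + c) @^-1` `]a, b] = `]a - c, b - c]%classic.
  by apply/seteqP; split => x; rewrite /= !in_itv /= ltrBlDr lerBrDr.
rewrite !lebesgue_measure_itv /= !lte_fin ltrD2r; case: ifP => // _.
by rewrite -!EFinB; congr (_%:E); ring.
Qed.

Lemma integral_shift G a b c : measurable_fun (setT : set mR) (G : mR -> \bar R) ->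
  (forall x, 0 <= G x)%E ->
  (\int[mu]_(x in `[a, b[) G (x + c)%R = \int[mu]_(x in `[(a + c)%R, (b + c)%R[) G x)%E.
Proof.
move=> mG G0; have ms : measurable_fun (setT : set mR) ((fun x => x + c) : mR -> mR).
  by apply: (@measurable_funD _ _ R setT).
have mI : measurable (`[(a + c)%R, (b + c)%R[ : set mR) by [].
have -> : (\int[mu]_(x in `[(a + c)%R, (b + c)%R[) G x =
    \int[pushforward mu ((fun x => x + c)%R : mR -> mR)]_(x in `[(a + c)%R, (b + c)%R[) G x)%E.
  apply: eq_measure_integral => A mA _; exact/esym/lebesgue_measure_shift.
rewrite (ge0_integral_pushforward ms)//; last exact: measurable_funTS.
congr (integral _ _ _).
by apply/seteqP; split => x; rewrite /= !in_itv /= lerD2r ltrD2r.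
Qed.

Lemma integral_periodic G a T n : 0 <= T ->
  measurable_fun (setT : set mR) (G : mR -> \bar R) -> (forall x, 0 <= G x)%E ->
  (forall x, G (x + T) = G x) ->
  (\int[mu]_(x in `[(a - n%:R * T)%R, a[) G x = n%:R%:E * \int[mu]_(x in `[(a - T)%R, a[) G x)%E.
Proof.
move=> T0 mG G0 GT; have I0 u v : (0 <= \int[mu]_(x in `[u, v[) G x)%E by exact: integral_ge0.
elim: n a => [|n IH] a.
  by rewrite mul0r subr0 set_itvco0 integral_set0 mul0e.
have -> : (`[a - n.+1%:R * T, a[ : set R)%classic =
    (`[a - n.+1%:R * T, a - T[ `|` `[a - T, a[)%classic.
  rewrite -itv_bndbnd_setU// bnd_simp.
    by rewrite lerD2l lerN2 ler_peMl// ler1n.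
  by rewrite gerBl.
rewrite ge0_integral_setU//; last 2 first.
- exact: measurable_funTS.
- by apply/disj_set2P; apply/seteqP; split => x //= []; rewrite !in_itv /= => /andP[_ h1] /andP[h2 _]; move: (lt_le_trans h1 h2); rewrite ltxx.
have -> : (a - n.+1%:R * T = (a - T) - n%:R * T)%R by rewrite -natr1; ring.
rewrite IH.
have -> : (\int[mu]_(x in `[(a - T - T)%R, (a - T)%R[) G x = \int[mu]_(x in `[(a - T)%R, a[) G x)%E.
  have -> : (\int[mu]_(x in `[(a - T - T)%R, (a - T)%R[) G x =
     \int[mu]_(x in `[(a - T - T)%R, (a - T)%R[) G (x + T)%R)%E.
    by apply: eq_integral => x _; rewrite GT.
  by rewrite integral_shift// !subrK.
by rewrite -natr1 EFinD ge0_muleDl// mul1e.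
Qed.

End Periodic.

Section Grids.
Context {R : realType}.
Local Notation mR := (measurableTypeR R).
Local Notation mu := (@lebesgue_measure R).
Implicit Types (t x y A L eta : R) (j k l n : nat).

Section OneGrid.
Variables (A L : R).
Hypothesis L0 : 0 < L.

Definition gbase : set R := `[A, A + L[%classic.

(** Coordinate in which the dyadic intervals of generation [j] become unit intervals, so that
    truncation numbers them. *)
Definition gcoord j t : R := 2 ^+ j * ((t - A) / L).

Definition gidx j t : nat := Num.truncn (gcoord j t).

Lemma gcoord_ge0 j t : gbase t -> 0 <= gcoord j t.
Proof.
rewrite /gbase /= in_itv /= => /andP[h _].
by rewrite mulr_ge0 ?exprn_ge0// divr_ge0 ?subr_ge0// ltW.
Qed.

(** A natural endpoint of level [k] is again natural after multiplication by [2 ^+ (l - k)], so the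
    comparisons that define the coarse index can be read off from the fine one. *)
Lemma gidx_refine k l t t' : (k <= l)%N -> gbase t -> gbase t' ->
  gidx l t = gidx l t' -> gidx k t = gidx k t'.
Proof.
move=> kl Dt Dt'; rewrite /gidx => E; apply/esym/eqP.
rewrite Num.Theory.truncn_eq ?gcoord_ge0//.
have lE s : gcoord l s = gcoord k s * 2 ^+ (l - k)%N.
  by rewrite /gcoord mulrAC -exprD subnKC.
have e0 : (0 : R) < 2 ^+ (l - k) by rewrite exprn_gt0.
have /andP[h1 h2] := Num.Theory.truncn_itv (gcoord_ge0 k Dt).
rewrite -(ler_pM2r e0) -lE -natrX -natrM -Num.Theory.truncn_ge_nat ?gcoord_ge0// in h1.
rewrite -(ltr_pM2r e0) -lE -natrX -natrM -Num.Theory.truncn_lt_nat ?gcoord_ge0// in h2.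
rewrite E in h1 h2.
rewrite Num.Theory.truncn_ge_nat ?gcoord_ge0// lE natrM natrX (ler_pM2r e0) in h1.
rewrite Num.Theory.truncn_lt_nat ?gcoord_ge0// lE natrM natrX (ltr_pM2r e0) in h2.
by rewrite h1.
Qed.

Lemma cell_gidxE j i : cell gbase (gidx j) i =
  gbase `&` `[A + i%:R * (L / 2 ^+ j), A + i%:R * (L / 2 ^+ j) + L / 2 ^+ j[%classic.
Proof.
have e0 : (0 : R) < 2 ^+ j by rewrite exprn_gt0.
have d0 : 0 < L / 2 ^+ j by rewrite divr_gt0.
have E t : gbase t -> (gidx j t == i) =
    (t \in `[A + i%:R * (L / 2 ^+ j), A + i%:R * (L / 2 ^+ j) + L / 2 ^+ j[).
  move=> Dt; rewrite /gidx Num.Theory.truncn_eq ?gcoord_ge0//.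
  have -> : gcoord j t = (t - A) / (L / 2 ^+ j) by rewrite /gcoord invf_div mulrCA.
  by rewrite (ler_pdivlMr _ _ d0) (ltr_pdivrMr _ _ d0) lerBrDl ltrBlDl -[i.+1%:R]natr1 mulrDl mul1r addrA in_itv.
apply/seteqP; split => t [Dt] /= h; split => //.
  by rewrite -E//; exact/eqP.
by apply/eqP; rewrite E.
Qed.

Lemma measurable_cell_gidx j i : measurable (cell gbase (gidx j) i : set mR).
Proof. by rewrite cell_gidxE; apply: measurableI; exact: measurable_itv. Qed.

Lemma measure_cell_gidx j i : (mu (cell gbase (gidx j) i) <= (L / 2 ^+ j)%:E)%E.
Proof.
rewrite cell_gidxE; set I := `[_, _[%classic.
have d0 : 0 < L / 2 ^+ j by rewrite divr_gt0// exprn_gt0.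
apply: (@le_trans _ _ (mu I)).
  apply: le_measure; rewrite ?inE; [by apply: measurableI; exact: measurable_itv|exact: measurable_itv|exact: subIsetr].
rewrite /I lebesgue_measure_itv /= lte_fin ltrDl d0.
by rewrite -EFinB lee_fin addrAC subrr add0r.
Qed.

Lemma integral_le_cavg j t (b : R -> R) (B : R) (J : set R) : gbase t ->
  measurable_fun (setT : set mR) (b : mR -> mR) -> (forall x, 0 <= b x <= B) ->
  (forall x, J x -> gbase x /\ gidx j x = gidx j t) ->
  (\int[mu]_(x in J) (b x)%:E <= (L / 2 ^+ j * cavg mu gbase (gidx j) b t)%:E)%E.
Proof.
move=> Dt mb bB JC; set C := cell gbase (gidx j) (gidx j t).
have b0 x : 0 <= b x by case/andP: (bB x).
have mC : measurable (C : set mR) by exact: measurable_cell_gidx.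
have mL := measure_cell_gidx j (gidx j t); rewrite -/C in mL.
have Cfin : mu C \is a fin_num.
  by rewrite ge0_fin_numE ?measure_ge0// (le_lt_trans mL)// ltry.
apply: (@le_trans _ _ (\int[mu]_(x in C) (b x)%:E)%E).
  apply: le_integral_ge0.
  - by move=> x _; rewrite lee_fin.
  - by move=> x _; rewrite lee_fin.
  - by move=> x /JC.
have IB : (\int[mu]_(x in C) (b x)%:E <= B%:E * mu C)%E.
  have B0 : 0 <= B by case/andP: (bB t) => /le_trans; apply.
  rewrite -integral_cst//; apply: le_integral_ge0.
  - by move=> x _; rewrite lee_fin.
  - by move=> x _; rewrite lee_fin.
  - by move=> x Cx _; split => //; rewrite lee_fin; case/andP: (bB x).
have I0 : (0 <= \int[mu]_(x in C) (b x)%:E)%E by apply: integral_ge0 => x _; rewrite lee_fin.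
have Ifin : (\int[mu]_(x in C) (b x)%:E)%E \is a fin_num.
  by rewrite ge0_fin_numE// (le_lt_trans IB)// -(fineK Cfin) -EFinM ltry.
rewrite /cavg -/C -[leLHS](fineK Ifin) lee_fin.
have m0 : 0 <= fine (mu C) by rewrite fine_ge0// measure_ge0.
have [mz|mz] := eqVneq (fine (mu C)) 0.
  rewrite mz invr0 !mulr0 -lee_fin (fineK Ifin) (le_trans IB)//.
  by rewrite -(fineK Cfin) mz mule0.
have mp : 0 < fine (mu C) by rewrite lt_neqAle eq_sym mz.
rewrite mulrCA -[leLHS]mulr1 ler_wpM2l ?fine_ge0// ler_pdivlMr// mul1r.
by rewrite -lee_fin fineK.
Qed.

End OneGrid.

(** A window leaves its unit cell only across an endpoint [N] within [eta] of its centre. Cells are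
    closed on the left, hence the strict inequality on one side; [y < eta] sets apart windows
    reaching below 0. *)
Lemma truncn_straddle y eta : 0 <= eta ->
  (forall x, `|x - y| <= eta -> Num.truncn x = Num.truncn y) \/
  y < eta \/ exists N : nat, - eta < N%:R - y <= eta.
Proof.
move=> e0; have [ye|ye] := ltP y eta; first by right; left.
have y0 : 0 <= y by exact: le_trans ye.
have /andP[h1 h2] := Num.Theory.truncn_itv y0.
have [h3|h3] := ltP (y - eta) (Num.truncn y)%:R.
  by right; right; exists (Num.truncn y); apply/andP; split; lra.
have [h4|h4] := leP (Num.truncn y).+1%:R (y + eta).
  by right; right; exists (Num.truncn y).+1; apply/andP; split; lra.
left => x; rewrite ler_norml => /andP[h5 h6]; apply: Num.Theory.truncn_def.
by apply/andP; split; lra.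
Qed.

(** The half-open bounds put [N - N' - 2^j / 3] strictly between [-1/3] and [1/3]. Multiplied by 3
    this is an integer, hence 0, which is impossible as 3 does not divide [2 ^ j]. *)
Lemma thirds_not_natural (N N' j : nat) (eta : R) (y : R) : eta <= 1 / 6 ->
  - eta < N%:R - y <= eta -> - eta < N'%:R - (y - 2 ^+ j / 3) <= eta -> False.
Proof.
move=> e6 /andP[h1 h2] /andP[h3 h4].
have : (N * 3 = N' * 3 + 2 ^ j)%N.
  suff h : (N * 3 < (N' * 3 + 2 ^ j).+1)%N && (N' * 3 + 2 ^ j < (N * 3).+1)%N.
    by apply/eqP; rewrite eqn_leq -ltnS; case/andP: h => -> /=.
  by rewrite -!(ltr_nat R) -!natr1 !natrD !natrM natrX; apply/andP; split; lra.
move=> /(congr1 (modn^~ 3)); rewrite modnMl modnMDl => /esym/eqP.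
by rewrite -/(dvdn _ _) Euclid_dvdX.
Qed.

(** The two left ends differ by [2 pi], one third of the base length [6 pi], and both bases contain
    [[0, 2 pi]] with a margin of at least [pi] on either side. *)
Definition gA i : R := if i == 0%N then - (3 * pi) else - pi.

(** In units of a cell the window has half-width at most [pi / (6 pi) = 1 / 6], and the two grids
    are offset by [2^j / 3]; so it cannot straddle an endpoint in both. The coordinate of [t] is at
    least [1 / 6], which excludes the left edge. *)
Lemma one_third_trick j t eta : (0 < j)%N -> 0 <= t <= 2 * pi -> 0 <= eta ->
  eta * 2 ^+ j <= pi -> exists2 i, (i < 2)%N &
  forall x, `|x - t| <= eta ->
    gbase (gA i) (6 * pi) x /\ gidx (gA i) (6 * pi) j x = gidx (gA i) (6 * pi) j t.
Proof.
move=> j0 /andP[t0 t1] e0 ej; have p0 := pi_gt0 R.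
have e2 : 2 <= 2 ^+ j :> R by case: j j0 {ej} => // j _; rewrite exprS ler_peMr// exprn_ege1// ler1n.
have eh : eta <= pi / 2.
  have : eta * 2 <= eta * 2 ^+ j by rewrite ler_wpM2l.
  by move: ej; lra.
have inD i x : (i < 2)%N -> `|x - t| <= eta -> gbase (gA i) (6 * pi) x.
  rewrite ler_norml /gbase /= in_itv /= /gA => i2 /andP[h1 h2].
  by case: i i2 => [|[|//]] _ /=; apply/andP; split; lra.
have p6 : 0 < 6 * pi :> R by lra.
have cB i x : `|x - t| <= eta ->
    `|gcoord (gA i) (6 * pi) j x - gcoord (gA i) (6 * pi) j t| <= 1 / 6.
  move=> xt; rewrite /gcoord -mulrBr -mulrBl opprB addrA subrK mulrA normrM normfV.
  rewrite (gtr0_norm p6) ler_pdivrMr// normrM ger0_norm ?exprn_ge0//.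
  rewrite (_ : 1 / 6 * (6 * pi) = pi); last by field.
  by apply: le_trans ej; rewrite mulrC ler_wpM2r// exprn_ge0.
have ge i : (i < 2)%N -> 1 / 6 <= gcoord (gA i) (6 * pi) j t.
  move=> i2; rewrite /gcoord -[1 / 6]mul1r.
  apply: ler_pM; [exact: ler01|lra|by apply: le_trans e2; rewrite ler1n|].
  rewrite ler_pdivlMr// /gA; case: i i2 => [|[|//]] _ /=; lra.
have e6 : (0 : R) <= 1 / 6 by lra.
have [H|[H|[N HN]]] := @truncn_straddle (gcoord (gA 0) (6 * pi) j t) _ e6.
- by exists 0%N => // x xt; split; [exact: inD|exact/H/cB].
- by have := ge 0%N isT; rewrite leNgt H.
have [H|[H|[N' HN']]] := @truncn_straddle (gcoord (gA 1) (6 * pi) j t) _ e6.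
- by exists 1%N => // x xt; split; [exact: inD|exact/H/cB].
- by have := ge 1%N isT; rewrite leNgt H.
exfalso; apply: (@thirds_not_natural N N' j (1 / 6) _ _ HN); first exact: lexx.
suff -> : gcoord (gA 0) (6 * pi) j t - 2 ^+ j / 3 = gcoord (gA 1) (6 * pi) j t by exact: HN'.
have pn0 : pi != 0 :> R by rewrite lt0r_neq0.
have H (P u : R) : P != 0 ->
    u * ((t - - (3 * P)) / (6 * P)) - u / 3 = u * ((t - - P) / (6 * P)).
  by move=> P0; field.
exact: H.
Qed.

End Grids.

(** * Moving averages over arcs *)

Section MovingAverage.
Context {R : realType}.
Local Notation mR := (measurableTypeR R).
Local Notation mu := (@lebesgue_measure R).
Implicit Types (t x c : R) (k m n : nat) (b : nat -> R -> R).

Lemma powRD_le (x y e : R) : 0 <= x -> 0 <= y -> 0 <= e ->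
  (x + y) `^ e <= 2 `^ e * (x `^ e + y `^ e).
Proof.
move=> x0 y0 e0; wlog xy : x y x0 y0 / x <= y => [H|].
  by have [/H|/ltW /H] := leP x y; [exact|rewrite addrC [X in _ * X]addrC; exact].
apply: (@le_trans _ _ ((2 * y) `^ e)).
  apply: ge0_ler_powR => //; rewrite ?nnegrE ?addr_ge0 ?mulr_ge0//.
  by move: xy; clear; lra.
by rewrite (powRM e (ler0n R 2) y0) ler_wpM2l ?powR_ge0// lerDr powR_ge0.
Qed.

Lemma measurable_powR_sum d (T : measurableType d) (D : set T) (f : nat -> T -> R) n (p v : R) :
  (forall k, measurable_fun D (f k)) ->
  measurable_fun D (fun s : T => (\sum_(k < n) f k s `^ p) `^ v).
Proof.
move=> mf.
have msum (g : nat -> T -> R) : (forall k, measurable_fun D (g k)) ->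
    measurable_fun D (fun s : T => \sum_(k < n) g k s).
  by move=> mg; apply: (@measurable_sum _ _ _ D _ (index_enum (ordinal n)) (fun (k : ordinal n) s => g k s)).
have mpow (g : T -> R) (r : R) : measurable_fun D g -> measurable_fun D (fun s : T => g s `^ r).
  by move=> mg; exact: (measurableT_comp (measurable_powR r) mg).
by apply: (mpow _ v); apply: (msum (fun k s => f k s `^ p)) => k; exact: mpow.
Qed.

(** At the levels up to [m] the arcs are no longer small against the base, and [[- pi, 3 pi]]
    replaces them: it contains a full turn, with room around the angles given by [polar_arc]. *)
Definition window c m k t : set R :=
  if (k <= m)%N then `[- pi, 3 * pi]%classic
  else `[t - c / 2 ^+ k, t + c / 2 ^+ k[%classic.

Definition movavg c m b k t : R :=
  2 ^+ k * fine (\int[mu]_(x in window c m k t) (b k x)%:E)%E.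

Section Bound.
Variables (c : R) (m : nat) (b : nat -> R -> R) (B : nat -> R).
Hypotheses (c0 : 0 < c) (cm : c <= pi * 2 ^+ m).
Hypotheses (mb : forall k, measurable_fun (setT : set mR) (b k : mR -> mR))
  (bB : forall k t, 0 <= b k t <= B k).

Let L : R := 6 * pi.
Let L0 : 0 < L. Proof. by rewrite mulr_gt0// pi_gt0. Qed.
Let av i k t := cavg mu (gbase (gA i) L) (gidx (gA i) L (k - m)) (b k) t.

Lemma gbase_fin i : (mu (gbase (gA i) L) < +oo)%E.
Proof. by rewrite /gbase lebesgue_measure_itv /= lte_fin ltrDl L0 -EFinB ltry. Qed.

Lemma gbase_arc i t : (i < 2)%N -> 0 <= t <= 2 * pi -> gbase (gA i) L t.
Proof.
have p0 := pi_gt0 R; move=> i2 /andP[t0 t1]; rewrite /gbase /= in_itv /= /gA /L.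
by case: i i2 => [|[|//]] _ /=; apply/andP; split; lra.
Qed.

Lemma grid_cavg_ge0 i k t : (i < 2)%N -> gbase (gA i) L t -> 0 <= av i k t.
Proof.
move=> i2 Dt.
have B0 : 0 <= B k by case/andP: (bB k t) => /le_trans; apply.
by have /andP[] := @cavg_bounds _ _ _ mu _ (measurable_itv _) (gbase_fin i) _
  (measurable_cell_gidx (gA i) L0 (k - m)) (b k) (B k) t B0 (fun t _ => bB k t).
Qed.

(** Level [k] is compared with generation [k - m] of the grids, coarse enough for the one-third
    trick because [c <= pi * 2 ^+ m]. Truncated subtraction gives generation 0 for [k <= m], and its
    only cell in the second grid contains [[- pi, 3 pi]]. *)
Lemma movavg_le_cavg k t : 0 <= t <= 2 * pi ->
  movavg c m b k t <= 2 ^+ m * L * (av 0 k t + av 1 k t).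
Proof.
move=> t02.
have ge i : (i < 2)%N -> 0 <= av i k t by move=> i2; apply: grid_cavg_ge0 => //; exact: gbase_arc.
suff [i i2 H] : exists2 i, (i < 2)%N &
    (\int[mu]_(x in window c m k t) (b k x)%:E <= (L / 2 ^+ (k - m) * av i k t)%:E)%E.
  apply: (@le_trans _ _ (2 ^+ m * L * av i k t)); last first.
    apply: ler_wpM2l; first by rewrite mulr_ge0 ?exprn_ge0// ltW.
    by case: i i2 {H} => [|[|//]] i2; rewrite ?lerDl ?lerDr ge.
  have I0 : (0 <= \int[mu]_(x in window c m k t) (b k x)%:E)%E.
    by apply: integral_ge0 => x _; rewrite lee_fin; case/andP: (bB k x).
  have Ifin : (\int[mu]_(x in window c m k t) (b k x)%:E)%E \is a fin_num.
    by rewrite ge0_fin_numE// (le_lt_trans H)// ltry.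
  move: H; rewrite -[X in (X <= _)%E](fineK Ifin) lee_fin /movavg => H.
  apply: (le_trans (ler_wpM2l (exprn_ge0 k (ler0n R 2)) H)).
  rewrite mulrA ler_wpM2r ?ge// mulrCA mulrC ler_wpM2r ?(ltW L0)//.
  rewrite ler_pdivrMr ?exprn_gt0// -exprD ler_weXn2l ?ler1n//.
  by rewrite -leq_subLR.
have [km|mk] := leqP k m.
  exists 1%N => //; rewrite /window km.
  apply: (@integral_le_cavg _ _ _ L0 _ _ _ (B k)) => //; first exact: gbase_arc.
  have p0 := pi_gt0 R.
  have idx x : gbase (gA 1) L x -> gidx (gA 1) L (k - m) x = 0%N.
    move=> Dx; move: (Dx); rewrite /gidx /gcoord (eqP km) expr0 mul1r /gbase /= in_itv /= => /andP[h1 h2].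
    apply: Num.Theory.truncn_def; rewrite divr_ge0 ?subr_ge0 ?(ltW L0)//=.
    by rewrite ltr_pdivrMr// mul1r ltrBlDl.
  move=> x; rewrite /= in_itv /= => /andP[h1 h2].
  have Dx : gbase (gA 1) L x.
    by rewrite /gbase /= in_itv /= /gA /L /=; apply/andP; split; lra.
  by split => //; rewrite !idx//; exact: gbase_arc.
have e0 : 0 <= c / 2 ^+ k by rewrite divr_ge0 ?exprn_ge0// ltW.
have [|//|i i2 H] := @one_third_trick R (k - m) t (c / 2 ^+ k) _ t02 e0.
- by rewrite subn_gt0.
- have -> : (2 ^+ k = 2 ^+ (k - m) * 2 ^+ m :> R) by rewrite -exprD subnK// ltnW.
  rewrite mulrAC ler_pdivrMr ?mulr_gt0 ?exprn_gt0//.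
  by rewrite mulrCA mulrC ler_wpM2l ?exprn_ge0.
exists i => //; rewrite /window leqNgt mk /=.
apply: (@integral_le_cavg _ _ _ L0 _ _ _ (B k)) => //; first exact: gbase_arc.
by move=> x; rewrite /= in_itv /= => /andP[h1 /ltW h2]; apply: H; rewrite ler_distl h1.
Qed.

End Bound.

(** Both bases lie in [[- 4 pi, 6 pi[], which consists of five periods. *)
Lemma integral_gbase_periodic (G : R -> \bar R) i : (i < 2)%N ->
  measurable_fun (setT : set mR) (G : mR -> \bar R) -> (forall t, 0 <= G t)%E ->
  (forall t, G (t + 2 * pi) = G t) ->
  (\int[mu]_(t in gbase (gA i) (6 * pi)) G t <= 5%:E * \int[mu]_(t in `[0%R, (2 * pi)%R]) G t)%E.
Proof.
move=> i2 mG G0 GT; have pg := pi_gt0 R; apply: (@le_trans _ _ (\int[mu]_(t in `[(6 * pi - 5%:R * (2 * pi))%R, (6 * pi)%R[) G t)%E).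
  apply: le_integral_ge0 => // x; rewrite /gbase /= !in_itv /= /gA => /andP[h1 h2] _.
  split=> //; apply/andP.
  by case: i i2 h1 h2 => [|[|//]] _ /= h1 h2; split; move: h1 h2 pg; clear; lra.
have P0 : (0 <= 2 * pi :> R) by lra.
rewrite (@integral_periodic _ _ (6 * pi) _ 5 P0 mG G0 GT).
apply: lee_wpmul2l; first by rewrite lee_fin.
have := @integral_periodic _ G (6 * pi) _ 3 P0 mG G0 GT.
have -> : 6 * pi - 3%:R * (2 * pi) = 0 :> R by ring.
have -> : (6 * pi = 3%:R * (2 * pi) :> R) by ring.
have -> : (3%:R * (2 * pi) - 2 * pi = 2%:R * (2 * pi) :> R) by ring.
have E2 := @integral_periodic _ G (2 * pi) _ 1 P0 mG G0 GT.
have shift : (\int[mu]_(t in `[(2%:R * (2 * pi))%R, (3%:R * (2 * pi))%R[) G t =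
    \int[mu]_(t in `[0%R, (2 * pi)%R[) G t)%E.
  have S1 := @integral_shift R G 0 (2 * pi) (2 * pi) mG G0.
  have S2 := @integral_shift R G (2 * pi) (2%:R * (2 * pi)) (2 * pi) mG G0.
  rewrite add0r in S1.
  have e1 : 2 * pi + 2 * pi = 2%:R * (2 * pi) :> R by ring.
  have e2 : 2%:R * (2 * pi) + 2 * pi = 3%:R * (2 * pi) :> R by ring.
  rewrite e1 in S1 S2; rewrite e2 in S2.
  transitivity (\int[mu]_(t in `[(2 * pi)%R, (2%:R * (2 * pi))%R[) G t)%E.
    by rewrite -S2; apply: eq_integral => x _; rewrite GT.
  by rewrite -S1; apply: eq_integral => x _; rewrite GT.
move=> _; rewrite shift; apply: le_integral_ge0 => // x; rewrite /= !in_itv /= => /andP[-> h] _.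
by rewrite ltW.
Qed.

(** Stein's inequality is applied on each base, and periodicity brings the right sides back to
    [[0, 2 pi]]. The bounds [B k] are quantified after [C]: they serve finiteness only. *)
Theorem moving_average_stein (p q c : R) m : 1 < p -> 1 < q -> 0 < c -> c <= pi * 2 ^+ m ->
  exists2 C : R, 0 < C & forall b (B : nat -> R) n,
    (forall k, measurable_fun (setT : set mR) (b k : mR -> mR)) ->
    (forall k t, 0 <= b k t <= B k) -> (forall k t, b k (t + 2 * pi) = b k t) ->
    (\int[mu]_(t in `[0%R, (2 * pi)%R]) ((\sum_(k < n) movavg c m b k t `^ p) `^ (q / p))%:E <=
     C%:E * \int[mu]_(t in `[0%R, (2 * pi)%R]) ((\sum_(k < n) b k t `^ p) `^ (q / p))%:E)%E.
Proof.
move=> p1 q1 c0 cm; have pg : 0 < pi :> R := pi_gt0 R.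
pose L : R := 6 * pi; have L0 : 0 < L by rewrite mulr_gt0.
have mD i : measurable (gbase (gA i) L : set mR) by exact: measurable_itv.
have [C0 C00 H0] := @stein_inequality _ _ _ mu _ (mD 0%N) (gbase_fin 0) _ _ p1 q1.
have [C1 C10 H1] := @stein_inequality _ _ _ mu _ (mD 1%N) (gbase_fin 1) _ _ p1 q1.
have p0 : 0 < p by exact: lt_trans p1.
have v0 : 0 < q / p by rewrite divr_gt0// (lt_trans ltr01).
move: (q / p) v0 H0 H1 => v v0 H0 H1.
have [K [KE K0]] : exists K : R, K = (((2 ^+ m * L) `^ p * 2 `^ p) `^ v * 2 `^ v) /\ 0 < K.
  eexists; split; first exact: erefl.
  by rewrite !mulr_gt0 ?powR_gt0 ?mulr_gt0 ?powR_gt0 ?mulr_gt0 ?exprn_gt0.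
exists (K * (5 * (C0 + C1))).
  by apply: mulr_gt0 => //; apply: mulr_gt0; [rewrite ltr0n|exact: addr_gt0].
move=> b B n mb bB bT.
have b0 k t : 0 <= b k t by case/andP: (bB k t).
have B0 k : 0 <= B k by exact: le_trans (b0 k 0) (proj2 (andP (bB k 0))).
pose av i k t := cavg mu (gbase (gA i) L) (gidx (gA i) L (k - m)) (b k) t.
pose X i t := (\sum_(k < n) av i k t `^ p) `^ v.
have mX i : measurable_fun (gbase (gA i) L : set mR) (X i : mR -> mR).
  apply: (@measurable_powR_sum _ _ (gbase (gA i) L : set mR) (av i)) => k.
  have mc := measurable_cell_gidx (gA i) L0 (k - m).
  exact: (measurable_cell_constant mc (@cavg_constant _ _ _ mu (gbase (gA i) L) _ (b k))).
pose G t := (\sum_(k < n) b k t `^ p) `^ v.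
have mG : measurable_fun (setT : set mR) ((fun t => (G t)%:E) : mR -> \bar R).
  by apply/measurable_EFinP; exact: (@measurable_powR_sum _ _ setT b).
have G0 t : (0 <= (G t)%:E)%E by rewrite lee_fin powR_ge0.
pose IG := (\int[mu]_(t in `[0%R, (2 * pi)%R]) (G t)%:E)%E.
have IG0 : (0 <= IG)%E by exact: integral_ge0.
have X0 i t : (0 <= (X i t)%:E)%E by rewrite lee_fin powR_ge0.
have per i : (i < 2)%N -> (\int[mu]_(t in gbase (gA i) L) (G t)%:E <= 5%:E * IG)%E.
  move=> i2; apply: (integral_gbase_periodic i2 mG G0) => t.
  by rewrite /G; under eq_bigr do rewrite bT.
have SX i : (i < 2)%N -> forall Ci : R, 0 < Ci ->
   (\int[mu]_(t in gbase (gA i) L) (X i t)%:E <= Ci%:E * \int[mu]_(t in gbase (gA i) L) (G t)%:E)%E ->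
   (\int[mu]_(t in `[0%R, (2 * pi)%R]) (X i t)%:E <= (5 * Ci)%:E * IG)%E.
  move=> i2 Ci Ci0 H; apply: (@le_trans _ _ (\int[mu]_(t in gbase (gA i) L) (X i t)%:E)%E).
    apply: le_integral_ge0; [by move=> x _; exact: X0|by move=> x _; exact: X0|].
    move=> x; rewrite /= in_itv /= => x02 _; split; last exact: lexx.
    exact: gbase_arc.
  apply: (le_trans H); rewrite mulrC EFinM -muleA.
  by apply: lee_wpmul2l; [rewrite lee_fin ltW|exact: per].
have {}H0 := SX 0%N isT C0 C00 (H0 (fun k => gidx (gA 0) L (k - m)) b B n _ _ B0 _ b0 _).
have {}H1 := SX 1%N isT C1 C10 (H1 (fun k => gidx (gA 1) L (k - m)) b B n _ _ B0 _ b0 _).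
have mbD i k : measurable_fun (gbase (gA i) L : set mR) (b k : mR -> mR) by exact: measurable_funTS.
have bBD i k t : gbase (gA i) L t -> b k t <= B k by case/andP: (bB k t).
have ref i k l t t' : (k <= l)%N -> gbase (gA i) L t -> gbase (gA i) L t' ->
    gidx (gA i) L (l - m) t = gidx (gA i) L (l - m) t' -> gidx (gA i) L (k - m) t = gidx (gA i) L (k - m) t'.
  by move=> kl Dt Dt'; apply: gidx_refine => //; exact: leq_sub2r.
have {}H0 := H0 (fun k => measurable_cell_gidx (gA 0) L0 (k - m)) (ref 0%N) (mbD 0%N) (bBD 0%N).
have {}H1 := H1 (fun k => measurable_cell_gidx (gA 1) L0 (k - m)) (ref 1%N) (mbD 1%N) (bBD 1%N).
have arcD i : (i < 2)%N -> (`[0%R, (2 * pi)%R] : set R) `<=` gbase (gA i) L.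
  by move=> i2 x; rewrite /= in_itv /= => ?; exact: gbase_arc.
have mXa i : (i < 2)%N -> measurable_fun (`[0%R, (2 * pi)%R] : set mR) ((fun t => (X i t)%:E) : mR -> \bar R).
  by move=> i2; apply/measurable_EFinP; apply: (measurable_funS (mD i) (arcD i i2)); exact: mX.
apply: (@le_trans _ _ (K%:E * \int[mu]_(t in `[0%R, (2 * pi)%R]) ((X 0%N t)%:E + (X 1%N t)%:E))%E); last first.
  rewrite (ge0_integralD mu (measurable_itv _) (fun t _ => X0 0%N t) (mXa 0%N isT)
    (fun t _ => X0 1%N t) (mXa 1%N isT)).
  rewrite EFinM -muleA; apply: lee_wpmul2l; first by rewrite lee_fin (ltW K0).
  have c5 (x : R) : 0 < x -> (0 <= (5 * x)%:E)%E by move=> x0; rewrite lee_fin mulr_ge0 ?ler0n ?(ltW x0).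
  have -> : (5 * (C0 + C1) = 5 * C0 + 5 * C1)%R by rewrite mulrDr.
  rewrite EFinD (ge0_muleDl _ (c5 _ C00) (c5 _ C10)).
  exact: (leeD H0 H1).
have XX0 t : (0 <= (X 0%N t)%:E + (X 1%N t)%:E)%E by exact: (adde_ge0 (X0 0%N t) (X0 1%N t)).
have KK0 : (0 <= K%:E)%E by rewrite lee_fin (ltW K0).
rewrite -(ge0_integralZl mu (measurable_itv _) (emeasurable_funD (mXa 0%N isT) (mXa 1%N isT)) (fun t _ => XX0 t) KK0).
apply: le_integral_ge0.
- by move=> t _; rewrite lee_fin; exact: powR_ge0.
- by move=> t _; exact: (mule_ge0 KK0 (XX0 t)).
move=> t; rewrite /= in_itv /= => t02 _; split; first exact: t02.
rewrite -EFinD -EFinM lee_fin.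
have a0 i k : (i < 2)%N -> 0 <= av i k t.
  move=> i2; apply: (@grid_cavg_ge0 m b B bB i k t i2); exact: gbase_arc.
have M0 k : 0 <= movavg c m b k t.
  by rewrite mulr_ge0 ?exprn_ge0// fine_ge0// integral_ge0// => x _; rewrite lee_fin.
have step : \sum_(k < n) movavg c m b k t `^ p <= ((2 ^+ m * L) `^ p * 2 `^ p) *
    (\sum_(k < n) av 0%N k t `^ p + \sum_(k < n) av 1%N k t `^ p).
  rewrite -big_split /= mulr_sumr; apply: ler_sum => k _.
  apply: (@le_trans _ _ ((2 ^+ m * L * (av 0%N k t + av 1%N k t)) `^ p)).
    apply: ge0_ler_powR; rewrite ?nnegrE ?(ltW p0)//.
      by rewrite mulr_ge0 ?addr_ge0 ?a0// mulr_ge0 ?exprn_ge0// ltW.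
    exact: (@movavg_le_cavg c m b B).
  rewrite powRM ?addr_ge0 ?a0//; last by rewrite mulr_ge0 ?exprn_ge0// ltW.
  by rewrite -mulrA ler_wpM2l ?powR_ge0// powRD_le ?a0// ltW.
have S0 i : 0 <= \sum_(k < n) av i k t `^ p by rewrite sumr_ge0// => k _; exact: powR_ge0.
apply: (@le_trans _ _ ((((2 ^+ m * L) `^ p * 2 `^ p) *
    (\sum_(k < n) av 0%N k t `^ p + \sum_(k < n) av 1%N k t `^ p)) `^ v)).
  apply: ge0_ler_powR; rewrite ?nnegrE ?(ltW v0)//.
    by rewrite sumr_ge0// => k _; exact: powR_ge0.
  by rewrite mulr_ge0 ?mulr_ge0 ?powR_ge0 ?addr_ge0.
rewrite powRM ?addr_ge0 ?mulr_ge0 ?powR_ge0//.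
rewrite KE -mulrA ler_wpM2l ?powR_ge0//.
by apply: powRD_le; rewrite ?S0 ?(ltW v0).
Qed.

Lemma measurable_movavg c m (b : nat -> R -> R) k :
  measurable_fun (setT : set mR) (b k : mR -> mR) -> forall B, (forall t, 0 <= b k t <= B) ->
  measurable_fun (setT : set mR) (movavg c m b k : mR -> mR).
Proof.
move=> mb B bB; have b0 x : 0 <= b k x by case/andP: (bB x).
rewrite /movavg /window; have [km|km] := boolP (k <= m)%N; first exact: measurable_cst.
apply: measurable_funM; first exact: measurable_cst.
have Ifin t : (\int[mu]_(x in `[(t - c / 2 ^+ k)%R, (t + c / 2 ^+ k)%R[) (b k x)%:E)%E \is a fin_num.
  rewrite ge0_fin_numE; last by apply: integral_ge0 => x _; rewrite lee_fin.
  apply: (@le_lt_trans _ _ (\int[mu]_(x in `[(t - c / 2 ^+ k)%R, (t + c / 2 ^+ k)%R[) B%:E)%E).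
    apply: le_integral_ge0 => x; rewrite ?lee_fin//.
      by move=> _; case/andP: (bB x) => /le_trans; apply.
    by move=> xI _; split => //; case/andP: (bB x).
  rewrite integral_cst//= lebesgue_measure_itv /=.
  by case: ifP => _; rewrite ?mule0 ?ltry// -EFinB -EFinM ltry.
apply/measurable_EFinP; rewrite (_ : _ \o _ =
  fun t => \int[mu]_(x in `[(t - c / 2 ^+ k)%R, (t + c / 2 ^+ k)%R[) (b k x)%:E)%E; last first.
  by apply/funext => t /=; rewrite fineK.
have mbE : measurable_fun (setT : set mR) ((fun x => (b k x)%:E) : mR -> \bar R).
  by apply/measurable_EFinP.
have -> : (fun t => \int[mu]_(x in `[(t - c / 2 ^+ k)%R, (t + c / 2 ^+ k)%R[) (b k x)%:E)%E =
    (fun t => \int[mu]_(x in `[(- (c / 2 ^+ k))%R, (c / 2 ^+ k)%R[) (b k (x + t))%:E)%E.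
  apply/funext => t; rewrite (@integral_shift R (fun x => (b k x)%:E)) => [|//|x].
    by rewrite [(- _ + t)%R]addrC [(c / 2 ^+ k + t)%R]addrC.
  by rewrite lee_fin.
apply: (@measurable_fun_integral_slice R (fun w => (b k (w.1 + w.2))%:E)) => //.
  apply/measurable_EFinP; apply: measurableT_comp => //.
  by apply: measurable_funD; [exact: measurable_fst|exact: measurable_snd].
by move=> w; rewrite lee_fin.
Qed.

End MovingAverage.

(** * Radial blocks and approach regions *)

Section Preliminaries.
Context {R : realType}.
Implicit Types (x y r t M : R) (k n : nat) (z xi : R[i]).

(** Integrates the tangent inequality [y^P >= P A^(P-1) y - (P-1) A^P] at [A = I / l]. Only a finite
    lower bound [I] of the integral enters, so the integral of [psi] itself may be infinite. *)
Lemma jensen_powR d (T : measurableType d) (nu : {measure set T -> \bar R}) (D : set T)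
    (psi : T -> R) (P l I : R) : 1 < P -> 0 < l -> 0 <= I ->
  measurable D -> nu D = l%:E -> measurable_fun D psi -> (forall s, D s -> 0 <= psi s) ->
  (I%:E <= \int[nu]_(s in D) (psi s)%:E)%E ->
  (((I / l) `^ P * l)%:E <= \int[nu]_(s in D) (psi s `^ P)%:E)%E.
Proof.
move=> P1 l0 I0 mD Dl mpsi psi0 HI.
have P0 : 0 < P by exact: lt_trans P1.
pose A := I / l; have A0 : 0 <= A by rewrite divr_ge0// ltW.
have P10 : 0 < P - 1 by rewrite subr_gt0.
have AE : A `^ P = A `^ (P - 1) * A.
  have [->|An0] := eqVneq A 0; first by rewrite mulr0 powR0// gt_eqF.
  by rewrite -[X in _ = _ * X](powRr1 A0) -powRD ?subrK// An0 implybT.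
have Y y : 0 <= y -> P * A `^ (P - 1) * y <= y `^ P + (P - 1) * A `^ P.
  move=> y0; have Q0 : 0 < P / (P - 1) by rewrite divr_gt0.
  have pq : P^-1 + (P / (P - 1))^-1 = 1.
    by rewrite invf_div; field; rewrite ?(gt_eqF P0) ?(gt_eqF P10).
  have := conjugate_powR y0 (powR_ge0 A (P - 1)) P0 Q0 pq.
  rewrite -powRrM (_ : (P - 1) * (P / (P - 1)) = P); last first.
    by field; rewrite ?(gt_eqF P10).
  rewrite -(ler_pM2l P0) => /le_trans H.
  rewrite -mulrA [_ * y]mulrC; apply: H; rewrite mulrDr invf_div.
  rewrite [P * (_ / P)]mulrC divfK ?gt_eqF// lerD2l.
  by rewrite [P * _]mulrC -mulrA divfK ?gt_eqF// mulrC.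
have mpsiP : measurable_fun D (fun s : T => psi s `^ P).
  exact: (measurableT_comp (measurable_powR P) mpsi).
set J := (\int[nu]_(s in D) (psi s `^ P)%:E)%E.
have J0 : (0 <= J)%E by apply: integral_ge0 => x _; rewrite lee_fin powR_ge0.
have K0 : 0 <= P * A `^ (P - 1) by rewrite mulr_ge0 ?powR_ge0 ?(ltW P0).
have L0 : 0 <= (P - 1) * A `^ P by rewrite mulr_ge0 ?powR_ge0 ?(ltW P10).
have H1 : ((P * A `^ (P - 1) * I)%:E <= J + ((P - 1) * A `^ P * l)%:E)%E.
  rewrite EFinM; apply: (@le_trans _ _ ((P * A `^ (P - 1))%:E * \int[nu]_(s in D) (psi s)%:E)%E).
    by apply: lee_wpmul2l; rewrite ?lee_fin.
  rewrite -ge0_integralZl//; last exact/measurable_EFinP.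
  have -> : ((P - 1) * A `^ P * l)%:E = (\int[nu]_(s in D) ((P - 1) * A `^ P)%:E)%E.
    by rewrite integral_cst// Dl EFinM.
  rewrite -ge0_integralD//; last 2 first.
  - by move=> s _; rewrite lee_fin powR_ge0.
  - exact/measurable_EFinP.
  apply: le_integral_ge0.
  - by move=> s Dx; rewrite -EFinM lee_fin mulr_ge0 ?psi0.
  - by move=> s _; rewrite -EFinD lee_fin addr_ge0 ?powR_ge0.
  - by move=> s Dx _; split => //; rewrite -EFinM -EFinD lee_fin Y ?psi0.
rewrite -/A; move: H1 J0; case: J => [j| |] H1 // J0; last by rewrite leey.
move: H1; rewrite -EFinD !lee_fin (_ : I = A * l); last by rewrite divfK ?gt_eqF.
rewrite mulrA -[P * _ * A]mulrA -AE.
by rewrite -!(mulrA _ (A `^ P)) mulrBl; move: (A `^ P * l) (P * _) => X X'; clear; lra.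
Qed.

Lemma geometric_cutoff_sum (Y : R) n : 0 <= Y ->
  \sum_(k < n) (if 2 ^- k <= Y then 2 ^- k else 0) <= 2 * Y.
Proof.
move=> Y0; set S := \sum_(k < n) _.
(* Invariant for the induction: the sum is zero until the first admissible term, and afterwards the
   geometric tail still to come fits under [2 Y]. *)
suff [->|H] : S = 0 \/ S <= 2 * Y - 2 * 2 ^- n.
- by rewrite mulr_ge0.
- by apply: (le_trans H); rewrite gerBl mulr_ge0// invr_ge0 exprn_ge0.
rewrite /S; elim: n {S} => [|n IH]; first by left; rewrite big_ord0.
rewrite big_ord_recr /=; set S := \sum_(k < n) _ in IH *.
have S0 : 0 <= S by apply: sumr_ge0 => k _; case: ifP => // _; rewrite invr_ge0 exprn_ge0.
have -> : 2 ^- n.+1 = 2 ^- n / 2 :> R by rewrite exprS invfM mulrC.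
move: IH; move: (2 ^- n) S S0 => u S S0; case: (leP u Y) => uY [->|H].
- by right; lra.
- by right; lra.
- by left; rewrite addr0.
- by exfalso; lra.
Qed.

Lemma normr_atan_le x : `|atan x| <= `|x|.
Proof.
wlog x0 : x / 0 <= x => [H|].
  have [/H//|/ltW x0] := leP 0 x.
  by have := H (- x); rewrite atanN !normrN oppr_ge0; exact.
have a0 : 0 <= atan x by rewrite -(atan0 R); exact: le_atan.
rewrite !ger0_norm//.
have [|c _] := @MVT_segment R (@atan R) (fun x => (1 + x ^+ 2)^-1) 0 x x0.
  by apply: continuous_at_within => y _; exact: continuous_atan.
rewrite atan0 !subr0 => ->; apply: ler_piMl => //.
by rewrite invf_le1 ?ltr_wpDr ?sqr_ge0// lerDl sqr_ge0.
Qed.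

Lemma polar_rightP z : 0 < Re z -> exists2 t, `|t| < pi / 2 &
  z = polar (normc z) t /\ `|t| <= `|Im z / Re z|.
Proof.
case: z => a b /= a0; exists (atan (b / a)).
  by rewrite ltr_norml atan_gtNpi2 atan_ltpi2.
have sp : 0 < 1 + (b / a) ^+ 2 by rewrite ltr_wpDr// sqr_ge0.
have sE : Num.sqrt (a ^+ 2 + b ^+ 2) = a * Num.sqrt (1 + (b / a) ^+ 2).
  rewrite -{2}(ger0_norm (ltW a0)) -sqrtr_sqr -sqrtrM ?sqr_ge0//; congr (Num.sqrt _).
  by field; rewrite gt_eqF.
have ct : 0 < cos (atan (b / a)) by rewrite cos_atan invr_gt0 sqrtr_gt0.
have cE : Num.sqrt (a ^+ 2 + b ^+ 2) * cos (atan (b / a)) = a.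
  by rewrite sE cos_atan -mulrA divff ?mulr1// gt_eqF// sqrtr_gt0.
have st : sin (atan (b / a)) = b / a * cos (atan (b / a)).
  by have := atanK (b / a); rewrite /tan => {2}<-; rewrite divfK ?gt_eqF.
split.
  by rewrite /polar cE st mulrCA cE divfK ?gt_eqF.
exact: normr_atan_le.
Qed.

Lemma polar_arc z : exists t, - (pi / 2) <= t <= 3 * (pi / 2) /\ z = polar (normc z) t.
Proof.
have pp := pi_gt0 R; have [z0|z0|z0] := ltgtP (Re z) 0.
- have /polar_rightP[t] : 0 < Re (- z) by case: z z0 => a b /=; rewrite oppr_gt0.
  rewrite ltr_norml => /andP[t0 t1] [+ _]; rewrite normc_opp => zE.
  exists (t + pi); split; first by apply/andP; split; lra.
  rewrite -[LHS]opprK zE; apply/eqP; rewrite eq_complex /= cosDpi sinDpi.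
  by rewrite !mulrN !eqxx.
- have /polar_rightP[t] := z0; rewrite ltr_norml => /andP[t0 t1] [zE _].
  by exists t; split => //; apply/andP; split; lra.
- case: z z0 => a b /= ->; have [b0|b0] := leP 0 b.
    exists (pi / 2); split; first by apply/andP; split; lra.
    rewrite /polar cos_pihalf sin_pihalf mulr0 mulr1 expr0n /= add0r.
    by rewrite sqrtr_sqr ger0_norm.
  exists (- (pi / 2)); split; first by apply/andP; split; lra.
  rewrite /polar cosN sinN cos_pihalf sin_pihalf mulr0 mulrN1 expr0n /= add0r.
  by rewrite sqrtr_sqr ltr0_norm// opprK.
Qed.

(** For [xi] on the circle [conjc xi * xi = 1], so the defining modulus is the distance from [z] to
    [xi]. *)
Lemma stolz_polarE M z t : stolz M (polar 1 t) z <->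
  normc z < 1 /\ normc (z - polar 1 t) < M * (1 - normc z ^+ 2).
Proof.
have -> : normc (z - polar 1 t) = normc (1 - conjc (polar 1 t) * z).
  have -> : 1 - conjc (polar 1 t) * z = - (conjc (polar 1 t) * (z - polar 1 t)).
    have E : conjc (polar 1 t) * polar 1 t = 1.
      apply/eqP; rewrite eq_complex /= !mul1r mulNr opprK -!expr2 cos2Dsin2 eqxx /=.
      by apply/eqP; ring.
    by rewrite mulrBr E opprB.
  rewrite normc_opp normcM; have -> : normc (conjc (polar 1 t)) = 1.
    by rewrite /polar /= !mul1r sqrrN cos2Dsin2 sqrtr1.
  by rewrite mul1r.
by split.
Qed.

(** Once the boundary point is rotated to 1, the real part is at least [1 / 2], and the angle is at
    most the ratio of imaginary to real part, hence at most [2 e]. *)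
Lemma near_boundary_angle z t (e : R) : normc z < 1 -> normc (z - polar 1 t) <= e -> e <= 1 / 2 ->
  exists2 s, `|s - t| <= 2 * e & z = polar (normc z) s.
Proof.
move=> z1 ze e2; pose u := z * polar 1 (- t).
have zE : z = u * polar 1 t.
  by rewrite /u -mulrA -polarD mulr1 addNr /polar cos0 sin0 mulr0 !mulr1.
have n1 s : normc (polar (1 : R) s) = 1 by rewrite normc_polar normr1.
have uE : normc (u - 1) <= e.
  suff <- : normc (z - polar 1 t) = normc (u - 1) by [].
  have -> : z - polar 1 t = (u - 1) * polar 1 t by rewrite mulrBl mul1r -zE.
  by rewrite normcM n1 mulr1.
have h1 : `|Re u - 1| <= e by have := normr_Re_le (u - 1); rewrite complex_ReB => /le_trans; apply.
have h2 : `|Im u| <= e.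
  by have := normr_Im_le (u - 1); rewrite complex_ImB subr0 => /le_trans; apply.
have u0 : 1 / 2 <= Re u by move: h1 e2; rewrite ler_norml => /andP[+ _]; clear; lra.
have up : 0 < Re u by apply: lt_le_trans u0.
have [s s1 [sE sL]] := polar_rightP up.
have nu : normc u = normc z by rewrite /u normcM n1 mulr1.
exists (s + t); last first.
  by rewrite {1}zE sE -polarD mulr1 nu.
rewrite addrK (le_trans sL)// normrM normfV (gtr0_norm up) ler_pdivrMr//.
apply: (le_trans h2); have e0 : 0 <= e by apply: le_trans h2.
by rewrite mulrAC -[leLHS]mul1r ler_wpM2r//; move: u0; clear; lra.
Qed.

End Preliminaries.

Section RadialBlocks.
Context {R : realType}.
Local Notation mR := (measurableTypeR R).
Local Notation mu := (@lebesgue_measure R).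
Implicit Types (x r t d c M : R) (k m n : nat) (z : R[i]) (G : R[i] -> R[i]).

(** The closed disc is covered by a square about the origin and by the image under [cexp] of a
    rectangle, so that [crect_bounded] applies twice. *)
Lemma disc_bounded G (s : R) : s < 1 -> (forall z, normc z < 1 -> holo G z) ->
  exists B, forall z, normc z <= s -> normc (G z) <= B.
Proof.
move=> s1 Gh.
have [|B1 HB1] := @crect_bounded R G (- (1 / 2)) (1 / 2) (- (1 / 2)) (1 / 2).
  move=> [a b] [/= /andP[a0 a1] /andP[b0 b1]]; apply/holo_ccont/Gh.
  rewrite /= -(@sqrtr1 R) ltr_sqrt; last exact: ltr01.
  by rewrite !expr2; nra.
pose s' := Num.max s (1 / 2).
have s'1 : s' < 1 by rewrite gt_max s1 /=; lra.
have s'2 : 1 / 2 <= s' by rewrite le_max lexx orbT.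
have s'0 : 0 < s' by apply: lt_le_trans s'2; lra.
have [|B2 HB2] := @crect_bounded R (G \o cexp) (ln (1 / 2)) (ln s') (- (pi / 2)) (3 * (pi / 2)).
  move=> z [/andP[_ z1] _]; apply: holo_ccont; apply: holo_comp; first exact: holo_cexp.
  apply: Gh; rewrite normc_cexp (@le_lt_trans _ _ s')//.
  by rewrite -[leRHS]lnK ?posrE// ler_expR.
exists (Num.max B1 B2) => z zs; rewrite le_max.
have [z2|z2] := leP (normc z) (1 / 2).
  apply/orP; left; apply: HB1.
  have := le_trans (normr_Re_le z) z2; have := le_trans (normr_Im_le z) z2.
  by rewrite !ler_norml => h1 h2; split.
apply/orP; right; have z0 : 0 < normc z by apply: lt_trans z2; lra.
have [t [t01 zE]] := polar_arc z.
have -> : G z = (G \o cexp) (ln (normc z) +i* t) by rewrite /= /cexp /= lnK ?posrE// -zE.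
have h2 : (0 : R) < 1 / 2 by lra.
apply: HB2; split => //=; rewrite !ler_ln ?posrE//.
by rewrite (ltW z2) le_max zs.
Qed.

(** The ring [2^-k / 2 < 1 - x <= 2^-k], enlarged to [2^-k / 16 <= 1 - x <= 2 * 2^-k] to contain the
    radial sides of the mean value rectangles and the squares used in the converse bound. *)
Definition rstar k : set R :=
  `[0, 1[%classic `&` `[1 - 2 / 2 ^+ k, 1 - (16 * 2 ^+ k)^-1]%classic.

Lemma measurable_rstar k : measurable (rstar k : set mR).
Proof. by apply: measurableI; exact: measurable_itv. Qed.

(** The factor [2 ^+ k] is comparable to the inverse length of [rstar k]: up to constants this is
    the radial average of [|G|^(1/2)]. *)
Definition radial_block G k t : R :=
  2 ^+ k * fine (\int[mu]_(x in rstar k) (Num.sqrt (dnormc G (polar x t)))%:E)%E.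

Section OneFunction.
Variable G : R[i] -> R[i].
Hypothesis Gh : forall z, normc z < 1 -> holo G z.
Local Notation N z := (Num.sqrt (dnormc G z)).
Local Notation blk := (radial_block G).

Lemma sqrt_dnormc_bounded k : exists2 B, 0 <= B & forall x t, rstar k x -> N (polar x t) <= B.
Proof.
have s1 : 1 - (16 * 2 ^+ k)^-1 < 1 :> R.
  by rewrite gtrBl invr_gt0 mulr_gt0 ?ltr0n// exprn_gt0.
have [B HB] := disc_bounded s1 Gh; exists (Num.sqrt B) => [|x t]; first exact: sqrtr_ge0.
rewrite /rstar /= !in_itv /= => -[/andP[x0 x1] /andP[_ x2]].
have nx : normc (polar x t) = x by rewrite normc_polar ger0_norm.
rewrite dnormcE ?nx//; apply: ler_wsqrtr; apply: HB; by rewrite nx.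
Qed.

Lemma radial_integral_bounded k : exists2 B, 0 <= B &
  forall t, (0 <= \int[mu]_(x in rstar k) (N (polar x t))%:E <= B%:E)%E.
Proof.
have [B B0 HB] := sqrt_dnormc_bounded k; exists B => // t; apply/andP; split.
  by apply: integral_ge0 => x _; rewrite lee_fin sqrtr_ge0.
apply: (@le_trans _ _ (\int[mu]_(x in `[0%R, 1%R[) B%:E)%E).
  apply: le_integral_ge0.
  - by move=> x _; rewrite lee_fin sqrtr_ge0.
  - by move=> x _; rewrite lee_fin.
  - by move=> x xk _; split; [case: xk|rewrite lee_fin HB].
by rewrite integral_cst//= lebesgue_measure_itv /= lte01 oppr0 adde0 mule1.
Qed.

Lemma radial_blockE k t :
  (blk k t)%:E = ((2 ^+ k)%:E * \int[mu]_(x in rstar k) (N (polar x t))%:E)%E.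
Proof.
have [B B0 HB] := radial_integral_bounded k; have /andP[h0 h1] := HB t.
by rewrite EFinM fineK// ge0_fin_numE// (le_lt_trans h1) ?ltry.
Qed.

Lemma radial_block_bounded k : exists B, forall t, 0 <= blk k t <= B.
Proof.
have [B B0 HB] := radial_integral_bounded k; exists (2 ^+ k * B) => t.
have /andP[h0 h1] := HB t; rewrite -!lee_fin radial_blockE EFinM.
by rewrite mule_ge0 ?lee_fin ?exprn_ge0//= lee_wpmul2l// lee_fin exprn_ge0.
Qed.

Lemma radial_block_ge0 k t : 0 <= blk k t.
Proof. by have [B /(_ t) /andP[]] := radial_block_bounded k. Qed.

Lemma measurable_radial_block k : measurable_fun (setT : set mR) (blk k : mR -> mR).
Proof.
apply/measurable_EFinP; rewrite (_ : _ \o _ =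
   fun t => (2 ^+ k)%:E * \int[mu]_(x in rstar k) (N (polar x t))%:E)%E; last first.
  by apply/funext => t; rewrite /= radial_blockE.
apply: measurable_funeM.
apply: (@measurable_fun_integral_slice R (fun w => (N (polar w.1 w.2))%:E)).
- exact: measurable_rstar.
- apply/measurable_EFinP; apply: (@measurable_polar R (fun z => N z)).
  by apply: measurable_plane_sqrt; exact: measurable_dnormc.
- by move=> w; rewrite lee_fin sqrtr_ge0.
Qed.

Lemma radial_block_periodic k t : blk k (t + 2 * pi) = blk k t.
Proof. by rewrite /radial_block; under eq_integral do rewrite polarD2pi. Qed.

Lemma integral_window_fin c m (b : nat -> R -> R) k t B : (forall t, 0 <= b k t <= B) ->
  (\int[mu]_(x in window c m k t) (b k x)%:E)%E \is a fin_num.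
Proof.
move=> bB; have b0 x : 0 <= b k x by case/andP: (bB x).
have [i H] : exists i : interval R, window c m k t = [set` i] /\ (mu [set` i] < +oo)%E.
  rewrite /window; case: ifP => _; eexists; (split; first by []).
    by rewrite lebesgue_measure_itv /=; case: ifP => _; rewrite ?ltry// -EFinB ltry.
  by rewrite lebesgue_measure_itv /=; case: ifP => _; rewrite ?ltry// -EFinB ltry.
case: H => -> fi.
rewrite ge0_fin_numE; last by apply: integral_ge0 => x _; rewrite lee_fin.
apply: (@le_lt_trans _ _ (\int[mu]_(x in [set` i]) B%:E)%E).
  apply: le_integral_ge0 => x; rewrite ?lee_fin//.
    by move=> _; case/andP: (bB x) => /le_trans; apply.
  by move=> xI _; split => //; case/andP: (bB x).
rewrite integral_cst//=; have mi0 := measure_ge0 mu [set` i].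
have fin : mu [set` i] \is a fin_num by rewrite ge0_fin_numE.
by rewrite -(fineK fin) -EFinM ltry.
Qed.

(** One factor [2 ^+ k] normalises the radial integral, the other the angular one; [d] is thereby
    measured in units of [2^-k]. *)
Lemma polar_block_estimate c m k theta r t d : 1 / 2 <= r -> 0 < d <= 1 / 4 -> r + 2 * d < 1 ->
  `[r - 2 * d, r + 2 * d]%classic `<=` rstar k ->
  `[t - d, t + d]%classic `<=` window c m k theta ->
  N (polar r t) * (2 ^+ k * d) ^+ 2 <= 4 * (32 * 192) * movavg c m blk k theta.
Proof.
move=> r2 d01 rd sr sw; have := polar_mean_value t Gh r2 d01 rd.
have [B HB] := radial_block_bounded k.
have wfin := integral_window_fin c m theta HB.
have k0 : (0 : R) < 2 ^+ k by rewrite exprn_gt0.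
have [K [KE K0]] : exists K : R, K = 4 * (32 * 192) /\ 0 <= K.
  by eexists; split; [exact: erefl|rewrite !mulr_ge0 ?ler0n].
rewrite -KE => H.
have Hin : ((2 ^+ k)%:E * (\int[mu]_(y in `[(t - d)%R, (t + d)%R])
     \int[mu]_(x in `[(r - 2 * d)%R, (r + 2 * d)%R]) (N (polar x y))%:E) <=
     \int[mu]_(y in window c m k theta) (blk k y)%:E)%E.
  pose I y := (\int[mu]_(x in `[(r - 2 * d)%R, (r + 2 * d)%R]) (N (polar x y))%:E)%E.
  have I0 y : (0 <= I y)%E by apply: integral_ge0 => x _; rewrite lee_fin sqrtr_ge0.
  have mI : measurable_fun (setT : set mR) (I : mR -> \bar R).
    apply: (@measurable_fun_integral_slice R (fun w => (N (polar w.1 w.2))%:E)) => //.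
      apply/measurable_EFinP; apply: (@measurable_polar R (fun z => N z)).
      by apply: measurable_plane_sqrt; exact: measurable_dnormc.
  have k0E : (0 <= (2 ^+ k)%:E :> \bar R)%E by rewrite lee_fin ltW.
  rewrite -(ge0_integralZl mu (measurable_itv _) (measurable_funTS mI) (fun y _ => I0 y) k0E).
  apply: le_integral_ge0.
  - by move=> y _; exact: mule_ge0.
  - by move=> y _; rewrite lee_fin radial_block_ge0.
  move=> y yI _; split; first exact: sw.
  rewrite radial_blockE; apply: lee_wpmul2l; first by rewrite lee_fin ltW.
  apply: le_integral_ge0.
  - by move=> x _; rewrite lee_fin sqrtr_ge0.
  - by move=> x _; rewrite lee_fin sqrtr_ge0.
  - by move=> x xI _; split; [exact: sr|exact: lexx].
have H2 : ((2 ^+ k * (N (polar r t) * d ^+ 2))%:E <=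
    K%:E * \int[mu]_(y in window c m k theta) (blk k y)%:E)%E.
  rewrite EFinM; have k0E : (0 <= (2 ^+ k)%:E :> \bar R)%E by rewrite lee_fin ltW.
  apply: (le_trans (lee_wpmul2l k0E H)).
  by rewrite muleCA; apply: lee_wpmul2l => //; rewrite lee_fin.
move: H2; rewrite -[X in (_ <= _ * X)%E](fineK wfin) -EFinM lee_fin /movavg => H2.
move: (ler_wpM2l (ltW k0) H2); rewrite [X in _ <= X]mulrCA => {}H2; apply: le_trans H2.
by rewrite le_eqVlt; apply/orP; left; apply/eqP; ring.
Qed.

End OneFunction.

(** Three regimes. At level 0 the logarithmic coordinate degenerates at the origin, so [G] is
    bounded on an annulus and the maximum principle does the rest. At levels up to [m] the window is
    a full turn. Beyond [m] the angle of [z] is within [4 M 2^-k] of [theta]. *)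
Lemma stolz_block_estimate M : 0 < M -> exists c m (C : R),
  [/\ 0 < c, c <= pi * 2 ^+ m, 0 < C & forall G theta z k,
    (forall z, normc z < 1 -> holo G z) -> 0 <= theta <= 2 * pi ->
    stolz M (polar 1 theta) z -> 2 ^- k / 2 < 1 - normc z <= 2 ^- k ->
    Num.sqrt (dnormc G z) <= C * movavg c m (radial_block G) k theta].
Proof.
(* In the Stolz region [|z - xi| <= 2 M 2^-k], so the angles differ by at most [4 M 2^-k]; the added
   1 makes room for the rectangle. With [c <= 2 ^+ m], levels [k > m] satisfy [2 M 2^-k <= 1 / 2],
   as [near_boundary_angle] requires. *)
move=> M0; pose c := 4 * M + 1; pose m := (Num.truncn c).+1.
have c0 : 0 < c by rewrite /c; lra.
have cm : c <= 2 ^+ m.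
  rewrite (@le_trans _ _ m%:R)//; first exact/ltW/Num.Theory.truncnS_gt.
  by rewrite -natrX ler_nat ltnW// ltn_expl.
have pi2 := pi_ge2 R.
have [K [KE K0]] : exists K : R, K = 4 * (32 * 192) /\ 0 < K.
  by eexists; split; [exact: erefl|rewrite !mulr_gt0 ?ltr0n].
(* Rectangles with [d = 2^-k / 8] cost [8^2 = 64]; the annulus at level 0, with [d = 1 / 16], costs
   [16^2], doubled by the maximum principle. *)
exists c, m, (512 * K); split; first exact: c0.
- by apply: (le_trans cm); rewrite ler_peMl ?exprn_ge0//; move: pi2; clear; lra.
- by apply: mulr_gt0; [rewrite ltr0n|exact: K0].
move=> G theta z k Gh th /stolz_polarE[z1 zM] /andP[zk1 zk2].
have est := @polar_block_estimate G Gh; rewrite -KE in est.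
have mv0 : 0 <= movavg c m (radial_block G) k theta.
  by rewrite mulr_ge0 ?exprn_ge0// fine_ge0// integral_ge0// => x _; rewrite lee_fin radial_block_ge0.
have [k0|k0] := posnP k.
  rewrite k0 expr0 invr1 in zk1 mv0 *.
  pose A := 256 * K * movavg c m (radial_block G) 0 theta.
  have A0 : 0 <= A by apply: mulr_ge0 mv0; apply: mulr_ge0; [exact: ler0n|exact: ltW].
  have NA w : 1 / 2 < normc w < 3 / 4 -> normc (G w) <= A ^+ 2.
    move=> /andP[w2 w4]; have w1 : normc w < 1 by move: w4; clear; lra.
    have [t [/andP[t0 t1] wE]] := polar_arc w.
    have := @est c m 0 theta (normc w) t (1 / 16) (ltW w2).
    rewrite -wE expr0 mul1r => H.
    have {}H : Num.sqrt (dnormc G w) * (1 / 16) ^+ 2 <= K * movavg c m (radial_block G) 0 theta.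
      apply: H; [by apply/andP; split; lra|by move: w4; clear; lra| |].
        move=> x; rewrite /rstar /= !in_itv /= expr0 => /andP[x0 x1].
        by split; apply/andP; split; move: w2 w4 x0 x1; clear; lra.
      move=> x; rewrite /window leq0n /= !in_itv /= => /andP[x0 x1].
      by apply/andP; split; move: pi2 t0 t1 x0 x1; clear; lra.
    have {}H : Num.sqrt (dnormc G w) <= A.
      have -> : Num.sqrt (dnormc G w) = 256 * (Num.sqrt (dnormc G w) * (1 / 16) ^+ 2) by field.
      by rewrite /A -mulrA ler_wpM2l ?ler0n.
    rewrite -[leLHS](@sqr_sqrtr _ (normc (G w))) ?normc_ge0//.
    rewrite -(dnormcE G w1) !expr2; apply: ler_pM => //; exact: sqrtr_ge0.
  have z2 : normc z <= 1 / 2 by move: zk1; clear; lra.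
  have r01 : ((0 : R) < 1 / 2) && ((1 / 2 : R) < 3 / 4) by lra.
  have r11 : 3 / 4 < 1 :> R by lra.
  have := weak_maximum_principle r01 r11 Gh NA z2 => H.
  apply: (@le_trans _ _ (2 * A)).
    rewrite dnormcE// -[leRHS]ger0_norm; last by rewrite mulr_ge0.
    rewrite -sqrtr_sqr; apply: ler_wsqrtr; apply: (le_trans H).
    have HA (a : R) : 2 * a ^+ 2 <= (2 * a) ^+ 2 by have := sqr_ge0 a; rewrite !expr2; nra.
    exact: HA.
  by rewrite /A mulrA mulrA -natrM; exact: lexx.
have u0 : (0 : R) < 2 ^- k by rewrite invr_gt0 exprn_gt0.
have u1 : 2 ^- k <= 1 / 2 :> R.
  rewrite div1r lef_pV2 ?posrE ?exprn_gt0//.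
  by rewrite -[leLHS]expr1 ler_weXn2l ?ler1n.
have z2 : 1 / 2 <= normc z by move: zk2 u1; clear; lra.
pose d := 2 ^- k / 8 : R.
have kd : 2 ^+ k * d = 1 / 8 by rewrite /d mulrA divff ?expf_neq0// .
have d01 : 0 < d <= 1 / 4 by rewrite /d; apply/andP; split; move: u0 u1; clear; lra.
have rd : normc z + 2 * d < 1 by rewrite /d; move: u0 zk1; clear; lra.
have sr : `[normc z - 2 * d, normc z + 2 * d]%classic `<=` rstar k.
  have -> : (rstar k = `[0, 1[%classic `&` `[1 - 2 * 2 ^- k, 1 - 2 ^- k / 16]%classic).
    by rewrite /rstar invfM [_^-1 * _]mulrC.
  move=> x; rewrite /= !in_itv /= /d => /andP[x0 x1].
  by split; apply/andP; split; move: u0 u1 x0 x1 z2 zk1 zk2 rd; rewrite /d; clear; lra.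
have fin t : z = polar (normc z) t -> `[t - d, t + d]%classic `<=` window c m k theta ->
    Num.sqrt (dnormc G z) <= 512 * K * movavg c m (radial_block G) k theta.
  move=> zE sw; have := est c m k theta (normc z) t d z2 d01 rd sr sw.
  rewrite -zE kd => H.
  have -> : Num.sqrt (dnormc G z) = 64 * (Num.sqrt (dnormc G z) * (1 / 8) ^+ 2) by field.
  rewrite -[leRHS]mulrA; apply: ler_pM; [exact: ler0n| |by rewrite ler_nat|exact: H].
  by apply: mulr_ge0; [exact: sqrtr_ge0|exact: sqr_ge0].
have [km|mk] := leqP k m.
  have [t [/andP[t0 t1] zE]] := polar_arc z; apply: (fin _ zE).
  move=> x; rewrite /window km /= !in_itv /= /d => /andP[x0 x1].
  by apply/andP; split; move: pi2 t0 t1 x0 x1 u0 u1; clear; lra.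
have ze : normc (z - polar 1 theta) <= 2 * M * 2 ^- k.
  apply: (le_trans (ltW zM)); rewrite [2 * M]mulrC -mulrA ler_wpM2l ?(ltW M0)//.
  by have n0 := normc_ge0 z; rewrite expr2; nra.
have cu : c * 2 ^- k <= 1.
  rewrite ler_pdivrMr ?exprn_gt0// mul1r (le_trans cm)//.
  by rewrite ler_weXn2l ?ler1n// ltnW.
have e2 : 2 * M * 2 ^- k <= 1 / 2.
  by move: cu u0; rewrite /c mulrDl; clear; lra.
have [s st zE] := near_boundary_angle z1 ze e2; apply: (fin _ zE).
move=> x; rewrite /window leqNgt mk /= !in_itv /= => /andP[x0 x1].
have -> : c / 2 ^+ k = 2 * (2 * M * 2 ^- k) + 2 ^- k by rewrite /c; ring.
move: st x0 x1 u0; rewrite ler_norml /d => /andP[].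
move: (2 * (2 * M * 2 ^- k)) (2 ^- k) => a b; clear.
by move=> *; apply/andP; split; lra.
Qed.

End RadialBlocks.

(** * The tent norm is bounded by the radial norm *)

Section TentLeRadial.
Context {R : realType}.
Local Notation mR := (measurableTypeR R).
Local Notation mu := (@lebesgue_measure R).
Local Notation mu2 := (mu \x mu)%E.
Implicit Types (x r t d c M : R) (k m n kappa : nat) (z : R[i]) (G h : R[i] -> R[i]).

Lemma dyadic_level (y : R) : 0 < y <= 1 -> exists k, 2 ^- k / 2 < y <= 2 ^- k.
Proof.
move=> /andP[y0 y1]; have E : exists n, 2 ^- n < y.
  exists (Num.truncn y^-1).+1; rewrite -[ltRHS]invrK ltf_pV2 ?posrE ?exprn_gt0 ?invr_gt0//.
  rewrite (@lt_le_trans _ _ (Num.truncn y^-1).+1%:R)//; first exact: Num.Theory.truncnS_gt.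
  by rewrite -natrX ler_nat ltnW// ltn_expl.
have [[|k] ky kmin] := ex_minnP E.
  by exists 0%N; move: ky; rewrite expr0 invr1; lra.
exists k; rewrite -invfM -exprSr ky /= leNgt; apply/negP => /kmin.
by rewrite ltnn.
Qed.

Lemma measure_box (w : R * R) d : 0 <= d -> mu2 (box w d) = ((2 * d) ^+ 2)%:E.
Proof.
move=> d0.
have -> : box w d = ball w.1 d `*` ball w.2 d.
  by apply/seteqP; split => -[x y]; rewrite /box /ball /= ![`|_ - x|]distrC ![`|_ - y|]distrC.
have mb (x : R) : measurable (ball x d : set mR) by rewrite ball_itv; exact: measurable_itv.
have mE (x : R) : mu (ball x d) = (2 * d)%:E.
  rewrite ball_itv lebesgue_measure_itv /= lte_fin.
  case: ltP => h; first by rewrite -EFinB; congr (_%:E); ring.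
  by congr (_%:E); lra.
transitivity (mu (ball w.1 d) * mu (ball w.2 d))%E; first exact: product_measure1E.
by rewrite !mE -EFinM expr2.
Qed.

(** Moves the power inside the limit of partial sums, Stein's inequality being available for finite
    sums. If the limit is finite, [v]-th roots bound all partial sums; otherwise the right side is
    infinite. *)
Lemma poweR_le_limit (x : \bar R) (K v : R) (s : nat -> R) : 0 < K -> 0 < v ->
  (forall k, 0 <= s k) -> (0 <= x)%E -> (x <= K%:E * \sum_(k <oo) (s k)%:E)%E ->
  (x `^ v <= (K `^ v)%:E * limn (fun n => ((\sum_(k < n) s k) `^ v)%:E))%E.
Proof.
move=> K0 v0 s0 x0 xK.
pose u n := ((\sum_(k < n) s k) `^ v)%:E.
have S0 n : 0 <= \sum_(k < n) s k by exact: sumr_ge0.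
have und : nondecreasing_seq u.
  apply/nondecreasing_seqP => n; rewrite lee_fin; apply: ge0_ler_powR; rewrite ?nnegrE// ?(ltW v0)//.
  by rewrite big_ord_recr /= lerDl.
have ucv := ereal_nondecreasing_cvgn und.
have uL n : (u n <= limn u)%E.
  by rewrite (cvg_lim _ ucv)//; apply: ereal_sup_ubound; exists n.
change (x `^ v <= (K `^ v)%:E * limn u)%E.
move: uL; move: (limn u) => L uL.
have L0 : (0 <= L)%E by apply: le_trans (uL 0%N); rewrite lee_fin powR_ge0.
have Kv0 : 0 < K `^ v by rewrite powR_gt0.
case: L L0 uL => [r r0 uL|_ _|//]; last by rewrite gt0_muley ?leey// lte_fin.
rewrite lee_fin in r0.
have Sr n : \sum_(k < n) s k <= r `^ v^-1.
  rewrite -[leLHS]powRr1// -(@divff _ v) ?gt_eqF// powRrM.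
  by apply: ge0_ler_powR; rewrite ?nnegrE ?powR_ge0 ?invr_ge0 ?(ltW v0)//; have := uL n; rewrite lee_fin.
have xr : (x <= (K * r `^ v^-1)%:E)%E.
  apply: (le_trans xK); rewrite EFinM; apply: lee_wpmul2l; first by rewrite lee_fin ltW.
  apply: lime_le; first by apply: is_cvg_nneseries => n _ _; rewrite lee_fin.
  by near=> n; rewrite big_mkord sumEFin lee_fin.
case: x x0 {xK} xr => [y y0 yr|_|//]; last by rewrite leye_eq.
rewrite poweR_EFin -EFinM lee_fin; rewrite lee_fin in y0 yr.
apply: (@le_trans _ _ ((K * r `^ v^-1) `^ v)).
  by apply: ge0_ler_powR; rewrite ?nnegrE ?mulr_ge0 ?powR_ge0 ?(ltW K0) ?(ltW v0).
rewrite powRM ?powR_ge0 ?(ltW K0)// -powRrM mulVf ?gt_eqF//.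
by rewrite powRr1.
Unshelve. all: by end_near.
Qed.

Lemma movavg_scale c m (a b : nat -> R -> R) (lam B : R) k t : 0 <= lam ->
  measurable_fun (setT : set mR) (a k : mR -> mR) -> (forall t, 0 <= a k t <= B) ->
  (forall t, b k t = lam * a k t) -> movavg c m b k t = lam * movavg c m a k t.
Proof.
move=> l0 ma aB bE; rewrite /movavg mulrCA; congr (_ * _).
have wfin := integral_window_fin c m t aB.
have -> : (\int[mu]_(x in window c m k t) (b k x)%:E =
    lam%:E * \int[mu]_(x in window c m k t) (a k x)%:E)%E.
  rewrite -ge0_integralZl//; first by apply: eq_integral => x _; rewrite bE EFinM.
  - by rewrite /window; case: ifP => _; exact: measurable_itv.
  - by apply: measurable_funTS; exact/measurable_EFinP.
  - by move=> x _; rewrite lee_fin; case/andP: (aB x).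
by rewrite fineM.
Qed.

Lemma rstar_measure k : exists2 l, mu (rstar k) = l%:E & 2 ^- k / 2 <= l <= 2 * 2 ^- k.
Proof.
have u0 : (0 : R) < 2 ^- k by rewrite invr_gt0 exprn_gt0.
have u1 : 2 ^- k <= 1 :> R by rewrite invf_le1 ?exprn_gt0// exprn_ege1// ler1n.
have E : rstar k = `[0, 1[%classic `&` `[1 - 2 * 2 ^- k, 1 - 2 ^- k / 16]%classic :> set R.
  by rewrite /rstar invfM [_^-1 * _]mulrC.
have up : (mu (rstar k) <= (2 * 2 ^- k)%:E)%E.
  apply: (@le_trans _ _ (mu `[1 - 2 * 2 ^- k, 1 - 2 ^- k / 16]%classic)).
    by apply: le_measure; rewrite ?inE; [exact: measurable_rstar|exact: measurable_itv|rewrite E; exact: subIsetr].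
  rewrite lebesgue_measure_itv /= lte_fin; case: ifP => _; rewrite -?EFinB lee_fin; move: u0; clear; lra.
have lo : ((2 ^- k / 2)%:E <= mu (rstar k))%E.
  apply: (@le_trans _ _ (mu `[1 - 2 ^- k, 1 - 2 ^- k / 2]%classic)).
    rewrite lebesgue_measure_itv /= lte_fin; case: ltP => h; rewrite -?EFinB lee_fin; move: h u0; clear; lra.
  apply: le_measure; rewrite ?inE; [exact: measurable_itv|exact: measurable_rstar|].
  rewrite E => x; rewrite /= !in_itv /= => /andP[x0 x1].
  by split; apply/andP; split; move: u0 u1 x0 x1; clear; lra.
have fin : mu (rstar k) \is a fin_num.
  by rewrite ge0_fin_numE ?measure_ge0// (le_lt_trans up) ?ltry.
exists (fine (mu (rstar k))); first by rewrite fineK.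
by rewrite -!lee_fin fineK// lo up.
Qed.

(** Membership forces [(1 - x) / 2 <= 2^-k <= 16 (1 - x)]. Charging each such level
    [2 * 2^-k / (1 - x) >= 1] and summing the geometric series gives [2 * 2 * 16]. *)
Lemma rstar_count x n : 0 <= x < 1 -> \sum_(k < n) \1_(rstar k) x <= 64 :> R.
Proof.
move=> /andP[x0 x1]; have y0 : 0 < 1 - x by lra.
apply: (@le_trans _ _ (\sum_(k < n) 2 / (1 - x) * (if 2 ^- k <= 16 * (1 - x) then 2 ^- k else 0))).
  apply: ler_sum => k _; rewrite indicE; case: ifPn => h.
    have [|_] := boolP (x \in _); last by rewrite mulr_ge0 ?invr_ge0 ?exprn_ge0 ?divr_ge0 ?(ltW y0).
    rewrite inE /rstar /= !in_itv /= => -[_ /andP[h1 _]].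
    by rewrite mulrAC ler_pdivlMr// mul1r; move: h1; lra.
  rewrite mulr0; case: (boolP (x \in _)) => //; rewrite inE /rstar /= !in_itv /= => -[_ /andP[_ h1]].
  exfalso; move: h; rewrite -ltNge; move: h1; rewrite invfM [_^-1 * _]mulrC; lra.
rewrite -mulr_sumr; apply: (@le_trans _ _ (2 / (1 - x) * (2 * (16 * (1 - x))))).
  apply: ler_wpM2l; first by rewrite divr_ge0 ?(ltW y0).
  by apply: geometric_cutoff_sum; rewrite mulr_ge0 ?(ltW y0).
by rewrite le_eqVlt; apply/orP; left; apply/eqP; field; rewrite gt_eqF.
Qed.

Lemma sqrt_powR (x p : R) : 0 <= x -> Num.sqrt x `^ (2 * p) = x `^ p.
Proof.
move=> x0; rewrite -(powR12_sqrt x0) -powRrM; congr (_ `^ _).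
by rewrite mulrA mulVf ?mul1r// pnatr_eq0.
Qed.

Definition radial_power (p : R) h t : \bar R :=
  (\int[mu]_(x in `[0%R, 1%R[) (normc (h (polar x t)) `^ p)%:E)%E.

(** Treats both assertions at once: [kappa = 0] with [G = h = f], and [kappa = 1] with [G] the
    derivative and [h] its weighted version. *)
Definition weight_of kappa G h := forall z, normc z < 1 ->
  normc (h z) = normc (G z) * (1 - normc z) ^+ kappa.

(** Its power [2 p] is the length scale [2^-k] of the ring times the [p]-th power of the weight
    there, so that weighted blocks sum to a radial integral of [|h|^p]. *)
Definition block_weight (p : R) kappa k : R :=
  (2 ^- k * (2 ^- k ^+ kappa) `^ p) `^ (2 * p)^-1.

Lemma block_weight_powR (p : R) kappa k : 0 < p ->
  block_weight p kappa k `^ (2 * p) = 2 ^- k * (2 ^- k ^+ kappa) `^ p.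
Proof.
move=> p0; rewrite /block_weight -powRrM mulVf; last by rewrite mulf_neq0 ?pnatr_eq0// gt_eqF.
by rewrite powRr1// mulr_ge0 ?powR_ge0// invr_ge0 exprn_ge0.
Qed.

Definition weighted_block (p : R) kappa G k t : R :=
  block_weight p kappa k * radial_block G k t.

Lemma measurable_weighted_radial (p : R) kappa G h t : (forall z, normc z < 1 -> holo G z) ->
  weight_of kappa G h ->
  measurable_fun (`[0%R, 1%R[ : set mR) ((fun x => normc (h (polar x t)) `^ p) : mR -> mR).
Proof.
move=> Gh hE.
pose u z := dnormc G z * (1 - normc z) ^+ kappa.
have E x : `[0%R, 1%R[%classic x -> normc (h (polar x t)) `^ p = u (polar x t) `^ p.
  rewrite /= in_itv /= => /andP[x0 x1]; have nx : normc (polar x t) < 1 by rewrite normc_polar ger0_norm.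
  by rewrite /u dnormcE// hE.
apply: (@eq_measurable_fun _ _ _ _ _ (fun x => u (polar x t) `^ p)).
  by move=> x /set_mem xI; rewrite E.
apply: measurable_funTS; apply: (measurableT_comp (measurable_powR p)).
apply: measurable_funM.
  have mp := measurable_polar (measurable_dnormc Gh).
  pose f : mR -> mR * mR := fun x => (x, t).
  have mf : measurable_fun (setT : set mR) f by apply: measurable_fun_pair.
  by have := measurableT_comp mp mf.
apply: measurable_funX; apply: measurable_funB => //.
have -> : (fun x => normc (polar x t)) = Num.norm by apply/funext => x; rewrite normc_polar.
exact: normr_measurable.
Qed.

(** Jensen with exponent [2 p > 1] on each ring turns the average of [|G|^(1/2)] into the integral
    of [|G|^p]. On [rstar k] one has [2^-k <= 16 (1 - x)], whence the power of 16; the factor 64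
    counts overlaps. *)
Lemma block_sum_le (p : R) kappa G h t n : 1 <= p -> (forall z, normc z < 1 -> holo G z) ->
  weight_of kappa G h ->
  ((\sum_(k < n) weighted_block p kappa G k t `^ (2 * p))%:E <=
   (64 * (2 * 2 `^ (2 * p) * (16 ^+ kappa) `^ p))%:E * radial_power p h t)%E.
Proof.
move=> p1 Gh hE; have p0 : 0 < p by exact: lt_le_trans p1.
have P1 : 1 < 2 * p by move: p1; clear; lra.
pose N z := Num.sqrt (dnormc G z).
have [c [cE c0]] : exists c : R, c = 2 * 2 `^ (2 * p) * (16 ^+ kappa) `^ p /\ 0 <= c.
  eexists; split; first exact: erefl.
  by rewrite mulr_ge0 ?powR_ge0// mulr_ge0 ?ler0n ?powR_ge0.
rewrite -cE.
have mh := measurable_weighted_radial p t Gh hE.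
have mr k : measurable (rstar k : set mR) by exact: measurable_rstar.
have rI k x : rstar k x -> 0 <= x < 1 by rewrite /rstar /= !in_itv /= => -[].
have one k : ((weighted_block p kappa G k t `^ (2 * p))%:E <=
    c%:E * \int[mu]_(x in rstar k) (normc (h (polar x t)) `^ p)%:E)%E.
  have [l lE /andP[l1 l2]] := rstar_measure k.
  have u0 : (0 : R) < 2 ^- k by rewrite invr_gt0 exprn_gt0.
  have l0 : 0 < l by apply: lt_le_trans l1; rewrite divr_gt0.
  have a0 := radial_block_ge0 Gh k t.
  pose I := 2 ^- k * radial_block G k t.
  have I0 : 0 <= I by rewrite mulr_ge0// ltW.
  have IE : (I%:E <= \int[mu]_(x in rstar k) (N (polar x t))%:E)%E.
    rewrite /I EFinM radial_blockE// muleA -EFinM mulVf ?expf_neq0 ?pnatr_eq0// mul1e.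
    exact: lexx.
  have mN : measurable_fun (rstar k : set mR) ((fun x => N (polar x t)) : mR -> mR).
    apply: measurable_funTS.
    have mp := measurable_polar (measurable_plane_sqrt (measurable_dnormc Gh)).
    pose f : mR -> mR * mR := fun x => (x, t).
    have mf : measurable_fun (setT : set mR) f by apply: measurable_fun_pair.
    by have := measurableT_comp mp mf.
  have J := jensen_powR P1 l0 I0 (mr k) lE mN (fun x _ => sqrtr_ge0 _) IE.
  have a2 : radial_block G k t / 2 <= I / l.
    rewrite ler_pdivlMr// /I [leRHS]mulrC -mulrA; apply: ler_wpM2l => //.
    by move: l2; clear; lra.
  have lo : 2 ^- k / 2 * (radial_block G k t / 2) `^ (2 * p) <= (I / l) `^ (2 * p) * l.
    rewrite mulrC; apply: ler_pM => //; rewrite ?powR_ge0 ?divr_ge0 ?(ltW u0)//.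
    by apply: ge0_ler_powR; rewrite ?nnegrE ?divr_ge0 ?(ltW l0) ?(ltW (lt_trans _ P1)).
  have J2 := le_trans (_ : ((2 ^- k / 2 * (radial_block G k t / 2) `^ (2 * p))%:E <= _)%E) J.
  rewrite lee_fin in J2; have {}J2 := J2 lo.
  have -> : weighted_block p kappa G k t `^ (2 * p) =
      (2 * 2 `^ (2 * p)) * (2 ^- k ^+ kappa) `^ p * (2 ^- k / 2 * (radial_block G k t / 2) `^ (2 * p)).
    rewrite /weighted_block powRM ?powR_ge0// (block_weight_powR _ _ p0).
    have -> : radial_block G k t `^ (2 * p) = 2 `^ (2 * p) * (radial_block G k t / 2) `^ (2 * p).
      by rewrite -powRM ?divr_ge0 ?ler0n// mulrCA divff ?mulr1// pnatr_eq0.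
    have H (A B C D : R) : D * B * (A * C) = 2 * A * B * (D / 2 * C) by field.
    exact: H.
  rewrite EFinM.
  have w0 : 0 <= 2 * 2 `^ (2 * p) * (2 ^- k ^+ kappa) `^ p.
    by rewrite mulr_ge0 ?powR_ge0// mulr_ge0 ?ler0n ?powR_ge0.
  have w0E : (0 <= (2 * 2 `^ (2 * p) * (2 ^- k ^+ kappa) `^ p)%:E)%E by rewrite lee_fin.
  apply: (le_trans (lee_wpmul2l w0E J2)).
  have mNP : measurable_fun (rstar k : set mR) ((fun x => (N (polar x t) `^ (2 * p))%:E) : mR -> \bar R).
    by apply/measurable_EFinP; exact: (measurableT_comp (measurable_powR _) mN).
  have mhk : measurable_fun (rstar k : set mR) ((fun x => (normc (h (polar x t)) `^ p)%:E) : mR -> \bar R).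
    apply/measurable_EFinP; apply: measurable_funS mh => //.
    by move=> x /rI; rewrite /= in_itv.
  have c0E : (0 <= c%:E)%E by rewrite lee_fin.
  have NP0 x : (0 <= (N (polar x t) `^ (2 * p))%:E)%E by rewrite lee_fin powR_ge0.
  have hP0 x : (0 <= (normc (h (polar x t)) `^ p)%:E)%E by rewrite lee_fin powR_ge0.
  rewrite -(ge0_integralZl mu (mr k) mNP (fun x _ => NP0 x) w0E).
  rewrite -(ge0_integralZl mu (mr k) mhk (fun x _ => hP0 x) c0E).
  apply: le_integral_ge0.
  - by move=> x _; exact: mule_ge0.
  - by move=> x _; exact: mule_ge0.
  move=> x xk _; split; first exact: xk.
  rewrite -!EFinM lee_fin /N.
  have /andP[x0 x1] := rI _ _ xk.
  have nx : normc (polar x t) = x by rewrite normc_polar ger0_norm.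
  rewrite (sqrt_powR _ (dnormc_ge0 _ _)) dnormcE ?nx// hE ?nx//.
  have g0 := normc_ge0 (G (polar x t)).
  have y0 : 0 <= 1 - x by move: x1; clear; lra.
  rewrite (powRM _ g0 (exprn_ge0 _ y0)) cE -!mulrA.
  apply: ler_wpM2l; first exact: ler0n.
  apply: ler_wpM2l; first exact: powR_ge0.
  rewrite [X in _ <= _ * X]mulrC mulrA; apply: ler_wpM2r; first exact: powR_ge0.
  rewrite -powRM ?exprn_ge0// -exprMn.
  apply: ge0_ler_powR; rewrite ?nnegrE ?exprn_ge0 ?(ltW p0) ?(ltW u0) ?mulr_ge0//.
  apply: lerXn2r; rewrite ?nnegrE ?(ltW u0) ?mulr_ge0//.
  move: xk; rewrite /rstar /= !in_itv /= => -[_ /andP[_]].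
  by rewrite invfM; move: (2 ^- k) => a; clear; lra.
rewrite -sumEFin; apply: (@le_trans _ _ (\sum_(k < n) (c%:E * \int[mu]_(x in rstar k) (normc (h (polar x t)) `^ p)%:E))%E).
  by apply: lee_sum => k _; exact: one.
have hP0 x : (0 <= (normc (h (polar x t)) `^ p)%:E)%E by rewrite lee_fin powR_ge0.
have mhE := (measurable_EFinP _ _).2 mh.
pose f k x := ((\1_(rstar k) x)%:E * (normc (h (polar x t)) `^ p)%:E)%E.
have f0 k x : (0 <= f k x)%E by rewrite mule_ge0// lee_fin.
have mf k : measurable_fun (`[0%R, 1%R[ : set mR) (f k : mR -> \bar R).
  apply: emeasurable_funM => //.
  by apply/measurable_EFinP; apply: measurable_funTS; exact: measurable_indic.
have fE k : (\int[mu]_(x in rstar k) (normc (h (polar x t)) `^ p)%:E <= \int[mu]_(x in `[0%R, 1%R[) f k x)%E.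
  apply: le_integral_ge0 => // x xk _; split.
    by have := rI _ _ xk; rewrite /= in_itv.
  by rewrite /f indicE mem_set// mul1e.
have c0E : (0 <= c%:E)%E by rewrite lee_fin.
apply: (@le_trans _ _ (c%:E * \sum_(k < n) \int[mu]_(x in `[0%R, 1%R[) f k x)%E).
  rewrite ge0_sume_distrr; last by move=> k _; exact: integral_ge0.
  by apply: lee_sum => k _; apply: lee_wpmul2l.
rewrite mulrC EFinM -muleA; apply: lee_wpmul2l => //.
rewrite -(ge0_integral_sum mu (measurable_itv _) (fun k : 'I_n => mf k) (fun (k : 'I_n) x _ => f0 k x)).
have c64 : (0 <= 64%:E :> \bar R)%E by rewrite lee_fin ler0n.
rewrite /radial_power -(ge0_integralZl mu (measurable_itv _) mhE (fun x _ => hP0 x) c64).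
apply: le_integral_ge0.
- by move=> x _; apply: sume_ge0.
- by move=> x _; exact: (mule_ge0 c64 (hP0 x)).
move=> x xI _; split; first exact: xI.
rewrite /f -ge0_sume_distrl; last by move=> k _; rewrite lee_fin.
apply: lee_wpmul2r => //; rewrite sumEFin lee_fin; apply: rstar_count.
by move: xI; rewrite /= in_itv.
Qed.

End TentLeRadial.

Section TentLeRadial2.
Context {R : realType}.
Local Notation mR := (measurableTypeR R).
Local Notation mu := (@lebesgue_measure R).
Local Notation mu2 := (mu \x mu)%E.
Implicit Types (x r t d c M theta : R) (k m n kappa : nat) (z : R[i]) (G h : R[i] -> R[i]).

Definition tent_power M (p : R) h theta : \bar R :=
  area_integral (stolz M (polar 1 theta))
    (fun z => (normc (h z) `^ p / (1 - normc z ^+ 2) `^ (2 - 1))%:E).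

Lemma powR_weightE z : normc z < 1 -> (1 - normc z ^+ 2) `^ (2 - 1) = 1 - normc z ^+ 2.
Proof.
move=> z1; have -> : 2 - 1 = 1 :> R by ring.
by rewrite powRr1// subr_ge0 exprn_ile1 ?normc_ge0// ltW.
Qed.

Lemma tent_power_ge0 M (p : R) h theta : (0 <= tent_power M p h theta)%E.
Proof. by apply: integral_ge0 => w _; rewrite lee_fin divr_ge0 ?powR_ge0. Qed.

(** The level [k] part of the Stolz region lies in a square of side [4 M 2^-k] at the boundary
    point; there the integrand is at most a constant [e k], and constant times area gives the [k]-th
    term. *)
Lemma tent_power_le M (p c : R) m kappa (C : R) : 0 < M -> 1 <= p -> 0 <= C ->
  forall G h theta, (forall z, normc z < 1 -> holo G z) -> weight_of kappa G h ->
  (forall z k, stolz M (polar 1 theta) z -> 2 ^- k / 2 < 1 - normc z <= 2 ^- k ->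
    Num.sqrt (dnormc G z) <= C * movavg c m (radial_block G) k theta) ->
  (tent_power M p h theta <= (32 * M ^+ 2 * C `^ (2 * p))%:E *
     \sum_(k <oo) (movavg c m (weighted_block p kappa G) k theta `^ (2 * p))%:E)%E.
Proof.
move=> M0 p1 C0 G h theta Gh hE est; have p0 : 0 < p by exact: lt_le_trans p1.
pose a k := movavg c m (weighted_block p kappa G) k theta `^ (2 * p).
have a0 k : 0 <= a k by exact: powR_ge0.
change (tent_power M p h theta <= (32 * M ^+ 2 * C `^ (2 * p))%:E * \sum_(k <oo) (a k)%:E)%E.
have aE k : a k = 2 ^- k * (2 ^- k ^+ kappa) `^ p * movavg c m (radial_block G) k theta `^ (2 * p).
  have [B HB] := radial_block_bounded Gh k.
  rewrite /a (movavg_scale c m theta (powR_ge0 _ _) (measurable_radial_block Gh k) HB (fun t => erefl)).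
  by rewrite (powRM _ (powR_ge0 _ _))// ?block_weight_powR// mulr_ge0 ?exprn_ge0// fine_ge0// integral_ge0// => x _; rewrite lee_fin; case/andP: (HB x).
(* One [2 ^+ k], with the 2, bounds the inverse of [1 - |z|^2]; the other undoes the [2^-k]
   contained in [a k]. *)
pose e k := 2 * (2 ^+ k) ^+ 2 * C `^ (2 * p) * a k.
have e0 k : 0 <= e k by rewrite !mulr_ge0 ?ler0n ?powR_ge0 ?exprn_ge0.
pose bx k : set (mR * mR) := box (to_plane (polar 1 theta)) (2 * M * 2 ^- k).
have mbx k : measurable (bx k) by exact: measurable_box.
pose f k (w : mR * mR) := ((e k)%:E * (\1_(bx k) w)%:E)%E.
have f0 k w : (0 <= f k w)%E by rewrite mule_ge0 ?lee_fin.
have mf k : measurable_fun (setT : set (mR * mR)) (f k).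
  by apply: measurable_funeM; apply/measurable_EFinP; exact: measurable_indic.
have fi k : (\int[mu2]_w f k w = (32 * M ^+ 2 * C `^ (2 * p))%:E * (a k)%:E)%E.
  have mi : measurable_fun (setT : set (mR * mR)) ((fun w => (\1_(bx k) w)%:E) : mR * mR -> \bar R).
    by apply/measurable_EFinP; exact: measurable_indic.
  have i0 (w : mR * mR) : (0 <= (\1_(bx k) w : R)%:E)%E by rewrite lee_fin.
  have e0E : (0 <= (e k)%:E)%E by rewrite lee_fin.
  rewrite (ge0_integralZl mu2 measurableT mi (fun w _ => i0 w) e0E).
  have kE : 2 ^- k = (2 ^+ k)^-1 :> R by [].
  have kn : 2 ^+ k != 0 :> R by rewrite expf_neq0 ?pnatr_eq0.
  have -> : (\int[mu2]_w (\1_(bx k) w)%:E = ((2 * (2 * M * 2 ^- k)) ^+ 2)%:E)%E.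
    rewrite integral_indic// setIT; apply: measure_box.
    by rewrite !mulr_ge0 ?ler0n ?(ltW M0)// invr_ge0 exprn_ge0.
  rewrite -!EFinM; congr (_%:E); rewrite /e.
  by move: kn; move: (2 ^+ k) (C `^ _) (a k) => u A B un; field.
apply: (@le_trans _ _ (\int[mu2]_w (\sum_(k <oo) f k w))%E); last first.
  rewrite integral_nneseries//.
  under eq_eseriesr do rewrite fi.
  by rewrite nneseriesZl// => k _; rewrite lee_fin.
apply: le_integral_ge0.
- by move=> w _; rewrite lee_fin divr_ge0 ?powR_ge0.
- by move=> w _; apply: nneseries_ge0 => k _ _; exact: f0.
move=> w wS0 _; split; first exact: I.
have wS : stolz M (polar 1 theta) (of_plane w) by exact: wS0.
have z1 : normc (of_plane w) < 1 by case: wS.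
have n0 := normc_ge0 (of_plane w).
have [|k Hk] := @dyadic_level R (1 - normc (of_plane w)).
  by apply/andP; split; move: z1 n0; clear; lra.
apply: (@le_trans _ _ (f k w)); last first.
  apply: (@le_trans _ _ (\sum_(0 <= i < k.+1) f i w)%E).
    by rewrite big_nat_recr//= leeDr// sume_ge0.
  by apply: nneseries_lim_ge => i _ _; exact: f0.
have [_ zM] := (stolz_polarE _ _ _).1 wS.
have /andP[k1 k2] := Hk.
have u0 : (0 : R) < 2 ^- k by rewrite invr_gt0 exprn_gt0.
have wb : bx k w.
  have zb : normc (of_plane w - polar 1 theta) < 2 * M * 2 ^- k.
    apply: (lt_le_trans zM); rewrite [2 * M]mulrC -mulrA ler_wpM2l ?(ltW M0)//.
    by move: n0 z1 k2; rewrite expr2; clear; nra.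
  split; rewrite /to_plane /=.
    by have := normr_Re_le (of_plane w - polar 1 theta); rewrite complex_ReB => /le_lt_trans; apply.
  by have := normr_Im_le (of_plane w - polar 1 theta); rewrite complex_ImB => /le_lt_trans; apply.
rewrite /f indicE mem_set// mule1 lee_fin.
rewrite powR_weightE// /e aE.
have Nle := est _ _ wS Hk; move: (movavg _ _ _ _ _) Nle => v Nle.
have v0 : 0 <= C * v by apply: le_trans Nle; exact: sqrtr_ge0.
have hp : normc (h (of_plane w)) `^ p <= (2 ^- k ^+ kappa) `^ p * (C `^ (2 * p) * v `^ (2 * p)).
  have y0 : 0 <= 1 - normc (of_plane w) by move: z1; clear; lra.
  rewrite hE// (powRM _ (normc_ge0 _) (exprn_ge0 _ y0)) mulrC.
  apply: ler_pM; rewrite ?powR_ge0//.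
    apply: ge0_ler_powR; rewrite ?nnegrE ?exprn_ge0 ?(ltW p0) ?(ltW u0)//.
    by apply: lerXn2r; rewrite ?nnegrE ?(ltW u0).
  rewrite -(sqrt_powR _ (normc_ge0 _)) -(dnormcE G z1).
  have [C00|Cn] := eqVneq C 0.
    have s0 : Num.sqrt (dnormc G (of_plane w)) = 0.
      by apply/eqP; rewrite eq_le sqrtr_ge0 andbT (le_trans Nle)// C00 mul0r.
    by rewrite s0 powR0 ?mulr_ge0 ?powR_ge0// gt_eqF// mulr_gt0.
  have v0' : 0 <= v by move: v0; rewrite pmulr_rge0// lt_neqAle eq_sym Cn.
  rewrite -powRM//.
  by apply: ge0_ler_powR; rewrite ?nnegrE ?sqrtr_ge0 ?mulr_ge0 ?ler0n ?(ltW p0).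
have X0 : 0 <= (2 ^- k ^+ kappa) `^ p * (C `^ (2 * p) * v `^ (2 * p)).
  by rewrite !mulr_ge0 ?powR_ge0.
have w0 : 2 ^- k / 2 < 1 - normc (of_plane w) ^+ 2.
  by move: k1 n0 z1; rewrite expr2; clear; nra.
rewrite ler_pdivrMr; last by apply: lt_trans w0; rewrite divr_gt0.
apply: (le_trans hp).
have -> : 2 * 2 ^+ k ^+ 2 * C `^ (2 * p) * (2 ^- k * (2 ^- k ^+ kappa) `^ p * v `^ (2 * p)) =
   ((2 ^- k ^+ kappa) `^ p * (C `^ (2 * p) * v `^ (2 * p))) * (2 ^- k / 2)^-1.
  have kn : 2 ^+ k != 0 :> R by rewrite expf_neq0 ?pnatr_eq0.
  have H (u A B D : R) : u != 0 -> 2 * u ^+ 2 * A * (u^-1 * B * D) = (B * (A * D)) * (u^-1 / 2)^-1.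
    by move=> un; field.
  exact: H.
have H (X a' b' : R) : 0 <= X -> 0 < a' -> a' < b' -> X <= X * a'^-1 * b'.
  by move=> ? ? ab; rewrite -mulrA ler_peMr// mulrC ler_pdivlMr// mul1r ltW.
by apply: H => //; rewrite divr_gt0.
Qed.

End TentLeRadial2.

Section TentLeRadial3.
Context {R : realType}.
Local Notation mR := (measurableTypeR R).
Local Notation mu := (@lebesgue_measure R).
Implicit Types (x r t d c M theta : R) (k m n kappa : nat) (z : R[i]) (G h : R[i] -> R[i]).

Lemma radial_power_ge0 (p : R) h t : (0 <= radial_power p h t)%E.
Proof. by apply: integral_ge0 => x _; rewrite lee_fin powR_ge0. Qed.

Lemma measurable_radial_integral (A : set R) (p : R) kappa G h :
  measurable (A : set mR) -> A `<=` `[0, 1[%classic ->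
  (forall z, normc z < 1 -> holo G z) -> weight_of kappa G h ->
  measurable_fun (setT : set mR)
    ((fun t => \int[mu]_(x in A) (normc (h (polar x t)) `^ p)%:E)%E : mR -> \bar R).
Proof.
move=> mA A01 Gh hE.
pose u z := dnormc G z * (1 - normc z) ^+ kappa.
have -> : (fun t => \int[mu]_(x in A) (normc (h (polar x t)) `^ p)%:E)%E =
    fun t => (\int[mu]_(x in A) (u (polar x t) `^ p)%:E)%E.
  apply/funext => t; apply: eq_integral => x /set_mem /A01; rewrite /= in_itv /= => /andP[x0 x1].
  have nx : normc (polar x t) < 1 by rewrite normc_polar ger0_norm.
  by rewrite /u dnormcE// hE.
apply: (@measurable_fun_integral_slice R (fun w => (u (polar w.1 w.2) `^ p)%:E)).
- exact: mA.
- apply/measurable_EFinP; apply: (measurableT_comp (measurable_powR p)).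
  apply: measurable_funM; first exact: (measurable_polar (measurable_dnormc Gh)).
  apply: measurable_funX; apply: measurable_funB => //.
  have -> : (fun w : mR * mR => normc (polar w.1 w.2)) = (fun w => `|w.1|).
    by apply/funext => w; rewrite normc_polar.
  by apply: measurableT_comp; [exact: normr_measurable|exact: measurable_fst].
- by move=> w; rewrite lee_fin powR_ge0.
Qed.

Lemma poweR_le (x y : \bar R) (v : R) : 0 <= v -> (0 <= x)%E -> (x <= y)%E ->
  (x `^ v <= y `^ v)%E.
Proof.
move=> v0 x0 xy; apply: gt0_ler_poweR => //; rewrite in_itv /= ?leey ?andbT//.
exact: le_trans xy.
Qed.

Lemma measurable_poweR_fun (F : R -> \bar R) (v : R) (D : set R) : measurable (D : set mR) ->
  measurable_fun (D : set mR) (F : mR -> \bar R) ->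
  measurable_fun (D : set mR) ((fun t => (F t `^ v)%E) : mR -> \bar R).
Proof.
move=> mD mF; apply: (@measurableT_comp _ _ _ _ _ _ (fun x : \bar R => (x `^ v)%E)) => //.
exact: measurable_poweR.
Qed.

(** Stein's inequality is used with exponents [2 p] and [2 q], whose ratio is still [q / p]. It
    bounds the integrals of all partial sums uniformly, and monotone convergence passes to the
    limit. *)
Theorem tent_le_radial M (p q : R) kappa : 0 < M -> 1 <= p -> 1 <= q ->
  exists2 K : R, 0 < K & forall G h, (forall z, normc z < 1 -> holo G z) ->
    weight_of kappa G h ->
    (\int[mu]_(t in `[0%R, (2 * pi)%R]) (tent_power M p h t) `^ (q / p) <=
     K%:E * \int[mu]_(t in `[0%R, (2 * pi)%R]) (radial_power p h t) `^ (q / p))%E.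
Proof.
move=> M0 p1 q1; have p0 : 0 < p by exact: lt_le_trans p1.
have q0 : 0 < q by exact: lt_le_trans q1.
have P1 : 1 < 2 * p by move: p1; clear; lra.
have Q1 : 1 < 2 * q by move: q1; clear; lra.
have [c [m [C [c0 cm C0 est]]]] := stolz_block_estimate M0.
have [C2 C20 stein] := moving_average_stein P1 Q1 c0 cm.
have vE : 2 * q / (2 * p) = q / p by field; rewrite gt_eqF.
rewrite vE in stein.
have v0 : 0 < q / p by exact: divr_gt0.
move: (q / p) v0 stein => v v0 stein {vE}.
have [K1 [K1E K10]] : exists K1 : R, K1 = 32 * M ^+ 2 * C `^ (2 * p) /\ 0 < K1.
  by eexists; split; [exact: erefl|rewrite !mulr_gt0 ?ltr0n ?powR_gt0].
have [K2 [K2E K20]] : exists K2 : R, K2 = 64 * (2 * 2 `^ (2 * p) * (16 ^+ kappa) `^ p) /\ 0 < K2.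
  eexists; split; first exact: erefl.
  apply: mulr_gt0; first by rewrite ltr0n.
  apply: mulr_gt0; last by rewrite powR_gt0// exprn_gt0// ltr0n.
  by apply: mulr_gt0; rewrite ?powR_gt0// ltr0n.
have K1v : 0 < K1 `^ v by exact: powR_gt0.
have K2v : 0 < K2 `^ v by exact: powR_gt0.
exists (K1 `^ v * (C2 * K2 `^ v)); first by apply: mulr_gt0 => //; exact: mulr_gt0.
move=> G h Gh hE.
pose b := weighted_block p kappa G.
pose s k t := movavg c m b k t `^ (2 * p).
have s0 k t : 0 <= s k t by exact: powR_ge0.
have bB k : exists B, forall t, 0 <= b k t <= B.
  have [B HB] := radial_block_bounded Gh k; exists (block_weight p kappa k * B) => t.
  have /andP[h1 h2] := HB t; rewrite /b /weighted_block mulr_ge0 ?powR_ge0//=.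
  by rewrite ler_wpM2l ?powR_ge0.
have [B HB] := choice bB.
have mb k : measurable_fun (setT : set mR) (b k : mR -> mR).
  by apply: measurable_funM => //; exact: measurable_radial_block.
have bT k t : b k (t + 2 * pi) = b k t by rewrite /b /weighted_block radial_block_periodic.
pose u n t := ((\sum_(k < n) s k t) `^ v)%:E.
have u0 n t : (0 <= u n t)%E by rewrite lee_fin powR_ge0.
have mu_ n : measurable_fun (setT : set mR) (u n : mR -> \bar R).
  apply/measurable_EFinP.
  apply: (@measurable_powR_sum R _ _ setT (movavg c m b)) => k.
  exact: measurable_movavg (mb k) (B k) (HB k).
have und t : nondecreasing_seq (u ^~ t).
  apply/nondecreasing_seqP => n; rewrite lee_fin; apply: ge0_ler_powR; rewrite ?nnegrE ?sumr_ge0 ?(ltW v0)//.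
  by rewrite big_ord_recr /= lerDl.
pose J := (\int[mu]_(t in `[0%R, (2 * pi)%R]) (radial_power p h t) `^ v)%E.
have mI : measurable (`[0%R, (2 * pi)%R]%classic : set mR) by exact: measurable_itv.
have mF := measurable_radial_integral p (measurable_itv _) (@subset_refl _ `[0%R, 1%R[%classic) Gh hE.
have mFv : measurable_fun (`[0%R, (2 * pi)%R]%classic : set mR) ((fun t => (radial_power p h t `^ v)%E) : mR -> \bar R).
  by apply: measurable_poweR_fun => //; exact: measurable_funTS.
have lim0 t : (0 <= limn (u ^~ t))%E.
  by apply: lime_ge; [exact: ereal_nondecreasing_is_cvgn|near=> n].
have K1vE : (0 <= (K1 `^ v)%:E)%E by rewrite lee_fin ltW.
have K2vE : (0 <= (K2 `^ v)%:E)%E by rewrite lee_fin ltW.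
have un n : (\int[mu]_(t in `[0%R, (2 * pi)%R]) u n t <= (C2 * K2 `^ v)%:E * J)%E.
  apply: (le_trans (stein b B n mb HB bT)).
  rewrite EFinM -muleA; apply: lee_wpmul2l; first by rewrite lee_fin ltW.
  rewrite -(ge0_integralZl mu mI mFv (fun t _ => poweR_ge0 _ _) K2vE).
  apply: le_integral_ge0.
  - by move=> t _; rewrite lee_fin powR_ge0.
  - by move=> t _; rewrite mule_ge0 ?poweR_ge0.
  move=> t tI _; split; first exact: tI.
  rewrite -poweR_EFin -poweR_EFin -poweRM; [|by rewrite lee_fin ltW|exact: radial_power_ge0].
  apply: poweR_le; [exact: ltW|by rewrite lee_fin sumr_ge0// => k _; exact: powR_ge0|].
  by rewrite K2E; exact: block_sum_le.
apply: (@le_trans _ _ ((K1 `^ v)%:E * \int[mu]_(t in `[0%R, (2 * pi)%R]) limn (u ^~ t))%E).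
  have mlim : measurable_fun (`[0%R, (2 * pi)%R]%classic : set mR) ((fun t => limn (u ^~ t)) : mR -> \bar R).
    apply: (@emeasurable_fun_cvg _ mR R `[0%R, (2 * pi)%R]%classic u) => [n|t _].
      exact: measurable_funTS.
    exact: ereal_nondecreasing_is_cvgn.
  rewrite -(ge0_integralZl mu mI mlim (fun t _ => lim0 t) K1vE).
  apply: le_integral_ge0.
  - by move=> t _; exact: poweR_ge0.
  - by move=> t _; exact: mule_ge0.
  move=> t tI _; split; first exact: tI.
  have tI' : 0 <= t <= 2 * pi by move: tI; rewrite /= in_itv.
  apply: (poweR_le_limit K10 v0 (s0 ^~ t) (tent_power_ge0 _ _ _ _)).
  rewrite K1E; apply: (tent_power_le M0 p1 (ltW C0) Gh hE) => z k zS zk.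
  exact: est.
rewrite EFinM -muleA; apply: lee_wpmul2l => //.
rewrite (@monotone_convergence _ _ _ mu _ mI u).
- apply: lime_le; last by near=> n; exact: un.
  apply: ereal_nondecreasing_is_cvgn; apply/nondecreasing_seqP => n.
  apply: le_integral_ge0.
  + by move=> t _; exact: u0.
  + by move=> t _; exact: u0.
  + by move=> t tI _; split; [exact: tI|exact: und].
- by move=> n; exact: measurable_funTS.
- by move=> n t _; exact: u0.
- by move=> t _; exact: und.
Unshelve. all: by end_near.
Qed.

End TentLeRadial3.

(** * The radial norm is bounded by the tent norm *)

Section RadialLeTent.
Context {R : realType}.
Local Notation mu := (@lebesgue_measure R).
Local Notation mu2 := (mu \x mu)%E.
Implicit Types (x r t s d c M theta : R) (k m n kappa : nat) (z a : R[i]) (G h : R[i] -> R[i]).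

Lemma lipschitz_of_derive (f df : R -> R) s t : (forall x, is_derive x 1 f (df x)) ->
  (forall x, `|df x| <= 1) -> `|f s - f t| <= `|s - t|.
Proof.
move=> fd f1; wlog st : s t / t <= s => [H|].
  by have [/H//|/ltW /H] := leP t s; rewrite distrC [in X in _ <= X -> _]distrC.
have [|x _ ->] := @MVT_segment R f df t s st.
  by apply: continuous_at_within => x _; apply/differentiable_continuous/derivable1_diffP; have [] := fd x.
by rewrite normrM ler_piMl.
Qed.

Lemma polar_chord s t : normc (polar (1 : R) s - polar 1 t) <= 2 * `|s - t|.
Proof.
apply: (le_trans (normc_le_ReIm _)); rewrite complex_ReB complex_ImB /= !mul1r.
have h1 : `|cos s - cos t| <= `|s - t|.
  apply: (@lipschitz_of_derive cos (fun x => - sin x)) => x.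
  by rewrite normrN ler_norml sin_geN1 sin_le1.
have h2 : `|sin s - sin t| <= `|s - t|.
  apply: (@lipschitz_of_derive sin cos) => x.
  by rewrite ler_norml cos_geN1 cos_le1.
by rewrite mulrDl mul1r lerD.
Qed.

(** The point [r xi] has distance [1 - r] to [xi], while the region allows about [2 M (1 - r)]; the
    surplus [b = 2 M - 1] pays for a small square and a small change of angle. *)
Lemma stolz_box M : 1 / 2 < M -> exists r0 c, [/\ 1 / 2 <= r0 < 1, 0 < c <= 1 / 8 &
  forall theta s r, r0 <= r < 1 -> `|s - theta| <= c * (1 - r) ->
    box (to_plane (polar r s)) (c * (1 - r)) `<=` of_plane @^-1` stolz M (polar 1 theta)].
Proof.
move=> M2; pose b := 2 * M - 1; have b0 : 0 < b by rewrite /b; move: M2; clear; lra.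
have M0 : 0 < M by move: M2; clear; lra.
(* For [r >= 1 - e] this gives [M (1 + r) >= 2 M - M e >= 1 + b / 2]. *)
pose e := Num.min (1 / 2) (b / (2 * M)).
have e0 : 0 < e by rewrite lt_min !divr_gt0// mulr_gt0.
have e2 : e <= 1 / 2 by rewrite ge_min lexx.
have eM : M * e <= b / 2.
  have : e <= b / (2 * M) by rewrite ge_min lexx orbT.
  by rewrite ler_pdivlMr ?mulr_gt0// mulrCA [e * M]mulrC; move: (M * e) => u; clear; lra.
(* The final comparison [1 + 4 c < (1 - 2 c) (1 + b / 2)] amounts to [c (6 + b) < b / 2]; this
   choice makes the left side [b / 8]. *)
pose c := b / (8 * (6 + b)).
have b6 : 0 < 8 * (6 + b) by move: b0; clear; lra.
have c6 : c * (8 * (6 + b)) = b by rewrite /c divfK// gt_eqF.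
have c0 : 0 < c by rewrite divr_gt0.
have cb0 : 0 < c * b by rewrite mulr_gt0.
have c8 : c <= 1 / 8.
  rewrite /c ler_pdivrMr//.
  by move: b0; clear; lra.
exists (1 - e), c; split; [by apply/andP; split; lra|by rewrite c0|].
move=> theta s r /andP[r0 r1] st w wb.
have zr : normc (of_plane w - polar r s) <= 2 * (c * (1 - r)).
  apply: (le_trans (normc_le_ReIm _)); rewrite complex_ReB complex_ImB mulrDl mul1r.
  by case: wb => h1 h2; exact: lerD (ltW h1) (ltW h2).
have r00 : 0 <= r by lra.
have zn : normc (of_plane w) <= r + 2 * (c * (1 - r)).
  have := ler_normcD (polar r s) (of_plane w - polar r s).
  rewrite addrC subrK normc_polar ger0_norm// => /le_trans; apply.
  by rewrite lerD2l.
have zt : normc (of_plane w - polar 1 theta) <= 2 * (c * (1 - r)) + ((1 - r) + 2 * (c * (1 - r))).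
  have -> : of_plane w - polar 1 theta = (of_plane w - polar r s) +
     ((polar r s - polar 1 s) + (polar 1 s - polar 1 theta)).
    by ring.
  apply: (le_trans (ler_normcD _ _)); apply: lerD zr _.
  apply: (le_trans (ler_normcD _ _)); apply: lerD.
    have -> : polar r s - polar 1 s = polar (r - 1) s.
      by apply/eqP; rewrite eq_complex /= !mulrBl !eqxx.
    by rewrite normc_polar distrC ger0_norm// subr_ge0 ltW.
  by apply: (le_trans (polar_chord _ _)); rewrite ler_wpM2l.
have y0 : 0 < 1 - r by lra.
have cy : c * (1 - r) <= 1 / 8 * (1 - r) by rewrite ler_wpM2r// ltW.
have z1 : normc (of_plane w) < 1 by move: zn cy y0; clear; lra.
apply/(stolz_polarE _ _ _).2; split => //; apply: (le_lt_trans zt).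
set N := normc (of_plane w) in zn z1 *; have N0 : 0 <= N by exact: normc_ge0.
have h1 : (1 - r) * (1 - 2 * c) <= 1 - N by move: zn; clear; lra.
have h2 : (1 - r) * (1 - 2 * c) * (1 + r) <= 1 - N ^+ 2.
  have [Nr|rN] := leP r N.
    have -> : 1 - N ^+ 2 = (1 - N) * (1 + N) by rewrite expr2; ring.
    apply: ler_pM => //; last by rewrite lerD2l.
      by rewrite mulr_ge0 ?(ltW y0)//; move: c8; clear; lra.
    by rewrite addr_ge0.
  apply: (@le_trans _ _ ((1 - r) * (1 + r))).
    rewrite -mulrA ler_wpM2l ?(ltW y0)// ler_piMl ?addr_ge0//.
    by move: c0; clear; lra.
  by move: rN r00 N0; rewrite expr2; clear; nra.
have h3 : 1 + 4 * c < M * ((1 - 2 * c) * (1 + r)).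
  have h4 : 1 + b / 2 <= M * (1 + r).
    have : M * (2 - e) <= M * (1 + r) by rewrite ler_wpM2l ?(ltW M0)//; move: r0; clear; lra.
    have : M * 2 = b + 1 by rewrite /b; ring.
    by rewrite mulrBr; move: eM; clear; lra.
  apply: (@lt_le_trans _ _ ((1 - 2 * c) * (1 + b / 2))).
    have -> : (1 - 2 * c) * (1 + b / 2) = 1 + b / 2 - 2 * c - c * b by field.
    have : 48 * c + 8 * (c * b) = b by rewrite -[RHS]c6; ring.
    by move: (c * b) b0 => u; clear; lra.
  by rewrite [leRHS]mulrCA ler_wpM2l//; move: c8; clear; lra.
apply: (@lt_le_trans _ _ (M * ((1 - r) * (1 - 2 * c) * (1 + r)))); last first.
  by rewrite ler_wpM2l// ltW.
have -> : M * ((1 - r) * (1 - 2 * c) * (1 + r)) = (1 - r) * (M * ((1 - 2 * c) * (1 + r))) by ring.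
have -> : 2 * (c * (1 - r)) + (1 - r + 2 * (c * (1 - r))) = (1 - r) * (1 + 4 * c) by ring.
by rewrite ltr_pM2l.
Qed.

(** The square-root mean value inequality raised to the power [2 p >= 2] by Jensen on the square,
    whose area [4 d^2] accounts for the extra 4. *)
Lemma box_power_estimate G a d (p : R) : 1 <= p -> 0 < d ->
  (forall z, normc z < 1 -> holo G z) ->
  box (to_plane a) d `<=` of_plane @^-1` disc ->
  ((normc (G a) `^ p * d ^+ 2)%:E <= ((4 * (32 * 192)) `^ (2 * p))%:E *
     \int[mu2]_(w in box (to_plane a) d) (normc (G (of_plane w)) `^ p)%:E)%E.
Proof.
move=> p1 d0 Gh bd; have P1 : 1 < 2 * p by move: p1; clear; lra.
have p0 : 0 < p by exact: lt_le_trans p1.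
have Gb : holo_box G a d.
  move=> z /bd zb; apply: Gh; have : disc (of_plane (to_plane z)) by exact: zb.
  by rewrite to_planeK.
have := mean_value_sqrt d0 Gb.
have [K [KE K0]] : exists K : R, K = 32 * 192 /\ 0 < K.
  by eexists; split; [exact: erefl|rewrite mulr_gt0 ?ltr0n].
rewrite -KE => mv.
set psi := fun w => Num.sqrt (normc (G (of_plane w))) in mv.
pose I := Num.sqrt (normc (G a)) * d ^+ 2 / K.
have I0 : 0 <= I.
  by apply: divr_ge0; [apply: mulr_ge0; [exact: sqrtr_ge0|exact: sqr_ge0]|exact: ltW].
have IE : (I%:E <= \int[mu2]_(w in box (to_plane a) d) (psi w)%:E)%E.
  rewrite -(@lee_pmul2l _ K%:E)// -EFinM.
  by have -> : K * I = Num.sqrt (normc (G a)) * d ^+ 2 by rewrite /I mulrC divfK// gt_eqF.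
have l0 : 0 < (2 * d) ^+ 2 by rewrite exprn_gt0// mulr_gt0.
have J := jensen_powR P1 l0 I0 (measurable_box (to_plane a) d)
  (measure_box (to_plane a) (ltW d0)) (measurable_sqrt_box Gb) (fun w _ => sqrtr_ge0 _) IE.
have JE : (\int[mu2]_(w in box (to_plane a) d) (psi w `^ (2 * p))%:E =
    \int[mu2]_(w in box (to_plane a) d) (normc (G (of_plane w)) `^ p)%:E)%E.
  by apply: eq_integral => w _; rewrite /psi sqrt_powR// normc_ge0.
rewrite -JE; have K4 : 0 < 4 * K by rewrite mulr_gt0.
have C0 : (0 <= ((4 * K) `^ (2 * p))%:E)%E by rewrite lee_fin powR_ge0.
apply: le_trans (lee_wpmul2l C0 J); rewrite -EFinM lee_fin [leRHS]mulrA.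
have I4 : 0 <= I / (2 * d) ^+ 2 by exact: (divr_ge0 I0 (ltW l0)).
rewrite -(powRM _ (ltW K4) I4).
have -> : 4 * K * (I / (2 * d) ^+ 2) = Num.sqrt (normc (G a)).
  by rewrite /I; move: (Num.sqrt _) => S; field; rewrite !gt_eqF.
rewrite sqrt_powR ?normc_ge0//; apply: ler_wpM2l; first exact: powR_ge0.
by move: (sqr_ge0 d); rewrite !expr2; clear; lra.
Qed.

End RadialLeTent.

Section RadialLeTent2.
Context {R : realType}.
Local Notation mR := (measurableTypeR R).
Local Notation mu := (@lebesgue_measure R).
Local Notation mu2 := (mu \x mu)%E.
Implicit Types (x r t s d c M theta : R) (k m n kappa : nat) (z a : R[i]) (G h : R[i] -> R[i]).

Definition tent_density (p : R) h z : R := normc (h z) `^ p / (1 - normc z ^+ 2) `^ (2 - 1).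

Lemma tent_density_ge0 p h z : 0 <= tent_density p h z.
Proof. by rewrite divr_ge0 ?powR_ge0. Qed.

(** Cutting to the moduli in [rstar k] localises the tent integral, so that estimates at all levels
    can be added with bounded overlap. *)
Definition tent_block M (p : R) h k theta : \bar R :=
  (\int[mu2]_(w in of_plane @^-1` stolz M (polar 1 theta))
     ((\1_(rstar k) (normc (of_plane w)))%:E * (tent_density p h (of_plane w))%:E))%E.

Lemma tent_block_ge0 M (p : R) h k theta : (0 <= tent_block M p h k theta)%E.
Proof.
by apply: integral_ge0 => w _; rewrite mule_ge0 ?lee_fin ?tent_density_ge0.
Qed.

Lemma tent_block_le M (p : R) h k theta : (tent_block M p h k theta <= tent_power M p h theta)%E.
Proof.
apply: le_integral_ge0.
- by move=> w _; rewrite mule_ge0 ?lee_fin ?tent_density_ge0.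
- by move=> w _; rewrite lee_fin; exact: tent_density_ge0.
move=> w wS _; split; first exact: wS.
rewrite indicE; case: (_ \in _); first by rewrite mul1e; exact: lexx.
by rewrite mul0e lee_fin; exact: tent_density_ge0.
Qed.

(** The angle [s] may differ from [theta]: the outer radial integral takes [s = theta], whereas the
    inner part needs one point to be controlled from a whole arc of boundary points. *)
Lemma stolz_point_estimate M (p : R) kappa : 1 / 2 < M -> 1 <= p ->
  exists r0 c (K : R), [/\ 1 / 2 <= r0 < 1, 0 < c <= 1 / 8, 0 < K &
   forall G h theta s r k, (forall z, normc z < 1 -> holo G z) -> weight_of kappa G h ->
     r0 <= r < 1 -> `|s - theta| <= c * (1 - r) -> 2 ^- k / 2 < 1 - r <= 2 ^- k ->
     ((normc (h (polar r s)) `^ p)%:E <= (K * 2 ^+ k)%:E * tent_block M p h k theta)%E].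
Proof.
move=> M2 p1; have p0 : 0 < p by exact: lt_le_trans p1.
have [r0 [c [r001 c08 SB]]] := stolz_box M2.
have [K' [K'E K'0]] : exists K : R, K = (4 * (32 * 192)) `^ (2 * p) /\ 0 < K.
  by eexists; split; [exact: erefl|rewrite powR_gt0// !mulr_gt0 ?ltr0n].
have [W [WE W0]] : exists W : R, W = (2 ^+ kappa) `^ p /\ 0 < W.
  by eexists; split; [exact: erefl|rewrite powR_gt0// exprn_gt0].
have /andP[c0 c8] := c08; have /andP[r02 r01] := r001.
exists r0, c, (16 * K' * W / c ^+ 2); split => //.
  by rewrite divr_gt0 ?exprn_gt0// !mulr_gt0.
move=> G h theta s r k Gh hE /andP[r0r r1] st /andP[k1 k2].
have y0 : 0 < 1 - r by rewrite subr_gt0.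
have r00 : 0 <= r by move: r02 r0r; clear; lra.
have [d [dE d0]] : exists d, d = c * (1 - r) /\ 0 < d.
  by eexists; split; [exact: erefl|exact: mulr_gt0].
have u0 : (0 : R) < 2 ^- k by rewrite invr_gt0 exprn_gt0.
have bS : box (to_plane (polar r s)) d `<=` of_plane @^-1` stolz M (polar 1 theta).
  by rewrite dE; apply: SB => //; rewrite r0r.
have bd : box (to_plane (polar r s)) d `<=` of_plane @^-1` @disc R by move=> w /bS [].
have := box_power_estimate p1 d0 Gh bd; rewrite -K'E.
set bx := box _ _ => BE.
have nr : normc (polar r s) = r by rewrite normc_polar ger0_norm.
have [C [CE C0]] : exists C : R, C = W * (4 * 2 ^- k) /\ 0 < C.
  by eexists; split; [exact: erefl|rewrite !mulr_gt0].
(* On the square [1 - |z|] is within a factor 2 of [1 - r], so the tent density there is at least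
   [A * |G|^p]. *)
have [A [AE A0]] : exists A : R, A = C^-1 * ((1 - r) ^+ kappa) `^ p /\ 0 < A.
  by eexists; split; [exact: erefl|rewrite mulr_gt0 ?invr_gt0 ?powR_gt0 ?exprn_gt0].
have IB : (A%:E * \int[mu2]_(w in bx) (normc (G (of_plane w)) `^ p)%:E <= tent_block M p h k theta)%E.
  have mG : measurable_fun (bx : set (mR * mR)) ((fun w => (normc (G (of_plane w)) `^ p)%:E) : mR * mR -> \bar R).
    apply/measurable_EFinP; apply: (measurableT_comp (measurable_powR p)).
    apply: measurable_normc_box => z /bd zb; apply: Gh.
    have : disc (of_plane (to_plane z)) := zb; by rewrite to_planeK.
  have G0 (w : mR * mR) : (0 <= (normc (G (of_plane w)) `^ p)%:E)%E by rewrite lee_fin powR_ge0.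
  have A0E : (0 <= A%:E)%E by rewrite lee_fin ltW.
  rewrite -(ge0_integralZl mu2 (measurable_box _ _) mG (fun w _ => G0 w) A0E).
  apply: le_integral_ge0.
  - by move=> w _; exact: mule_ge0.
  - by move=> w _; rewrite mule_ge0 ?lee_fin ?tent_density_ge0.
  move=> w wb _; split; first exact: bS.
  have wS : stolz M (polar 1 theta) (of_plane w) by exact: bS.
  have z1 : normc (of_plane w) < 1 by case: wS.
  have zr : normc (of_plane w - polar r s) <= 2 * d.
    apply: (le_trans (normc_le_ReIm _)); rewrite complex_ReB complex_ImB mulrDl mul1r.
    by case: wb => h1 h2; exact: lerD (ltW h1) (ltW h2).
  have z2 : normc (polar r s - of_plane w) <= 2 * d by rewrite normcBC.
  have {}z2 := le_trans (ler_normcB _ _) z2; have {}zr := le_trans (ler_normcB _ _) zr.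
  rewrite nr in zr z2; have d8 : d <= 1 / 8 * (1 - r) by rewrite dE ler_wpM2r// ltW.
  move: (of_plane w) (normc_ge0 (of_plane w)) wS z1 zr z2 => z n0 wS z1 zr z2.
  have Nr1 : 1 - r <= 2 * (1 - normc z) by move: zr z2 d8 y0; clear; lra.
  have Nr2 : 1 - normc z <= 2 * (1 - r) by move: zr z2 d8 y0; clear; lra.
  have N0 : 0 < 1 - normc z by rewrite subr_gt0.
  have xk : rstar k (normc z).
    rewrite /rstar /= !in_itv /= invfM; move: (2 ^- k) u0 k1 k2 => u u0 k1 k2.
    by split; apply/andP; split; move: zr z2 d8 n0 z1 u0 k1 k2; clear; lra.
  rewrite indicE mem_set// mul1e -EFinM lee_fin /tent_density powR_weightE//.
  rewrite hE// (powRM _ (normc_ge0 _) (exprn_ge0 _ (ltW N0))) AE CE.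
  have YY : ((1 - r) ^+ kappa) `^ p <= W * ((1 - normc z) ^+ kappa) `^ p.
    rewrite WE -powRM ?exprn_ge0 ?(ltW N0)// -exprMn.
    apply: ge0_ler_powR; rewrite ?nnegrE ?exprn_ge0 ?mulr_ge0 ?(ltW p0) ?(ltW y0) ?(ltW N0)//.
    by apply: lerXn2r; rewrite ?nnegrE ?mulr_ge0 ?(ltW y0) ?(ltW N0).
  have NN : 1 - normc z ^+ 2 <= 4 * 2 ^- k.
    by rewrite expr2; move: Nr2 k2 n0 z1; clear; nra.
  have NN0 : 0 < 1 - normc z ^+ 2 by rewrite expr2; move: n0 z1; clear; nra.
  have H (X Y Y' V a b : R) : 0 <= X -> 0 <= Y -> 0 < V -> 0 < a -> a <= b ->
      Y' <= V * Y -> (V * b)^-1 * Y' * X <= X * Y / a.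
    move=> X0 Y0 V0 a0 ab YV; have b0 : 0 < b by exact: lt_le_trans ab.
    rewrite [leLHS]mulrC -mulrA; apply: ler_wpM2l => //.
    rewrite mulrC ler_pdivrMr ?mulr_gt0// (le_trans YV)//.
    rewrite mulrCA ler_wpM2l ?(ltW V0)// mulrAC ler_pdivlMr//.
    by rewrite ler_wpM2l.
  by apply: H; rewrite ?powR_ge0.
have T0 := tent_block_ge0 M p h k theta.
have K'E0 : (0 <= K'%:E)%E by rewrite lee_fin ltW.
have A0E : (0 <= A%:E)%E by rewrite lee_fin ltW.
have H1 : ((A * (normc (G (polar r s)) `^ p * d ^+ 2))%:E <= K'%:E * tent_block M p h k theta)%E.
  rewrite EFinM; apply: (le_trans (lee_wpmul2l A0E BE)).
  by rewrite muleCA; apply: lee_wpmul2l.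
have -> : normc (h (polar r s)) `^ p = (C / d ^+ 2) * (A * (normc (G (polar r s)) `^ p * d ^+ 2)).
  rewrite hE ?nr// (powRM _ (normc_ge0 _) (exprn_ge0 _ (ltW y0))) AE.
  have H (X Y a b : R) : 0 < a -> 0 < b -> X * Y = a / b ^+ 2 * (a^-1 * Y * (X * b ^+ 2)).
    by move=> a0 b0; field; rewrite !gt_eqF.
  exact: H.
have Cd0 : (0 <= (C / d ^+ 2)%:E)%E by rewrite lee_fin divr_ge0 ?sqr_ge0 ?(ltW C0).
rewrite EFinM; apply: (le_trans (lee_wpmul2l Cd0 H1)).
rewrite muleA -EFinM; apply: lee_wpmul2r => //; rewrite lee_fin CE dE.
have kE : 2 ^+ k = (2 ^- k)^-1 :> R by rewrite invrK.
rewrite [X in _ <= _ * X]kE; move: (2 ^- k) u0 k1 k2 {CE C0 AE A0 IB H1 Cd0 kE} => u u0 k1 k2.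
have -> : W * (4 * u) / (c * (1 - r)) ^+ 2 * K' = (K' * W / c ^+ 2) * ((4 * u) / (1 - r) ^+ 2).
  by field; rewrite !gt_eqF.
have -> : 16 * K' * W / c ^+ 2 * u^-1 = (K' * W / c ^+ 2) * (16 / u).
  by field; rewrite !gt_eqF.
apply: ler_wpM2l; first by rewrite divr_ge0 ?sqr_ge0// mulr_ge0// ltW.
rewrite ler_pdivrMr ?exprn_gt0// mulrAC ler_pdivlMr//.
by move: u0 k1 y0; rewrite expr2; clear; nra.
Qed.

End RadialLeTent2.

Section RadialLeTent3.
Context {R : realType}.
Local Notation mR := (measurableTypeR R).
Local Notation mu := (@lebesgue_measure R).
Local Notation mu2 := (mu \x mu)%E.
Implicit Types (x r t s d c M theta : R) (k m n kappa : nat) (z a : R[i]) (G h : R[i] -> R[i]).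

Lemma measurable_normcB a : measurable_plane (fun z => normc (z - a)).
Proof.
case: a => x y; rewrite /measurable_plane.
have -> : (fun w => normc (of_plane w - (x +i* y))) =
    (fun w : mR * mR => Num.sqrt ((w.1 - x) ^+ 2 + (w.2 - y) ^+ 2)) by [].
apply: measurableT_comp; first by apply: continuous_measurable_fun; exact: sqrt_continuous.
by apply: measurable_funD; apply: measurable_funX; apply: measurable_funB => //.
Qed.

Lemma measurable_stolz M theta : measurable (of_plane @^-1` stolz M (polar 1 theta) : set (mR * mR)).
Proof.
have m0 : measurable_plane (fun z => normc z).
  have := measurable_normcB 0; congr (measurable_fun _ _).
  by apply/funext => w; rewrite subr0.
have m1 := measurable_normcB (polar 1 theta).
pose f (w : mR * mR) := M * (1 - normc (of_plane w) ^+ 2) - normc (of_plane w - polar 1 theta).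
have mf : measurable_fun (setT : set (mR * mR)) f.
  apply: measurable_funB => //; apply: measurable_funM => //.
  by apply: measurable_funB => //; exact: measurable_funX.
have -> : of_plane @^-1` stolz M (polar 1 theta) = of_plane @^-1` @disc R `&` (setT `&` f @^-1` `]0, +oo[).
  apply/seteqP; split => w.
    move=> /stolz_polarE [w1 wM]; split => //; split => //=.
    by rewrite in_itv /= andbT /f subr_gt0.
  move=> [w1 [_]]; rewrite /= in_itv /= andbT /f subr_gt0 => wM.
  by apply/stolz_polarE.
by apply: measurableI; [exact: measurable_disc_set|exact: mf].
Qed.

Lemma measurable_tent_density M (p : R) kappa G h theta : (forall z, normc z < 1 -> holo G z) ->
  weight_of kappa G h ->
  measurable_fun (of_plane @^-1` stolz M (polar 1 theta) : set (mR * mR))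
    ((fun w => tent_density p h (of_plane w)) : mR * mR -> mR).
Proof.
move=> Gh hE.
have m0 : measurable_plane (fun z => normc z).
  have := measurable_normcB 0; congr (measurable_fun _ _).
  by apply/funext => w; rewrite subr0.
apply: (@eq_measurable_fun _ _ _ _ _ (fun w : mR * mR =>
  (dnormc G (of_plane w) * (1 - normc (of_plane w)) ^+ kappa) `^ p *
  (1 - normc (of_plane w) ^+ 2) `^ (-1))).
  move=> w /set_mem -[w1 _]; rewrite /tent_density hE// dnormcE//.
  have -> : (2 - 1 = 1 :> R) by ring.
  by rewrite powRN.
apply: measurable_funTS; apply: measurable_funM.
  apply: (measurableT_comp (measurable_powR p)); apply: measurable_funM.
    exact: measurable_dnormc.
  by apply: measurable_funX; apply: measurable_funB.
apply: (measurableT_comp (measurable_powR (-1))).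
by apply: measurable_funB => //; exact: measurable_funX.
Qed.

Lemma sum_tent_block_le M (p : R) kappa G h theta n : (forall z, normc z < 1 -> holo G z) ->
  weight_of kappa G h ->
  (\sum_(k < n) tent_block M p h k theta <= 64%:E * tent_power M p h theta)%E.
Proof.
move=> Gh hE; have mS := measurable_stolz M theta.
have md := (measurable_EFinP _ _).2 (@measurable_tent_density M p kappa G h theta Gh hE).
have m0 : measurable_plane (fun z => normc z).
  have := measurable_normcB 0; congr (measurable_fun _ _).
  by apply/funext => w; rewrite subr0.
pose f k (w : mR * mR) := ((\1_(rstar k) (normc (of_plane w)))%:E * (tent_density p h (of_plane w))%:E)%E.
have f0 k w : (0 <= f k w)%E by rewrite mule_ge0 ?lee_fin ?tent_density_ge0.
have d0 (w : mR * mR) : (0 <= (tent_density p h (of_plane w))%:E)%E by rewrite lee_fin tent_density_ge0.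
have mf k : measurable_fun (of_plane @^-1` stolz M (polar 1 theta) : set (mR * mR)) (f k).
  apply: emeasurable_funM => //; apply/measurable_EFinP; apply: measurable_funTS.
  have mi : measurable_fun (setT : set mR) ((fun x => \1_(rstar k) x) : mR -> mR).
    by apply: measurable_indic; exact: measurable_rstar.
  exact: measurableT_comp mi m0.
rewrite -(ge0_integral_sum mu2 mS (fun k : 'I_n => mf k) (fun (k : 'I_n) w _ => f0 k w)).
have c64 : (0 <= 64%:E :> \bar R)%E by rewrite lee_fin ler0n.
rewrite /tent_power /area_integral -(ge0_integralZl mu2 mS md (fun w _ => d0 w) c64).
apply: le_integral_ge0.
- by move=> w _; apply: sume_ge0 => k _; exact: f0.
- by move=> w _; exact: (mule_ge0 c64 (d0 w)).
move=> w wS _; split; first exact: wS.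
rewrite /f -ge0_sume_distrl; last by move=> k _; rewrite lee_fin.
apply: lee_wpmul2r => //; rewrite sumEFin lee_fin; apply: rstar_count.
by have [w1 _] : stolz M (polar 1 theta) (of_plane w) := wS; rewrite normc_ge0.
Qed.

(** The radial interval of level [k] has length [2^-k / 2], which cancels the factor [2 ^+ k] of the
    point estimate; the blocks then add up to at most 64 tents. *)
Lemma outer_radial_le M (p K r0 : R) kappa G h theta : (forall z, normc z < 1 -> holo G z) ->
  weight_of kappa G h -> 0 < K -> 0 <= r0 ->
  (forall r k, r0 <= r < 1 -> 2 ^- k / 2 < 1 - r <= 2 ^- k ->
     ((normc (h (polar r theta)) `^ p)%:E <= (K * 2 ^+ k)%:E * tent_block M p h k theta)%E) ->
  (\int[mu]_(x in `[r0, 1%R[) (normc (h (polar x theta)) `^ p)%:E <=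
   (64 * K)%:E * tent_power M p h theta)%E.
Proof.
move=> Gh hE K0 r00 est; have T0 := tent_power_ge0 M p h theta.
have [Toy|Tfin] := eqVneq (tent_power M p h theta) +oo%E.
  by rewrite Toy gt0_muley ?leey// lte_fin mulr_gt0// ltr0n.
have {}Tfin : tent_power M p h theta \is a fin_num.
  by rewrite ge0_fin_numE// lt_neqAle Tfin leey.
have bfin k : tent_block M p h k theta \is a fin_num.
  rewrite ge0_fin_numE ?tent_block_ge0// (le_lt_trans (tent_block_le _ _ _ _ _))//.
  by rewrite -ge0_fin_numE.
pose tk k := fine (tent_block M p h k theta).
have tkE k : (tk k)%:E = tent_block M p h k theta by rewrite /tk fineK.
have tk0 k : 0 <= tk k by rewrite fine_ge0// tent_block_ge0.
pose I k : set R := `[1 - 2 ^- k, 1 - 2 ^- k / 2]%classic.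
have mI k : measurable (I k : set mR) by exact: measurable_itv.
have u0 k : (0 : R) < 2 ^- k by rewrite invr_gt0 exprn_gt0.
have e0 k : 0 <= K * 2 ^+ k * tk k by rewrite !mulr_ge0 ?exprn_ge0 ?(ltW K0).
pose f k x := ((K * 2 ^+ k * tk k)%:E * (\1_(I k) x)%:E)%E.
have f0 k x : (0 <= f k x)%E by rewrite mule_ge0 ?lee_fin.
have mi k : measurable_fun (setT : set mR) ((fun x => (\1_(I k) x)%:E) : mR -> \bar R).
  by apply/measurable_EFinP; exact: measurable_indic.
have mf k : measurable_fun (setT : set mR) (f k : mR -> \bar R) by exact: measurable_funeM.
have fi k : (\int[mu]_x f k x <= K%:E * tent_block M p h k theta)%E.
  have i0 x : (0 <= (\1_(I k) x : R)%:E)%E by rewrite lee_fin.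
  have e0E : (0 <= (K * 2 ^+ k * tk k)%:E)%E by rewrite lee_fin.
  rewrite (ge0_integralZl mu measurableT (mi k) (fun x _ => i0 x) e0E).
  rewrite -tkE.
  have IE : mu (I k) = (2 ^- k / 2)%:E.
    rewrite lebesgue_measure_itv /= lte_fin; have uk := u0 k.
    have -> : (1 - 2 ^- k : R) < 1 - 2 ^- k / 2.
      move: uk; move: (2 ^- k) => u; clear; lra.
    by rewrite -EFinB; congr (_%:E); move: (2 ^- k) => u; field.
  have -> : (\int[mu]_x (\1_(I k) x)%:E = (2 ^- k / 2)%:E)%E.
    by rewrite integral_indic// setIT; exact: IE.
  rewrite -!EFinM lee_fin.
  have -> : K * 2 ^+ k * tk k * (2 ^- k / 2) = K * tk k / 2.
    have H (u a' b' : R) : u != 0 -> a' * u * b' * (u^-1 / 2) = a' * b' / 2 by move=> un; field.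
    by apply: H; rewrite expf_neq0 ?pnatr_eq0.
  by rewrite ler_pdivrMr// ler_peMr ?mulr_ge0 ?(ltW K0)// ler1n.
apply: (@le_trans _ _ (\int[mu]_x (\sum_(k <oo) f k x))%E).
  apply: le_integral_ge0.
  - by move=> x _; rewrite lee_fin powR_ge0.
  - by move=> x _; apply: nneseries_ge0 => k _ _; exact: f0.
  move=> x; rewrite /= in_itv /= => /andP[x0 x1] _; split; first exact: Logic.I.
  have [|k /andP[k1 k2]] := @dyadic_level R (1 - x).
    by apply/andP; split; move: r00 x0 x1; clear; lra.
  apply: (@le_trans _ _ (f k x)); last first.
    apply: (@le_trans _ _ (\sum_(0 <= i < k.+1) f i x)%E).
      by rewrite big_nat_recr//= leeDr// sume_ge0.
    by apply: nneseries_lim_ge => i _ _; exact: f0.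
  have xI : I k x by rewrite /I /= in_itv /=; apply/andP; split; move: k1 k2; move: (2 ^- k) => u; clear; lra.
  rewrite /f indicE mem_set// mule1 EFinM tkE; apply: est; first by rewrite x0.
  by rewrite k1.
rewrite integral_nneseries//.
apply: lime_le; first by apply: is_cvg_nneseries => k _ _; exact: integral_ge0.
near=> n; rewrite big_mkord.
apply: (@le_trans _ _ (K%:E * \sum_(k < n) tent_block M p h k theta)%E).
  rewrite ge0_sume_distrr; last by move=> k _; exact: tent_block_ge0.
  by apply: lee_sum => k _; exact: fi.
rewrite mulrC EFinM -muleA; apply: lee_wpmul2l; first by rewrite lee_fin ltW.
exact: (@sum_tent_block_le M p kappa G h theta n Gh hE).
Unshelve. all: by end_near.
Qed.

End RadialLeTent3.

Section RadialLeTent4.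
Context {R : realType}.
Local Notation mR := (measurableTypeR R).
Local Notation mu := (@lebesgue_measure R).
Implicit Types (x r t s d c M theta : R) (k m n kappa : nat) (z a : R[i]) (G h : R[i] -> R[i]).

Lemma polar_arc_pos z : exists2 s, 0 <= s <= 2 * pi & z = polar (normc z) s.
Proof.
have pp := pi_gt0 R; have [t [/andP[t0 t1] zE]] := polar_arc z.
have [tn|tp] := ltP t 0.
  exists (t + 2 * pi); last by rewrite polarD2pi.
  by apply/andP; split; lra.
by exists t => //; apply/andP; split; lra.
Qed.

Lemma poweRD_le (x y : \bar R) (v : R) : (0 <= x)%E -> (0 <= y)%E -> 0 <= v ->
  ((x + y) `^ v <= (2 `^ v)%:E * (x `^ v + y `^ v))%E.
Proof.
move=> x0 y0 v0; wlog xy : x y x0 y0 / (x <= y)%E => [H|].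
  by have [/H|/ltW /H] := leP x y; [exact|rewrite addeC [X in (_ * X)%E]addeC; exact].
apply: (@le_trans _ _ ((2%:E * y) `^ v)%E).
  apply: poweR_le => //; first exact: adde_ge0.
  by rewrite (_ : 2%:E = 1%:E + 1%:E)%E// ge0_muleDl// mul1e leeD2r.
rewrite poweRM//; apply: lee_wpmul2l; first by rewrite lee_fin powR_ge0.
by rewrite leeDr ?poweR_ge0.
Qed.

(* The interval of length c1 on the side of s that stays in [0, 2 pi]. *)
Lemma arc_lower_bound (F : R -> \bar R) (s c1 A : R) : 0 <= s <= 2 * pi -> 0 < c1 <= 1 -> 0 <= A ->
  (forall t, (0 <= F t)%E) ->
  (forall t, `|s - t| <= c1 -> (A%:E <= F t)%E) ->
  ((A * c1)%:E <= \int[mu]_(t in `[0%R, (2 * pi)%R]) F t)%E.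
Proof.
move=> /andP[s0 s1] /andP[c0 c1'] A0 F0 HF; have p2 := pi_ge2 R.
have [b [b0 b1 bs]] : exists b, [/\ 0 <= b, b + c1 <= 2 * pi & b <= s <= b + c1].
  have [sp|sp] := leP s pi; first by exists s; split => //; [|apply/andP; split]; lra.
  by exists (s - c1); split => //; [| |apply/andP; split]; lra.
have -> : ((A * c1)%:E = \int[mu]_(t in `[b, (b + c1)%R]) A%:E)%E.
  rewrite integral_cst//= lebesgue_measure_itv /= lte_fin ltrDl c0 -EFinB EFinM.
  by congr (_ * _)%E; congr (_%:E); ring.
apply: le_integral_ge0.
- by move=> t _; rewrite lee_fin.
- by move=> t _; exact: F0.
move=> t; rewrite /= !in_itv /= => /andP[t0 t1] _; split.
  by apply/andP; split; move: b0 b1 t0 t1; clear; lra.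
apply: HF; rewrite ler_norml; case/andP: bs => h1 h2.
by apply/andP; split; move: h1 h2 t0 t1; clear; lra.
Qed.

(** A point of the annulus [r0 < |w| < r1] is controlled by the tents over an arc of fixed length;
    integrating over the arc bounds [|G w|] by [j]. The maximum principle then fills the inner disc;
    it concerns [G], as [h] need not be holomorphic. *)
Lemma inner_radial_bound M (p q : R) kappa r0 c (K : R) : 1 <= p -> 1 <= q ->
  1 / 2 <= r0 < 1 -> 0 < c <= 1 / 8 -> 0 < K ->
  exists2 K4 : R, 0 < K4 & forall G h, (forall z, normc z < 1 -> holo G z) -> weight_of kappa G h ->
   (forall theta s r k, r0 <= r < 1 -> `|s - theta| <= c * (1 - r) -> 2 ^- k / 2 < 1 - r <= 2 ^- k ->
     ((normc (h (polar r s)) `^ p)%:E <= (K * 2 ^+ k)%:E * tent_block M p h k theta)%E) ->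
   forall j : R, (\int[mu]_(t in `[0%R, (2 * pi)%R]) tent_power M p h t `^ (q / p) <= j%:E)%E ->
   forall z, normc z <= r0 -> normc (G z) `^ q <= K4 * j.
Proof.
move=> p1 q1 /andP[r02 r01] /andP[c0 c8] K0.
have p0 : 0 < p by exact: lt_le_trans p1.
have q0 : 0 < q by exact: lt_le_trans q1.
pose r1 := (1 + r0) / 2.
have r0r1 : r0 < r1 by rewrite /r1; lra.
have r11 : r1 < 1 by rewrite /r1; lra.
have y1 : 0 < 1 - r1 by rewrite subr_gt0.
(* The admissible half-length [c (1 - |w|)] is at least [c1] throughout the annulus. *)
pose c1 := c * (1 - r1); have c10 : 0 < c1 by exact: mulr_gt0.
have c11 : c1 <= 1.
  have : c * (1 - r1) <= 1 / 8 * (1 - r1) by rewrite ler_wpM2r// ltW.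
  by rewrite -/c1; move: r02 r0r1; lra.
have [e [eE e0]] : exists e, e = (1 - r1) ^+ kappa /\ 0 < e.
  by eexists; split; [exact: erefl|rewrite exprn_gt0].
(* Here [e] is a lower bound of the weight on the annulus, [(1 - r1) / K] one of [1 / (K 2^k)], and
   [c1] the length over which [arc_lower_bound] integrates. *)
have [D [DE D0]] : exists D : R, D = (e `^ p * ((1 - r1) / K)) `^ (q / p) * c1 /\ 0 < D.
  eexists; split; first exact: erefl.
  by rewrite mulr_gt0// powR_gt0// mulr_gt0 ?powR_gt0// divr_gt0.
exists (2 `^ q * D^-1); first by rewrite mulr_gt0 ?powR_gt0 ?invr_gt0.
move=> G h Gh hE est j Jj z zr0.
have v0 : 0 < q / p by exact: divr_gt0.
have j0 : 0 <= j.
  by rewrite -lee_fin (le_trans _ Jj)//; apply: integral_ge0 => t _; exact: poweR_ge0.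
have ann w : r0 < normc w < r1 -> normc (G w) <= (D^-1 * j) `^ q^-1.
  move=> /andP[w0 w1]; have [s s02 wE] := polar_arc_pos w.
  have y0 : 0 < 1 - normc w by move: w1 r11; clear; lra.
  have wp : 0 <= normc w by exact: normc_ge0.
  have [|k Hk] := @dyadic_level R (1 - normc w).
    by apply/andP; split => //; move: wp; clear; lra.
  have g0 := normc_ge0 (G w).
  have low t : `|s - t| <= c1 ->
      (((normc (G w) `^ p * (e `^ p * ((1 - r1) / K))) `^ (q / p))%:E <= tent_power M p h t `^ (q / p))%E.
    move=> st; rewrite -poweR_EFin; apply: poweR_le; first exact: ltW.
      by rewrite lee_fin !mulr_ge0 ?powR_ge0 ?invr_ge0 ?(ltW K0) ?(ltW y1).
    have st' : `|s - t| <= c * (1 - normc w).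
      by apply: (le_trans st); rewrite ler_wpM2l ?(ltW c0)// lerD2l lerN2 ltW.
    have r0w : r0 <= normc w < 1 by rewrite (ltW w0) -subr_gt0.
    have := est t s (normc w) k r0w st' Hk; rewrite -wE => H.
    have k0 : (0 : R) < 2 ^+ k by rewrite exprn_gt0.
    have kK : 2 ^+ k <= (1 - r1)^-1 :> R.
      have /andP[_ k2] := Hk; rewrite -[leLHS]invrK lef_pV2 ?posrE ?invr_gt0//.
      by apply: le_trans k2; rewrite lerD2l lerN2 ltW.
    have T0 := tent_power_ge0 M p h t.
    have H2 : ((normc (h w) `^ p)%:E <= (K / (1 - r1))%:E * tent_power M p h t)%E.
      apply: (le_trans H); apply: lee_pmul.
      - by rewrite lee_fin mulr_ge0 ?(ltW K0) ?(ltW k0).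
      - exact: tent_block_ge0.
      - by rewrite lee_fin ler_wpM2l ?(ltW K0).
      - exact: tent_block_le.
    have H3 : normc (G w) `^ p * e `^ p <= normc (h w) `^ p.
      rewrite -(powRM _ g0 (ltW e0)); apply: ge0_ler_powR; rewrite ?nnegrE ?mulr_ge0 ?normc_ge0 ?(ltW p0) ?(ltW e0)//.
      have wlt : normc w < 1 by rewrite -subr_gt0.
      rewrite (hE w wlt); apply: (ler_wpM2l g0); rewrite eE.
      apply: lerXn2r; rewrite ?nnegrE ?(ltW y1) ?(ltW y0)//.
      by rewrite lerD2l lerN2; exact: ltW.
    have yK : 0 < (1 - r1) / K by exact: divr_gt0.
    apply: (@le_trans _ _ (((1 - r1) / K)%:E * (normc (h w) `^ p)%:E)%E).
      by rewrite -EFinM lee_fin mulrA mulrC ler_wpM2l ?(ltW yK).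
    have yKE : (0 <= ((1 - r1) / K)%:E)%E by rewrite lee_fin ltW.
    apply: (le_trans (lee_wpmul2l yKE H2)); rewrite muleA -EFinM.
    have -> : (1 - r1) / K * (K / (1 - r1)) = 1 by field; rewrite !gt_eqF.
    by rewrite mul1e.
  have c1' : 0 < c1 <= 1 by rewrite c10.
  have := arc_lower_bound s02 c1' (powR_ge0 _ _) (fun t => poweR_ge0 _ _) low.
  move=> /le_trans /(_ Jj); rewrite lee_fin => H.
  have {}H : normc (G w) `^ q <= D^-1 * j.
    rewrite mulrC ler_pdivlMr//; apply: le_trans H.
    have B0 : 0 <= e `^ p * ((1 - r1) / K).
      by apply: mulr_ge0; [exact: powR_ge0|exact: divr_ge0 (ltW y1) (ltW K0)].
    rewrite DE (powRM _ (powR_ge0 _ _) B0) -(powRrM (normc (G w))) [p * _]mulrC divfK ?gt_eqF//.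
    by rewrite mulrA.
  rewrite -[leLHS](powRr1 g0) -(@divff _ q) ?gt_eqF// powRrM.
  by apply: ge0_ler_powR; rewrite ?nnegrE ?powR_ge0 ?mulr_ge0 ?invr_ge0 ?(ltW D0) ?(ltW q0).
have r00 : 0 < r0 by apply: lt_le_trans r02; rewrite divr_gt0.
have rr : (0 < r0) && (r0 < r1) by rewrite r00.
have := weak_maximum_principle rr r11 Gh ann zr0.
have X0 : 0 <= D^-1 * j by rewrite mulr_ge0 ?invr_ge0 ?(ltW D0).
move=> H; apply: (@le_trans _ _ ((2 * (D^-1 * j) `^ q^-1) `^ q)).
  by apply: ge0_ler_powR; rewrite ?nnegrE ?normc_ge0 ?mulr_ge0 ?powR_ge0 ?(ltW q0).
by rewrite powRM ?powR_ge0// -powRrM mulVf ?gt_eqF// powRr1// mulrA.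
Qed.

(** The radial integral is split at [r0]. Its outer part is bounded angle by angle; its inner part
    is bounded uniformly in the angle by the whole tent integral, so integration over the circle
    adds the factor [2 pi]. *)
Theorem radial_le_tent M (p q : R) kappa : 1 / 2 < M -> 1 <= p -> 1 <= q ->
  exists2 K : R, 0 < K & forall G h, (forall z, normc z < 1 -> holo G z) ->
    weight_of kappa G h ->
    (\int[mu]_(t in `[0%R, (2 * pi)%R]) (radial_power p h t) `^ (q / p) <=
     K%:E * \int[mu]_(t in `[0%R, (2 * pi)%R]) (tent_power M p h t) `^ (q / p))%E.
Proof.
move=> M2 p1 q1; have p0 : 0 < p by exact: lt_le_trans p1.
have q0 : 0 < q by exact: lt_le_trans q1.
have pp := pi_gt0 R.
have [r0 [c [K [r001 c08 K0 est]]]] := stolz_point_estimate kappa M2 p1.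
have [K4 K40 inner] := inner_radial_bound M kappa p1 q1 r001 c08 K0.
have /andP[r02 r01] := r001.
have r00 : 0 <= r0 by move: r02; clear; lra.
have v0 : 0 < q / p by exact: divr_gt0.
have [L [LE L0]] : exists L : R, L = (64 * K) `^ (q / p) /\ 0 < L.
  by eexists; split; [exact: erefl|rewrite powR_gt0// mulr_gt0 ?ltr0n].
have [V [VE V0]] : exists V : R, V = 2 `^ (q / p) /\ 0 < V.
  by eexists; split; [exact: erefl|rewrite powR_gt0].
exists (V * (K4 * (2 * pi) + L)).
  by rewrite mulr_gt0// addr_gt0// mulr_gt0// mulr_gt0.
move=> G h Gh hE.
pose J := (\int[mu]_(t in `[0%R, (2 * pi)%R]) (tent_power M p h t) `^ (q / p))%E.
have J0 : (0 <= J)%E by apply: integral_ge0 => t _; exact: poweR_ge0.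
change (\int[mu]_(t in `[0%R, (2 * pi)%R]) (radial_power p h t) `^ (q / p) <=
  (V * (K4 * (2 * pi) + L))%:E * J)%E.
have KK0 : 0 < V * (K4 * (2 * pi) + L) by rewrite mulr_gt0// addr_gt0// mulr_gt0// mulr_gt0.
have [Joy|Jfin] := eqVneq J +oo%E.
  by rewrite Joy gt0_muley ?leey// lte_fin.
have {}Jfin : J \is a fin_num by rewrite ge0_fin_numE// lt_neqAle Jfin leey.
pose j := fine J; have jE : j%:E = J by rewrite /j fineK.
have j0 : 0 <= j by rewrite fine_ge0.
have {}inner := inner G h Gh hE (fun theta s r k => est G h theta s r k Gh hE) j.
rewrite jE in inner; have {}inner := inner (lexx _).
have mI : measurable (`[0%R, (2 * pi)%R]%classic : set mR) by exact: measurable_itv.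
pose F1 t := (\int[mu]_(x in `[0%R, r0[) (normc (h (polar x t)) `^ p)%:E)%E.
pose F2 t := (\int[mu]_(x in `[r0, 1%R[) (normc (h (polar x t)) `^ p)%:E)%E.
have F10 t : (0 <= F1 t)%E by apply: integral_ge0 => x _; rewrite lee_fin powR_ge0.
have F20 t : (0 <= F2 t)%E by apply: integral_ge0 => x _; rewrite lee_fin powR_ge0.
have s1 : (`[0, r0[%classic : set R) `<=` `[0, 1[%classic.
  move=> x; rewrite /= !in_itv /= => /andP[-> h1].
  by move: h1 r01; clear; lra.
have s2 : (`[r0, 1[%classic : set R) `<=` `[0, 1[%classic.
  move=> x; rewrite /= !in_itv /= => /andP[h1 ->].
  by rewrite andbT; move: h1 r00; clear; lra.
have mF1 : measurable_fun (`[0%R, (2 * pi)%R]%classic : set mR) ((fun t => (F1 t `^ (q / p))%E) : mR -> \bar R).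
  by apply: measurable_poweR_fun => //; apply: measurable_funTS; exact: (measurable_radial_integral p (measurable_itv _) s1 Gh hE).
have mF2 : measurable_fun (`[0%R, (2 * pi)%R]%classic : set mR) ((fun t => (F2 t `^ (q / p))%E) : mR -> \bar R).
  by apply: measurable_poweR_fun => //; apply: measurable_funTS; exact: (measurable_radial_integral p (measurable_itv _) s2 Gh hE).
have FE t : radial_power p h t = (F1 t + F2 t)%E.
  have E : (`[0, 1[%classic = `[0, r0[ `|` `[r0, 1[%classic :> set R).
    by rewrite -itv_bndbnd_setU// bnd_simp// ltW.
  rewrite /radial_power E ge0_integral_setU//.
  - apply/measurable_EFinP; rewrite -E; exact: measurable_weighted_radial Gh hE.
  - by move=> x _; rewrite lee_fin powR_ge0.
  - apply/disj_set2P; apply/seteqP; split => x //= []; rewrite !in_itv /= => /andP[_ h1] /andP[h2 _].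
    by move: (lt_le_trans h1 h2); rewrite ltxx.
have F1v t : (F1 t `^ (q / p) <= (K4 * j)%:E)%E.
  have Kj0 : 0 <= K4 * j by rewrite mulr_ge0// ltW.
  have F1le : (F1 t <= ((K4 * j) `^ (p / q))%:E)%E.
    apply: (@le_trans _ _ (\int[mu]_(x in `[0%R, 1%R[) ((K4 * j) `^ (p / q))%:E)%E).
      apply: le_integral_ge0.
      - by move=> x _; rewrite lee_fin powR_ge0.
      - by move=> x _; rewrite lee_fin powR_ge0.
      move=> x xI _; split; first exact: s1.
      move: xI; rewrite /= in_itv /= => /andP[x0 x1]; rewrite lee_fin.
      have nx : normc (polar x t) = x by rewrite normc_polar ger0_norm.
      have g0 := normc_ge0 (G (polar x t)).
      have xx1 : x < 1 by move: x1 r01; clear; lra.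
      have hG : normc (h (polar x t)) <= normc (G (polar x t)).
        rewrite hE ?nx// ler_piMr// exprn_ile1//; move: x0 xx1; clear; lra.
      have Gq := inner (polar x t); rewrite nx in Gq; have {}Gq := Gq (ltW x1).
      apply: (@le_trans _ _ (normc (G (polar x t)) `^ p)).
        by apply: ge0_ler_powR; rewrite ?nnegrE ?normc_ge0 ?(ltW p0).
      have -> : normc (G (polar x t)) `^ p = (normc (G (polar x t)) `^ q) `^ (p / q).
        by rewrite -powRrM [q * _]mulrC divfK ?gt_eqF.
      by apply: ge0_ler_powR; rewrite ?nnegrE ?powR_ge0 ?divr_ge0 ?(ltW p0) ?(ltW q0).
    by rewrite integral_cst//= lebesgue_measure_itv /= lte01 oppr0 adde0 mule1.
  apply: (le_trans (poweR_le (ltW v0) (F10 t) F1le)).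
  rewrite poweR_EFin lee_fin -powRrM (_ : p / q * (q / p) = 1) ?powRr1//.
  by field; rewrite !gt_eqF.
have L0E : (0 <= (L^-1)%:E)%E by rewrite lee_fin invr_ge0 ltW.
have IF2 : (\int[mu]_(t in `[0%R, (2 * pi)%R]) F2 t `^ (q / p) <= L%:E * J)%E.
  (* The constant is put beside [F2], whose measurability in the angle has been established, so that
     it can be moved into the integral. *)
  have : ((L^-1)%:E * \int[mu]_(t in `[0%R, (2 * pi)%R]) F2 t `^ (q / p) <= J)%E.
    rewrite -(ge0_integralZl mu mI mF2 (fun t _ => poweR_ge0 _ _) L0E).
    apply: le_integral_ge0.
    - by move=> t _; rewrite mule_ge0 ?poweR_ge0.
    - by move=> t _; exact: poweR_ge0.
    move=> t tI _; split; first exact: tI.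
    have F2le : (F2 t <= (64 * K)%:E * tent_power M p h t)%E.
      apply: (outer_radial_le Gh hE K0 r00) => r k rr kk.
      apply: (est G h t t r k Gh hE rr _ kk).
      case/andP: rr => _ r1; case/andP: c08 => c0 _.
      by rewrite subrr normr0 mulr_ge0 ?(ltW c0)// subr_ge0 ltW.
    have K64 : (0 <= (64 * K)%:E)%E by rewrite lee_fin mulr_ge0 ?ler0n// ltW.
    apply: (le_trans (lee_wpmul2l L0E (poweR_le (ltW v0) (F20 t) F2le))).
    rewrite (poweRM _ K64 (tent_power_ge0 _ _ _ _)) poweR_EFin -LE muleA -EFinM.
    by rewrite mulVf ?gt_eqF// mul1e.
  have LE0 : (0 <= L%:E)%E by rewrite lee_fin ltW.
  move=> /(lee_wpmul2l LE0); rewrite muleA -EFinM divff ?gt_eqF// mul1e; exact.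
have V0E : (0 <= V%:E)%E by rewrite lee_fin ltW.
apply: (@le_trans _ _ (V%:E * \int[mu]_(t in `[0%R, (2 * pi)%R]) (F1 t `^ (q / p) + F2 t `^ (q / p)))%E).
  have mFF := emeasurable_funD mF1 mF2.
  have FF0 t : (0 <= F1 t `^ (q / p) + F2 t `^ (q / p))%E by rewrite adde_ge0 ?poweR_ge0.
  rewrite -(ge0_integralZl mu mI mFF (fun t _ => FF0 t) V0E).
  apply: le_integral_ge0.
  - by move=> t _; exact: poweR_ge0.
  - by move=> t _; exact: mule_ge0.
  move=> t tI _; split; first exact: tI.
  by rewrite FE VE; apply: poweRD_le => //; exact: ltW.
rewrite EFinM -muleA; apply: lee_wpmul2l => //.
rewrite (ge0_integralD mu mI (fun t _ => poweR_ge0 _ _) mF1 (fun t _ => poweR_ge0 _ _) mF2).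
have Kj : (\int[mu]_(t in `[0%R, (2 * pi)%R]) F1 t `^ (q / p) <= (K4 * (2 * pi))%:E * J)%E.
  apply: (@le_trans _ _ (\int[mu]_(t in `[0%R, (2 * pi)%R]) (K4 * j)%:E)%E).
    apply: le_integral_ge0.
    - by move=> t _; exact: poweR_ge0.
    - by move=> t _; rewrite lee_fin mulr_ge0// ltW.
    - by move=> t tI _; split; [exact: tI|exact: F1v].
  have pi2 : 0 < 2 * pi :> R by rewrite mulr_gt0.
  rewrite integral_cst//= lebesgue_measure_itv /= lte_fin pi2 oppr0 adde0 -jE -!EFinM lee_fin.
  by rewrite mulrAC.
have c1 : (0 <= (K4 * (2 * pi))%:E)%E by rewrite lee_fin mulr_ge0 ?(ltW K40)// mulr_ge0 ?(ltW pp).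
have c2 : (0 <= L%:E)%E by rewrite lee_fin ltW.
by rewrite EFinD (ge0_muleDl _ c1 c2); exact: leeD.
Qed.

End RadialLeTent4.

(** * Comparison of the norms *)

Section Comparison.
Context {R : realType}.
Local Notation mu := (@lebesgue_measure R).
Implicit Types (z : R[i]) (G h f : R[i] -> R[i]).

Lemma box_continuous_Re_Im F (U : set (R * R)) :
  (forall w, U w -> ccont F (of_plane w)) ->
  box_continuous U (fun w => Re (F (of_plane w))) /\
  box_continuous U (fun w => Im (F (of_plane w))).
Proof.
move=> Fc.
suff H w : U w -> forall e, 0 < e -> exists2 d, 0 < d &
    forall w', box w d w' -> normc (F (of_plane w') - F (of_plane w)) < e.
  split=> w Uw e /(H _ Uw)[d d0 Hd]; exists d => // w' /Hd.
    by rewrite -complex_ReB; apply: le_lt_trans; exact: normr_Re_le.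
  by rewrite -complex_ImB; apply: le_lt_trans; exact: normr_Im_le.
move=> Uw e /(Fc _ Uw)[d d0 Hd]; exists (d / 2) => [|w' [h1 h2]]; first by rewrite divr_gt0.
apply: Hd; rewrite (le_lt_trans (normc_le_ReIm _))// complex_ReB complex_ImB.
by rewrite (splitr d) ltrD.
Qed.

Lemma analytic_measurable_disc f : analytic_disc f -> measurable_disc f.
Proof.
move=> fa; have fc w : (of_plane @^-1` @disc R) w -> ccont f (of_plane w).
  by move=> w1; apply/holo_ccont/derivable_holo/fa.
have [h1 h2] := box_continuous_Re_Im fc.
by split; apply: measurable_box_continuous => //; exact: box_open_disc.
Qed.

(** Takes [q]-th roots of the two integral inequalities. The factors [2 pi] come from the normalised
    measure in [rho], and the sum [a + b] dominates both constants. *)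
Lemma rho_tent_comparable (M p q : R) (kappa : nat) : 1 / 2 < M -> 1 <= p -> 1 <= q ->
  exists2 C : R, 0 < C & forall G h, (forall z, normc z < 1 -> holo G z) -> weight_of kappa G h ->
    ((C^-1)%R%:E * tent_norm M p q 1 h <= rho p q h)%E /\ (rho p q h <= C%:E * tent_norm M p q 1 h)%E.
Proof.
move=> M2 p1 q1; have M0 : 0 < M by move: M2; clear; lra.
have q0 : 0 < q by exact: lt_le_trans q1.
have qi : 0 < q^-1 by rewrite invr_gt0.
have [K1 K10 H1] := tent_le_radial kappa M0 p1 q1.
have [K2 K20 H2] := radial_le_tent kappa M2 p1 q1.
have pp : 0 < 2 * pi :> R by rewrite mulr_gt0// pi_gt0.
pose a := (K1 * (2 * pi)) `^ q^-1; pose b := (K2 / (2 * pi)) `^ q^-1.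
have a0 : 0 < a by rewrite powR_gt0// mulr_gt0.
have b0 : 0 < b by rewrite powR_gt0// divr_gt0.
exists (a + b) => [|G h Gh hE]; first exact: addr_gt0.
pose A := (\int[mu]_(t in `[0%R, (2 * pi)%R]) (tent_power M p h t) `^ (q / p))%E.
pose B := (\int[mu]_(t in `[0%R, (2 * pi)%R]) (radial_power p h t) `^ (q / p))%E.
have A0 : (0 <= A)%E by apply: integral_ge0 => t _; exact: poweR_ge0.
have B0 : (0 <= B)%E by apply: integral_ge0 => t _; exact: poweR_ge0.
have AB : (A <= K1%:E * B)%E by exact: (H1 G h Gh hE).
have BA : (B <= K2%:E * A)%E by exact: (H2 G h Gh hE).
have tE : tent_norm M p q 1 h = (A `^ q^-1)%E by [].
have rE : rho p q h = ((((2 * pi)^-1)%R%:E * B) `^ q^-1)%E by [].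
rewrite tE rE; move: A B A0 B0 AB BA {H1 H2 tE rE} => A B A0 B0 AB BA.
have piE : (0 <= ((2 * pi)^-1)%R%:E :> \bar R)%E by rewrite lee_fin invr_ge0 ltW.
have X0 : (0 <= ((2 * pi)^-1)%R%:E * B)%E by exact: mule_ge0.
split.
  have H : (A `^ q^-1 <= (a + b)%:E * (((2 * pi)^-1)%R%:E * B) `^ q^-1)%E.
    apply: (@le_trans _ _ (a%:E * (((2 * pi)^-1)%R%:E * B) `^ q^-1)%E); last first.
      by apply: lee_wpmul2r; [exact: poweR_ge0|rewrite lee_fin lerDl ltW].
    rewrite /a -poweR_EFin -poweRM//; last by rewrite lee_fin mulr_ge0 ?(ltW K10) ?(ltW pp).
    apply: poweR_le => //; first exact: ltW.
    by rewrite muleA -EFinM mulrK// unitfE gt_eqF.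
  have Ci : (0 <= ((a + b)^-1)%R%:E :> \bar R)%E by rewrite lee_fin invr_ge0 ltW// addr_gt0.
  apply: (le_trans (lee_wpmul2l Ci H)); rewrite muleA -EFinM mulVf ?mul1e//.
  by rewrite gt_eqF// addr_gt0.
apply: (@le_trans _ _ (b%:E * A `^ q^-1)%E); last first.
  by apply: lee_wpmul2r; [exact: poweR_ge0|rewrite lee_fin lerDr ltW].
rewrite /b -poweR_EFin -poweRM//; last by rewrite lee_fin divr_ge0 ?(ltW K20) ?(ltW pp).
apply: poweR_le => //; first exact: ltW.
apply: (le_trans (lee_wpmul2l piE BA)).
by rewrite muleA -EFinM mulrC.
Qed.

End Comparison.

Theorem proposition3p1 (R : realType) (M p q : R)
  (hM : 2^-1 < M) (hp : 1 <= p) (hq : 1 <= q) :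
  [/\ asymp_on analytic_disc (rho p q) (tent_norm M p q 1),
      asymp_on analytic_disc (fun f => rho p q (cderiv_weighted f))
        (fun f => tent_norm M p q 1 (cderiv_weighted f))
    & RM p q = AT M p q 1].
Proof.
have M2 : 1 / 2 < M by rewrite div1r.
have fh (f : R[i] -> R[i]) : analytic_disc f -> forall z, normc z < 1 -> holo f z.
  by move=> fa z z1; apply/derivable_holo/fa.
have f'h (f : R[i] -> R[i]) : analytic_disc f -> forall z, normc z < 1 -> holo (cderiv f) z.
  (* The disc of radius [1 - |z|] about [z] stays inside the unit disc. *)
  move=> fa z z1; apply: (@holo_cderiv_holo _ f z (1 - normc z)); first by rewrite subr_gt0.
  move=> w wz; apply: fh => //; rewrite -[w](subrK z) (le_lt_trans (ler_normcD _ _))//.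
  by rewrite -ltrBrDr.
have w0 (f : R[i] -> R[i]) : weight_of 0 f f by move=> z _; rewrite expr0 mulr1.
have w1 (f : R[i] -> R[i]) : weight_of 1 (cderiv f) (cderiv_weighted f).
  move=> z z1; rewrite /cderiv_weighted normcM normc_real expr1 ger0_norm//.
  by rewrite subr_ge0 ltW.
have [C0 C00 H0] := rho_tent_comparable 0 M2 hp hq.
have [C1 C10 H1] := rho_tent_comparable 1 M2 hp hq.
split.
- by exists C0; split => // f fa; exact: (H0 f f (fh f fa) (w0 f)).
- by exists C1; split => // f fa; exact: (H1 _ _ (f'h f fa) (w1 f)).
(* Finiteness passes through the comparison in both directions, the constants being finite;
   membership in the tent space also asks for measurability, which follows from continuity. *)
apply/seteqP; split => f.
  move=> [fa fr]; split => //; split; first exact: analytic_measurable_disc.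
  have [H _] := H0 f f (fh f fa) (w0 f).
  have C0E : (0 <= C0%:E :> \bar R)%E by rewrite lee_fin ltW.
  have := lee_wpmul2l C0E H; rewrite muleA -EFinM divff ?gt_eqF// mul1e => /le_lt_trans; apply.
  by rewrite lte_mul_pinfty.
move=> [[_ ft] fa]; split => //.
have [_ H] := H0 f f (fh f fa) (w0 f).
apply: (le_lt_trans H); rewrite lte_mul_pinfty// lee_fin; exact: ltW.
Qed.
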